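(* Let $K$ be a field of characteristic $0$, let $k\geq 1$ be an integer and let $p=2k$ or $p=2k+1$. For each of the following partitions $\lambda$, with $n=|\lambda|$, the irreducible $S_n$-module $M(\lambda)$ appears with non-zero multiplicity in the $S_n$-module decomposition of $\Gamma_n(\mathfrak{N}_p)$: (i) $(p-1,1)$ and $(p-1,p-1)$; (ii) $(a+2,2^b,1^c)$ with integers $a,b,c\geq 0$, $b+c>0$, and $a+b+1\leq 2k-2$; (iii) $(l+3,l+1,1^{n-2l-4})$, $(l+2,l+2,1^{n-2l-4})$, and $(l+2,l+1,1^{n-2l-3})$, where $1\leq l\leq k-2$ (and $n$ is such that the exponents are non-negative); (iv) if $n$ is even, the partition $(1,1,\dots,1)=(1^n)$. In addition, if $p=2k+1$, the same holds for the following partitions $\lambda\vdash n$ with $n\leq 4k$: (v) $(a+2,2^b)$ for $a\geq 0$, $b>0$, and $a+b+1=2k$ or $a+b+1=2k-1$; (vi) $(a+2,2^b,1)$ for $a\geq 0$, $b\geq 0$, and $a+b+1=2k-1$.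
   Context: $K\langle X\rangle$ is the free unital associative $K$-algebra on $X=\{x_1,x_2,\dots\}$ and $K\langle X_n\rangle$ the free unital subalgebra generated by $x_1,\dots,x_n$. Commutators are left-normed: $[u_1,u_2]=u_1u_2-u_2u_1$, $[u_1,\dots,u_{m+1}]=[[u_1,\dots,u_m],u_{m+1}]$. $I_{p+1}$ is the two-sided ideal of $K\langle X\rangle$ generated by all commutators $[u_1,\dots,u_{p+1}]$, $u_i\in K\langle X\rangle$. $\mathfrak{N}_p$ is the variety of unital associative $K$-algebras satisfying $[x_1,\dots,x_{p+1}]=0$, and $F_n(\mathfrak{N}_p)=K\langle X_n\rangle/(I_{p+1}\cap K\langle X_n\rangle)$ is its relatively free algebra of rank $n$. $P_n\subset K\langle X_n\rangle$ is the space of multilinear polynomials of degree $n$ in $x_1,\dots,x_n$. A polynomial is proper if it is a linear combination of products of commutators $[x_{i_1},\dots,x_{i_r}]$ ($r\ge 2$) whose entries are variables. $\Gamma_n\subset P_n$ is the subspace of proper multilinear polynomials, and $\Gamma_n(\mathfrak{N}_p)$ is the image of $\Gamma_n$ in $F_n(\mathfrak{N}_p)$. $S_n$ acts by permuting variables. $M(\lambda)$ is the irreducible $S_n$-module corresponding to the partition $\lambda\vdash n$. In partitions, $2^b$ and $1^c$ mean $2$ repeated $b$ times and $1$ repeated $c$ times. *)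

(* Defs.v *)
From HB Require Import structures.
From mathcomp Require Import all_boot all_order all_algebra all_fingroup.
From mathcomp Require Import mxrepresentation.
From mathcomp Require Import boolp classical_sets.
From mathcomp Require Import monalg.

Set Implicit Arguments.
Unset Strict Implicit.
Unset Printing Implicit Defensive.

Import GRing.Theory.

Local Open Scope ring_scope.
Local Open Scope quotient_scope.

(* Not the coset representative of fingroup. *)
Local Notation repr := generic_quotient.repr.

Section QuotientLmodule.
Variables (K : fieldType) (V : lmodType K) (I : zmodClosed V).
Hypothesis scaleI : forall c : K, {in I, forall v, c *: v \in I}.

Lemma pi_quotP (u v : V) :
  reflect (\pi_{ideal_quot I} u = \pi_{ideal_quot I} v) (u - v \in I).
Proof. by rewrite Quotient.idealrBE; apply: eqP. Qed.

Definition quot_scale (c : K) (x : {ideal_quot I}) : {ideal_quot I} :=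
  \pi_{ideal_quot I} (c *: repr x).

Lemma pi_quot_scale c v :
  quot_scale c (\pi_{ideal_quot I} v) = \pi_{ideal_quot I} (c *: v).
Proof.
by apply/pi_quotP; rewrite -scalerBr scaleI //; apply/pi_quotP; rewrite reprK.
Qed.

Lemma quot_scaleA a b x : quot_scale a (quot_scale b x) = quot_scale (a * b) x.
Proof. by rewrite -[x]reprK (pi_quot_scale b) !pi_quot_scale scalerA. Qed.

Lemma quot_scale1 : left_id 1 quot_scale.
Proof. by move=> x; rewrite -[x]reprK pi_quot_scale scale1r. Qed.

Lemma quot_scaleDr : right_distributive quot_scale +%R.
Proof.
move=> a x y; rewrite -[x]reprK -[y]reprK -raddfD !pi_quot_scale.
by rewrite scalerDr raddfD.
Qed.

Lemma quot_scaleDl x : {morph quot_scale^~ x : a b / a + b}.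
Proof.
by move=> a b; rewrite -[x]reprK !pi_quot_scale scalerDl raddfD.
Qed.

End QuotientLmodule.

(* The free unital associative K-algebra on V, as the monoid algebra of the
   free monoid on V. *)
Notation freeAlg K V := {malg K[{fmonom V}]}.

Definition fvar (K : fieldType) (V : choiceType) (v : V) : freeAlg K V :=
  mkmalgU (fmu v) 1.

Definition word_eval (A : nzRingType) (V : choiceType) (u : V -> A)
    (m : {fmonom V}) : A :=
  \prod_(v <- fmonom_val m) u v.

(* The unital algebra morphism freeAlg K V -> freeAlg K W sending v to u v. *)
Definition fsubst (K : fieldType) (V W : choiceType) (u : V -> freeAlg K W)
    (f : freeAlg K V) : freeAlg K W :=
  mmap (@malgC {fmonom W} K) (word_eval u) f.

(* lcommutator [:: u_1; ...; u_m] is the left-normed [u_1, ..., u_m], m >= 1. *)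
Definition lcommutator (A : nzRingType) (s : seq A) : A :=
  foldl (fun u v => u * v - v * u) (head 0 s) (behead s).

Definition two_sided_ideal (A : nzRingType) (J : set A) : Prop :=
  [/\ J 0, forall u v, J u -> J v -> J (u + v) &
      forall a u, J u -> J (a * u) /\ J (u * a)].

Definition subspace (K : fieldType) (V : lmodType K) (W : set V) : Prop :=
  W 0 /\ forall (c : K) u v, W u -> W v -> W (c *: u + v).

Definition lspan (K : fieldType) (V : lmodType K) (G : set V) : set V :=
  smallest (@subspace K V) G.

(* The ideal I_m of K<X>; the variables x_1, x_2, ... are indexed from 0. *)
Definition commIdeal (K : fieldType) (m : nat) : set (freeAlg K nat) :=
  smallest (@two_sided_ideal (freeAlg K nat))
    [set f | exists2 s : seq (freeAlg K nat), size s = m & f = lcommutator s]%classic.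

Arguments commIdeal : clear implicits.

(* K<X_n> is freeAlg K 'I_n; finclude is its embedding into K<X>. *)
Definition finclude (K : fieldType) (n : nat) (f : freeAlg K 'I_n) :
    freeAlg K nat :=
  fsubst (fun i : 'I_n => fvar K (i : nat)) f.

(* The ideal of K<X_n> by which F_n(N_p) is the quotient. *)
Definition relIdeal (K : fieldType) (p n : nat) : {pred freeAlg K 'I_n} :=
  fun f => `[< commIdeal K p.+1 (finclude f) >].

Arguments relIdeal : clear implicits.

(* x_i |-> x_(s i); with the product of {perm _} this is a right action. *)
Definition permvar (K : fieldType) (n : nat) (f : freeAlg K 'I_n) (s : 'S_n) :
    freeAlg K 'I_n :=
  fsubst (fun i => fvar K (s i)) f.

Section FsubstTheory.
Variable K : fieldType.

Lemma word_eval_mmorph (A : nzRingType) (V : choiceType) (u : V -> A) :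
  mmorphism (word_eval u).
Proof.
split=> [m1 m2|]; last by rewrite /word_eval fm1 big_nil.
have -> : mmul m1 m2 = FMonom (fmonom_val m1 ++ fmonom_val m2).
  by rewrite -fmmulE.
by rewrite /word_eval big_cat.
Qed.

HB.instance Definition _ (A : nzRingType) (V : choiceType) (u : V -> A) :=
  isMultiplicative.Build {fmonom V} A (word_eval u) (word_eval_mmorph u).

Section Morph.
Variables (V W : choiceType) (u : V -> freeAlg K W).

Lemma fsubst_is_zmod_morphism : zmod_morphism (fsubst u).
Proof. by move=> f g; rewrite /fsubst raddfB. Qed.

Lemma malgC_comm (c : K) (g : freeAlg K W) : GRing.comm c%:MP g.
Proof.
rewrite /GRing.comm mul_malgC malgM_def malgZ_def fgmulgU.
by apply: eq_bigr => k _; rewrite mulm1 mulrC.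
Qed.

Lemma fsubst_is_monoid_morphism : monoid_morphism (fsubst u).
Proof.
have [|hM h1] := @commr_mmap_is_multiplicative {fmonom V} K
  (freeAlg K W) (@malgC {fmonom W} K) (word_eval u); last by split.
by move=> g m m'; apply: malgC_comm.
Qed.

HB.instance Definition _ :=
  GRing.isZmodMorphism.Build (freeAlg K V) (freeAlg K W) (fsubst u)
    fsubst_is_zmod_morphism.
HB.instance Definition _ :=
  GRing.isMonoidMorphism.Build (freeAlg K V) (freeAlg K W) (fsubst u)
    fsubst_is_monoid_morphism.

Lemma fsubstC (c : K) : fsubst u c%:MP = c%:MP.
Proof. by rewrite /fsubst mmapC. Qed.

Lemma fsubstZ (c : K) f : fsubst u (c *: f) = c *: fsubst u f.
Proof. by rewrite -mul_malgC rmorphM /= fsubstC mul_malgC. Qed.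

Lemma fsubst_var v : fsubst u (fvar K v) = u v.
Proof.
by rewrite /fsubst /fvar mmapU /= mpolyC1E mul1r /word_eval fmuE big_seq1.
Qed.
End Morph.

Lemma fsubst_comp (U V W : choiceType) (u : V -> freeAlg K W)
    (w : U -> freeAlg K V) f :
  fsubst u (fsubst w f) = fsubst (fun x => fsubst u (w x)) f.
Proof.
rewrite {2}/fsubst mmapE rmorph_sum; apply: eq_bigr => m _.
by rewrite rmorphM /= fsubstC /word_eval rmorph_prod.
Qed.

Lemma eq_fsubst (V W : choiceType) (u w : V -> freeAlg K W) :
  u =1 w -> fsubst u =1 fsubst w.
Proof.
move=> uw f; rewrite /fsubst !mmapE; apply: eq_bigr => m _.
by congr (_ * _); apply: eq_bigr => v _.
Qed.

Lemma rmorph_lcommutator (A B : nzRingType) (h : {rmorphism A -> B}) s :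
  h (lcommutator s) = lcommutator (map h s).
Proof.
case: s => [|a s]; rewrite /lcommutator /= ?rmorph0 //.
by elim: s a => //= b s IHs a; rewrite IHs rmorphB !rmorphM.
Qed.

End FsubstTheory.

Section RelFree.
Variables (K : fieldType) (p n : nat).

Lemma commIdeal_ideal m : two_sided_ideal (commIdeal K m).
Proof.
split=> [|u v Iu Iv|a u Iu].
- by move=> J [[J0 _ _] _].
- by move=> J hJ; have [[_ JD _] _] := hJ; exact: (JD _ _ (Iu J hJ) (Iv J hJ)).
- split=> J hJ; have [[_ _ JM] _] := hJ.
    exact: (JM a u (Iu J hJ)).1.
  exact: (JM a u (Iu J hJ)).2.
Qed.

Lemma relIdeal_submod_closed : submod_closed (relIdeal K p n).
Proof.
have [I0 ID IM] := commIdeal_ideal p.+1.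
split=> [|c f g /asboolP If /asboolP Ig]; apply/asboolP.
  by rewrite /finclude rmorph0; exact: I0.
rewrite /finclude rmorphD /= fsubstZ -mul_malgC.
exact: ID (IM _ _ If).1 Ig.
Qed.

Lemma relIdealZ (c : K) : {in relIdeal K p n, forall f, c *: f \in relIdeal K p n}.
Proof. exact: (GRing.subsemimod_closedZ relIdeal_submod_closed). Qed.

HB.instance Definition _ :=
  GRing.isSubmodClosed.Build K (freeAlg K 'I_n) (relIdeal K p n)
    relIdeal_submod_closed.

(* F_n(N_p) as a K-vector space. *)
Definition relfree := {ideal_quot relIdeal K p n}.

HB.instance Definition _ := EqQuotient.on relfree.
HB.instance Definition _ := GRing.Zmodule.on relfree.
HB.instance Definition _ := GRing.Zmodule_isLmodule.Build K relfree
  (quot_scaleA relIdealZ) (quot_scale1 relIdealZ)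
  (quot_scaleDr relIdealZ) (quot_scaleDl relIdealZ).

Lemma permvar_relIdeal s f :
  f \in relIdeal K p n -> permvar f s \in relIdeal K p n.
Proof.
pose t j := if insub j is Some i then val (s i) else j.
pose h := fsubst (fun j : nat => fvar K (t j)).
move=> /asboolP If; apply/asboolP.
have -> : finclude (permvar f s) = h (finclude f).
  rewrite /finclude /permvar /h !fsubst_comp; apply: eq_fsubst => i.
  by rewrite !fsubst_var /t valK.
have [I0 ID IM] := commIdeal_ideal p.+1.
apply: (If (fun g => commIdeal K p.+1 (h g))); split; last first.
  move=> _ [r sz_r ->]; apply: sub_gen_smallest.
  by exists (map h r); rewrite ?size_map // /h rmorph_lcommutator.
split=> [|u v Iu Iv|a u Iu].
- rewrite /h rmorph0; exact: I0.
- rewrite /h rmorphD; exact: ID Iu Iv.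
- have [Il Ir] := IM (h a) (h u) Iu.
  split.
    rewrite [X in commIdeal _ _ X](rmorphM (fsubst _)).
    exact: Il.
  rewrite [X in commIdeal _ _ X](rmorphM (fsubst _)).
  exact: Ir.
Qed.

Definition relfree_act (v : relfree) (s : 'S_n) : relfree :=
  \pi_relfree (permvar (repr v) s).

Lemma pi_relfree_act f s :
  relfree_act (\pi_relfree f) s = \pi_relfree (permvar f s).
Proof.
apply/pi_quotP; rewrite /permvar -rmorphB; apply: permvar_relIdeal.
by apply/pi_quotP; rewrite reprK.
Qed.

End RelFree.

Local Open Scope classical_set_scope.

(* P_n and Gamma_n; the empty product makes 1 a proper polynomial. *)
Definition multilinearPoly (K : fieldType) (n : nat) : set (freeAlg K 'I_n) :=
  lspan [set f | exists s : 'S_n, f = \prod_(i < n) fvar K (s i)].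

Definition properPoly (K : fieldType) (n : nat) : set (freeAlg K 'I_n) :=
  lspan [set f | exists2 cs : seq (seq 'I_n), all (fun c => 1 < size c)%N cs &
    f = \prod_(c <- cs) lcommutator [seq fvar K i | i <- c]].

Definition Gamma (K : fieldType) (n : nat) : set (freeAlg K 'I_n) :=
  @multilinearPoly K n `&` @properPoly K n.

Arguments multilinearPoly : clear implicits.
Arguments properPoly : clear implicits.
Arguments Gamma : clear implicits.

(* Gamma_n(N_p) *)
Definition relGamma (K : fieldType) (p n : nat) : set (relfree K p n) :=
  [set \pi_(relfree K p n) f | f in Gamma K n].

Arguments relGamma : clear implicits.

(* The diagram of lam is filled by rows with 0, 1, ..., sumn lam - 1: cell i
   is in row reshape_index lam i and column reshape_offset lam i. *)
Definition row_stab (lam : seq nat) : {set 'S_(sumn lam)} :=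
  [set s : 'S_(sumn lam) | [forall i, reshape_index lam (s i) == reshape_index lam i]]%SET.

Definition col_stab (lam : seq nat) : {set 'S_(sumn lam)} :=
  [set s : 'S_(sumn lam) | [forall i, reshape_offset lam (s i) == reshape_offset lam i]]%SET.

(* The Young symmetrizer, in the regular module with basis indexed by S_n. *)
Definition young_sym (K : fieldType) (lam : seq nat) :
    'rV[K]_#|[set: 'S_(sumn lam)]%G| :=
  \sum_(r in row_stab lam) \sum_(c in col_stab lam)
    (-1) ^+ c *: delta_mx 0 (gring_index [set: 'S_(sumn lam)]%G (r * c)%g).

(* M(lam), the right ideal of K[S_n] generated by the Young symmetrizer. *)
Definition specht (K : fieldType) (lam : seq nat) :=
  submod_repr (cyclic_mx_module (regular_repr K [set: 'S_(sumn lam)]%G)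
                                (young_sym K lam)).

(* rG is the matrix form of the S_n-submodule W of V. *)
Definition affords (K : fieldType) (n : nat) (V : lmodType K)
    (act : V -> 'S_n -> V) (W : set V)
    (d : nat) (rG : mx_representation K [set: 'S_n]%G d) : Prop :=
  exists phi : {linear 'rV[K]_d -> V},
    [/\ injective phi, range phi = W &
        forall v s, phi (v *m rG s) = act (phi v) s].

(* rG is a direct sum of simple modules, m of which are isomorphic to rM. *)
Definition has_multiplicity (K : fieldType) (gT : finGroupType) (G : {group gT})
    (d e : nat) (rG : mx_representation K G d) (rM : mx_representation K G e)
    (m : nat) : Prop :=
  exists (I : finType) (U : I -> 'M[K]_d),
    [/\ forall i, mxsimple rG (U i), (\sum_i U i :=: 1%:M)%MS,
        mxdirect (\sum_i U i) &
        #|[pred i | `[< exists modU : mxmodule rG (U i),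
                          mx_rsim (submod_repr modU) rM >]]| = m].

(* M(lam) appears with nonzero multiplicity in Gamma_n(N_p), n = |lam|. *)
Definition appears (K : fieldType) (p : nat) (lam : seq nat) : Prop :=
  exists d (rG : mx_representation K [set: 'S_(sumn lam)]%G d),
    affords (@relfree_act K p (sumn lam)) (relGamma K p (sumn lam)) rG /\
    exists2 m, has_multiplicity rG (specht K lam) m & m != 0%N.

(* Main.v *)
(* M(lambda) occurs in Gamma_n(N_p) as soon as a product f of commutators, multiplied
   by the Young symmetrizer, has a nonzero value in some algebra satisfying
   [x_1, ..., x_(p+1)] = 0. The variables are replaced by letters z_x attached to the
   cells x of the diagram. If words with a repeated letter vanish, summing over the
   row stabilizer amounts to evaluating f at the row sums y_r of the letters, so f
   need only be given as a product of commutators in the y_r; there remains the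
   alternating sum over the column stabilizer.

   The algebra is spanned by the products of distinct letters, where two letters
   commute or anticommute according to the scalar product over F_2 of their color
   vectors. A nonzero commutator of monomials consumes two letters of a common color,
   and this bounds the Lie class by the number of letters of colors other than a
   distinguished one (color 0), or by half of the total number of colors used.

   The value of f changes sign when two letters of the same odd color are exchanged
   within a column, so only the displacements of a few special cells matter. For the
   special cells and the first commutators chosen below, a displacement gives 0 or,
   in one family, a contribution of the same sign; f itself has a nonzero value
   because (g_1 + ... + g_s)^s = s! g_1 ... g_s for commuting g_i of square 0. *)
Require Import Defs.
From HB Require Import structures.
From mathcomp Require Import all_boot all_order all_algebra all_fingroup.
From mathcomp Require Import pgroup mxrepresentation.
From mathcomp Require boolp classical_sets monalg.
From mathcomp Require Import ring zify.

Set Implicit Arguments.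
Unset Strict Implicit.
Unset Printing Implicit Defensive.

Import GRing.Theory.

(** Only column 0 can be arbitrarily high for given p; hence it gets the distinguished color 0,
    which does not enter the first bound. That bound gives (ii), (iii) and (iv); the count of all
    colors gives (i), (v) and (vi). Letters of one column share an odd color, so they anticommute,
    and this cancels the sign of the column permutation. A cell of the arm is alone in its column
    and may have an even color: with [[:: 0; 1]] the letters of the arm commute, so their sum has a
    nonzero power, and they anticommute with those of column 0, so that brackets with the first row
    survive. The obstacle is parity. Two rows of equal length l split off as the l-th power of their
    commutator, which is central. The longer first row and the unpaired rows must be absorbed by a
    few long commutators, whose value depends on the parity of their length. A special cell of even
    color repairs a wrong parity at the cost of one more color; this is the origin of the terms
    [odd a] and [~~ odd a] in the final bounds. *)

Section YoungSymmetrizer.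
Import boolp.

(** * Young symmetrizers *)

Local Open Scope group_scope.
Local Open Scope ring_scope.

Section GroupRing.
Variables (K : fieldType) (gT : finGroupType) (G : {group gT}).
Local Notation aG := (regular_repr K G).
Local Notation nG := (gcard G).
Local Notation op := (gring_mx aG).

Definition left_mul_mx (v : 'rV[K]_nG) : 'M[K]_nG :=
  \matrix_i (v *m aG (enum_val i)).

Lemma mul_left_mul_mx (v x : 'rV[K]_nG) : x *m left_mul_mx v = v *m op x.
Proof.
rewrite /gring_mx /= [LHS]mulmx_sum_row [X in vec_mx X]mulmx_sum_row.
rewrite linear_sum mulmx_sumr /=.
by apply: eq_bigr => i _; rewrite !rowK linearZ /= mxvecK scalemxAr.
Qed.

Lemma left_mul_mx_hom v m (W : 'M_(m, nG)) : (W <= dom_hom_mx aG (left_mul_mx v))%MS.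
Proof.
apply/hom_mxP => x Gx; apply/row_matrixP => i.
by rewrite !row_mul !mul_left_mul_mx gring_mxJ // mulmxA.
Qed.

Lemma mxmodule_gring m (W : 'M_(m, nG)) x (v : 'rV_nG) :
  mxmodule aG W -> (v <= W)%MS -> (v *m op x <= W)%MS.
Proof.
by move=> modW vW; apply: (mxmodule_envelop modW _ vW); apply: gring_mxP.
Qed.

Hypothesis charG : [pchar K]^'.-group G.

(* If e A e = K e, a submodule W of e A either meets e A in e, or satisfies
   W W = 0 and then vanishes, being generated by an idempotent. *)
Lemma cyclic_mx_simple (e : 'rV[K]_nG) : e != 0 ->
    (forall x, exists c, e *m op x *m op e = c *: e) ->
  mxsimple aG (cyclic_mx aG e).
Proof.
move=> e0 eAe; split=> [||W modW sWe W0].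
- exact: cyclic_mx_module.
- by rewrite cyclic_mx_eq0.
apply: cyclic_mx_sub => //.
have inW (w : 'rV_nG) : (w <= W)%MS -> exists x, w = e *m op x.
  move=> wW; have /cyclic_mxP [A RA ->] := submx_trans wW sWe.
  by exists (gring_row A); rewrite gring_rowK.
case: (pselect (exists2 w : 'rV_nG, (w <= W)%MS & w *m op e != 0)).
  case=> w wW nz; have [x wE] := inW _ wW; have [c cE] := eAe x.
  rewrite wE cE in nz; have c0 : c != 0.
    by apply: contraNneq nz => ->; rewrite scale0r.
  rewrite -(eqmx_scale _ c0) -cE -wE; exact: mxmodule_gring.
move=> noW; have We0 (w : 'rV_nG) : (w <= W)%MS -> w *m op e = 0.
  by move=> wW; apply/eqP; apply: contra_notT noW => h; exists w.
(* With W' a complement of W, write 1 = u + u'. For w in W, u w = 0 since W e = 0 and w lies in e A;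
   so w = u' w lies in W' as well. *)
have [W' modW' /eqmxP/andP[_ s1] /mxdirect_addsP dxW] :=
  mx_Maschke_pchar aG charG modW (submx1 _).
have /sub_addsmxP [[u u'] /= uE] :=
  submx_trans (submx1 (gring_row (1%:M : 'M[K]_nG))) s1.
case/negP: W0; apply/eqP/row_matrixP => i; rewrite row0.
set w := row i W; have wW : (w <= W)%MS by apply: row_sub.
have : (w <= W :&: W')%MS.
  rewrite sub_capmx wW /=.
  have [x wE] := inW _ wW.
  have -> : w = u' *m W' *m op w.
    transitivity (gring_row (1%:M : 'M[K]_nG) *m op w).
      by rewrite -gring_row_mul mul1mx gring_mxK.
    rewrite uE mulmxDl [X in X + _](_ : _ = 0) ?add0r //.
    by rewrite wE gring_mxA mulmxA We0 ?mul0mx // submxMl.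
  by apply: mxmodule_gring => //; apply: submxMl.
by rewrite dxW submx0 => /eqP.
Qed.

(** Left multiplication by v maps e A into W; followed by the projection to U along Kr it is
    nonzero, because v e is not in Kr. By Schur its image is a copy of e A inside U, so any
    decomposition of U into simple modules has a component isomorphic to e A. *)
Lemma has_multiplicity_regular (U Kr W : 'M[K]_nG) (modU : mxmodule aG U)
    (v e : 'rV[K]_nG) :
    mxmodule aG Kr -> mxmodule aG W -> (Kr + U :=: W)%MS -> (Kr :&: U = 0)%MS ->
    mxsimple aG (cyclic_mx aG e) ->
    (v <= W)%MS -> ~~ (v *m op e <= Kr)%MS ->
  exists2 m, has_multiplicity (submod_repr modU)
     (submod_repr (cyclic_mx_module aG e)) m & m != 0%N.
Proof.
move=> modK modW defW dxW simS vW nve.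
pose S := cyclic_mx aG e.
pose f := left_mul_mx v; pose p := proj_mx U Kr; pose N := f *m p.
have defW' : (U + Kr :=: W)%MS by rewrite addsmxC.
have dxW' : (U :&: Kr = 0)%MS by rewrite capmxC.
have fW m (X : 'M_(m, nG)) : (X *m f <= W)%MS.
  apply/row_subP => i; rewrite row_mul mul_left_mul_mx; exact: mxmodule_gring.
have homN : (S <= dom_hom_mx aG N)%MS.
  have homp : (S *m f <= dom_hom_mx aG p)%MS.
    apply: submx_trans (fW _ _) _; rewrite -defW'; exact: proj_mx_hom.
  apply/hom_mxP => x Gx; rewrite [LHS]mulmxA [S *m N]mulmxA.
  by rewrite (hom_mxP (left_mul_mx_hom v S)) // (hom_mxP homp).
have sNU : (S *m N <= U)%MS by rewrite mulmxA proj_mx_sub.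
have nzN : S *m N != 0.
  apply: contraNneq nve => SN0; rewrite -mul_left_mul_mx -/f.
  have eN0 : e *m f *m p = 0.
    by rewrite -mulmxA; have /submxP[y ->] := cyclic_mx_id aG e; rewrite -mulmxA SN0 mulmx0.
  have : (e *m f <= U + Kr)%MS by rewrite defW' fW.
  by move/proj_mx_compl_sub; rewrite -/p eN0 subr0.
have isoS : mx_iso aG S (S *m N) by apply: mx_Schur_inj_iso.
pose rU := submod_repr modU.
have redU : mx_completely_reducible rU 1%:M by apply: mx_Maschke_pchar.
(* [mx_reducible_semisimple] delivers the decomposition only toward a boolean goal, whence the
   detour by contradiction. *)
have semU : inhabited (mxsemisimple rU 1%:M).
  apply: contrapT => nsem.
  suff: false by [].
  by apply: (mx_reducible_semisimple (mxmodule1 rU) redU) => sem; case: nsem.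
have [[I V V0 simV defV dxV]] := semU.
pose T := in_submod U (S *m N).
have modSN := hom_mxmodule homN (cyclic_mx_module aG e).
have modSN' : mxmodule aG <<S *m N>>%MS by rewrite (eqmx_module _ (genmxE _)).
have sNU' : (<<S *m N>> <= U)%MS by rewrite genmxE.
have [modT rsT] := mx_rsim_in_submod modSN' modU sNU'.
have rsST : mx_rsim (submod_repr (cyclic_mx_module aG e)) (submod_repr modT).
  apply: mx_rsim_trans rsT; apply/mx_rsim_iso.
  by apply: mx_iso_trans isoS _; apply: eqmx_iso; apply: eqmx_sym (genmxE _).
have simT : mxsimple rU <<in_submod U <<S *m N>>>>%MS.
  by apply/(submod_mx_irr modT); apply: mx_rsim_irr rsST _; apply/submod_mx_irr.
have [] := @hom_mxsemisimple_iso _ _ _ _ rU I predT _ V 1%:M simT.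
- by move=> i _ _; apply: simV.
- exact: scalar_mx_hom.
- by rewrite mulmx1 defV submx1.
move=> i0 _ iso0; eexists; last first.
  suff : (0 < #|[pred i | `[< exists modV : mxmodule rU (V i),
      mx_rsim (submod_repr modV) (submod_repr (cyclic_mx_module aG e)) >]]|)%N.
    by rewrite lt0n; apply.
  apply/card_gt0P; exists i0; rewrite inE; apply/asboolP.
  exists (mxsimple_module (simV i0)); apply: mx_rsim_sym.
  by apply: mx_rsim_trans rsST _; apply/mx_rsim_iso; apply: mx_iso_sym.
by exists I, V; split=> //; rewrite defV.
Qed.
End GroupRing.

(** * Row and column permutations of a diagram *)

Local Open Scope nat_scope.

Section Cells.
Variable lam : seq nat.
Local Notation n := (sumn lam).

Definition crow (i : 'I_n) : nat := reshape_index lam i.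
Definition ccol (i : 'I_n) : nat := reshape_offset lam i.

Lemma crow_lt i : crow i < size lam.
Proof. exact: reshape_indexP. Qed.

Lemma ccol_lt i : ccol i < nth 0 lam (crow i).
Proof. exact: reshape_offsetP. Qed.

Lemma cell_inj i j : crow i = crow j -> ccol i = ccol j -> i = j.
Proof.
move=> er ec; apply: val_inj; rewrite /= -(reshape_indexK lam i) -(reshape_indexK lam j).
by rewrite -/(crow i) -/(ccol i) er ec.
Qed.

Lemma cellP r j : j < nth 0 lam r ->
  exists2 i : 'I_n, crow i = r & ccol i = j.
Proof.
move=> hj; have hi := flatten_indexP hj.
exists (Ordinal hi); rewrite /crow /ccol /=.
  exact: flatten_indexKl.
exact: flatten_indexKr.
Qed.

Lemma row_stabP (s : 'S_n) :
  reflect (forall i, crow (s i) = crow i) (s \in row_stab lam).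
Proof. by rewrite inE; apply: (iffP forallP) => h i; apply/eqP; apply: h. Qed.

Lemma col_stabP (s : 'S_n) :
  reflect (forall i, ccol (s i) = ccol i) (s \in col_stab lam).
Proof. by rewrite inE; apply: (iffP forallP) => h i; apply/eqP; apply: h. Qed.

Lemma card_row_lt r m : m <= nth 0 lam r ->
  m <= #|[set x : 'I_n | (crow x == r) && (ccol x < m)]|.
Proof.
move=> hm; have cell (j : 'I_m) : {i : 'I_n | (crow i == r) && (ccol i == j)}.
  by apply: sigW; have [i er ec] := cellP (leq_trans (ltn_ord j) hm); exists i; rewrite er ec !eqxx.
rewrite -{1}(card_ord m) -(card_imset _ (_ : injective (fun j => sval (cell j)))).
  apply: subset_leq_card; apply/subsetP => _ /imsetP[j _ ->].
  by rewrite inE; case: (cell j) => i /= /andP[-> /eqP->] /=.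
move=> j k e; apply: val_inj; move: e.
by case: (cell j) => i /= /andP[_ /eqP<-]; case: (cell k) => i' /= /andP[_ /eqP<-] ->.
Qed.

(* If g separates the columns of every row, then row i of g has at most
   min(lam_i, m) cells in the first m columns; summing over i shows that these
   are equalities, so no cell of row i is sent beyond column lam_i. *)
Lemma ccol_perm_lt (g : 'S_n) :
    (forall x y, crow x = crow y -> ccol (g x) = ccol (g y) -> x = y) ->
  forall x, ccol (g x) < nth 0 lam (crow x).
Proof.
move=> sepg x0; set m := nth 0 lam (crow x0).
pose A r := [set x : 'I_n | (crow x == r) && (ccol (g x) < m)].
pose B r := [set x : 'I_n | (crow x == r) && (ccol x < m)].
have leAB r : #|A r| <= #|B r|.
  have [lem|/ltnW lem] := leqP (nth 0 lam r) m.
    apply: subset_leq_card; apply/subsetP => x; rewrite !inE => /andP[/eqP er _].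
    by rewrite er eqxx /= (leq_trans (ccol_lt x)) ?er.
  apply: leq_trans (card_row_lt lem).
  rewrite /A; case: (m) => [|k].
    by rewrite leqn0 cards_eq0; apply/eqP/setP => x; rewrite !inE andbF.
  rewrite -[X in _ <= X](card_ord k.+1).
  rewrite -(@card_in_imset _ _ (fun x => inord (ccol (g x)) : 'I_k.+1)); first exact: max_card.
  move=> x y; rewrite !inE => /andP[/eqP rx cx] /andP[/eqP ry cy] /(congr1 val) /=.
  by rewrite !inordK // => /sepg; apply; rewrite rx ry.
have split_rows (P : pred 'I_n) :
    \sum_(r < size lam) #|[set x | (crow x == r) && P x]| = #|[set x | P x]|.
  rewrite -sum1_card (partition_big (fun x => Ordinal (crow_lt x)) predT) //=.
  apply: eq_bigr => r _; rewrite -sum1_card; apply: eq_bigl => x.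
  by rewrite !inE andbC.
have sumAB : \sum_(r < size lam) #|A r| = \sum_(r < size lam) #|B r|.
  rewrite (split_rows (fun x => ccol (g x) < m)) (split_rows (fun x => ccol x < m)).
  rewrite -(card_imset _ (@perm_inj _ g)); apply: eq_card => x; rewrite !inE.
  apply/imsetP/idP => [[y]|]; first by rewrite inE => h ->.
  by move=> h; exists ((g^-1)%g x); rewrite ?inE permKV.
have [_ /esym] := leqif_sum (fun (r : 'I_(size lam)) (_ : true) =>
  leqif_eq (leAB r)).
rewrite sumAB eqxx => /forallP /(_ (Ordinal (crow_lt x0))) /= /eqP eqAB.
have sAB : A (crow x0) \subset B (crow x0).
  apply/subsetP => x; rewrite !inE => /andP[/eqP er _].
  by rewrite er eqxx /= /m -er ccol_lt.
have : x0 \in B (crow x0) by rewrite inE eqxx /= ccol_lt.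
have [_ /esym] := subset_leqif_cards sAB; rewrite eqAB eqxx => /eqP <-.
by rewrite inE => /andP[_].
Qed.

(** The classical combinatorial lemma behind Young symmetrizers. If g separates the columns of every
    row, [ccol_perm_lt] provides a cell in the row of x and the column of g x; sending x to it is
    the row permutation r, and r^-1 g preserves columns. *)
Lemma row_col_dichotomy (g : 'S_n) :
  (exists x y, [/\ x != y, crow x = crow y & ccol (g x) = ccol (g y)]) \/
  (exists2 r, r \in row_stab lam & exists2 c, c \in col_stab lam & g = (r * c)%g).
Proof.
case: (boolP [exists x, [exists y, [&& x != y, crow x == crow y & ccol (g x) == ccol (g y)]]]).
  by move=> /existsP[x /existsP[y /and3P[? /eqP ? /eqP ?]]]; left; exists x, y.
move=> /existsPn h; right.
have sepg x y : crow x = crow y -> ccol (g x) = ccol (g y) -> x = y.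
  move=> er ec; apply/eqP; have /existsPn /(_ y) := h x.
  by rewrite er ec !eqxx !andbT negbK.
have cell x : {i : 'I_n | (crow i == crow x) && (ccol i == ccol (g x))}.
  by apply: sigW; have [i er ec] := cellP (ccol_perm_lt sepg x); exists i; rewrite er ec !eqxx.
pose f x := sval (cell x).
have fP x : crow (f x) = crow x /\ ccol (f x) = ccol (g x).
  by rewrite /f; case: (cell x) => i /= /andP[/eqP-> /eqP->].
have f_inj : injective f.
  move=> x y e; apply: sepg.
    by rewrite -(fP x).1 -(fP y).1 e.
  by rewrite -(fP x).2 -(fP y).2 e.
pose r := perm f_inj; exists r.
  by apply/row_stabP => x; rewrite permE (fP x).1.
exists (r^-1 * g)%g; last by rewrite mulKVg.
by apply/col_stabP => x; rewrite permM -(fP _).2 -(permE f_inj) -/r permKV.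
Qed.
End Cells.

Local Open Scope ring_scope.

Lemma gring_mx_delta (K : fieldType) (gT : finGroupType) (G : {group gT}) (g : gT) :
  g \in G -> gring_mx (regular_repr K G) (delta_mx 0 (gring_index G g)) = regular_repr K G g.
Proof. by move=> Gg; rewrite /gring_mx /= -rowE rowK mxvecK gring_indexK. Qed.

Section Young.
Variables (K : fieldType) (lam : seq nat).
Local Notation n := (sumn lam).
Local Notation G := [set: 'S_n]%G.
Local Notation aG := (regular_repr K G).
Local Notation op := (gring_mx aG).
Local Notation e := (young_sym K lam).

Definition row_sum : 'M[K]_(gcard G) := \sum_(r in row_stab lam) aG r.
Definition col_altsum : 'M[K]_(gcard G) := \sum_(c in col_stab lam) (-1) ^+ c *: aG c.

Lemma op_young : op e = row_sum *m col_altsum.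
Proof.
rewrite /young_sym linear_sum mulmx_suml; apply: eq_bigr => r _.
rewrite linear_sum mulmx_sumr; apply: eq_bigr => c _.
by rewrite linearZ /= gring_mx_delta ?inE // -scalemxAr repr_mxM ?inE.
Qed.

Lemma mul_row_sum g : g \in row_stab lam -> row_sum *m aG g = row_sum.
Proof.
move=> hg; rewrite mulmx_suml [RHS](reindex_inj (mulIg g)) /=.
apply: eq_big => [r|r _]; last by rewrite repr_mxM ?inE.
apply/row_stabP/row_stabP => h i; first by rewrite permM (row_stabP _ hg) h.
by have := h i; rewrite permM (row_stabP _ hg).
Qed.

Lemma mul_col_altsum g : g \in col_stab lam -> aG g *m col_altsum = (-1) ^+ g *: col_altsum.
Proof.
move=> hg; rewrite mulmx_sumr scaler_sumr [RHS](reindex_inj (mulgI g)) /=.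
apply: eq_big => [c|c _].
  apply/col_stabP/col_stabP => h i; first by rewrite permM h (col_stabP _ hg).
  by have := h ((g^-1)%g i); rewrite permM permKV => ->; rewrite -{2}(permKV g i) (col_stabP _ hg).
rewrite -scalemxAr -repr_mxM ?inE // scalerA odd_permM signr_addb mulrA.
by rewrite -expr2 sqrr_sign mul1r.
Qed.

(** If two cells x, y of a row go to the same column, their transposition is absorbed by the row
    sum, while its conjugate by g is an odd column permutation; the product is then its own
    opposite. Otherwise g = r c, and r and c are absorbed up to sign. *)
Lemma row_col_sum_sandwich g : (2%:R != 0 :> K) ->
  exists k, row_sum *m aG g *m col_altsum = k *: (row_sum *m col_altsum).
Proof.
move=> two0; case: (row_col_dichotomy g) => [[x [y [xy er ec]]]|].
  pose t := tperm x y; exists 0; rewrite scale0r.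
  have tR : t \in row_stab lam.
    by apply/row_stabP => i; rewrite /t; case: tpermP => // ->.
  have tC : (t ^ g)%g \in col_stab lam.
    by rewrite /t tpermJ; apply/col_stabP => i; case: tpermP => // ->.
  have sgt : (-1) ^+ (t ^ g)%g = -1 :> K.
    by rewrite /t tpermJ odd_tperm (inj_eq perm_inj) xy.
  set M := _ *m _; suff: M = - M.
    move/eqP; rewrite -addr_eq0 -mulr2n -scaler_nat scaler_eq0 (negPf two0) /=.
    by move/eqP.
  rewrite {1}/M -(mul_row_sum tR) -(mulmxA row_sum) -repr_mxM ?inE // conjgC.
  rewrite repr_mxM ?inE // !mulmxA -(mulmxA _ (aG (t ^ g)%g)) mul_col_altsum //.
  by rewrite sgt scaleN1r mulmxN.
move=> [r hr [c hc ->]]; exists ((-1) ^+ c).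
rewrite repr_mxM ?inE // mulmxA mul_row_sum // -mulmxA mul_col_altsum //.
by rewrite scalemxAr.
Qed.

(** With e = R C, one has e x e = R (C x R) C, and the middle factor is a combination of group
    elements. *)
Lemma young_sandwich : (2%:R != 0 :> K) -> forall x, exists c, e *m op x *m op e = c *: e.
Proof.
move=> two0 x.
have sand (X : 'M_(gcard G)) : (X \in group_ring K G)%MS ->
    exists k, row_sum *m X *m col_altsum = k *: (row_sum *m col_altsum).
  case/envelop_mxP => a ->.
  pose k g := sval (cid (row_col_sum_sandwich g two0)).
  exists (\sum_(g in G) a g * k g).
  rewrite [X in X *m col_altsum]mulmx_sumr mulmx_suml scaler_suml; apply: eq_bigr => g _.
  rewrite -scalemxAr -scalemxAl /k; case: (cid _) => c /= ->.
  by rewrite scalerA.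
have Ra : (row_sum \in group_ring K G)%MS.
  rewrite /row_sum linear_sum summx_sub // => r _; exact: (envelop_mx_id aG).
have Rb : (col_altsum \in group_ring K G)%MS.
  rewrite /col_altsum linear_sum summx_sub // => c _; rewrite linearZ scalemx_sub //.
  exact: (envelop_mx_id aG).
have [|k hk] := sand (col_altsum *m op x *m row_sum).
  by apply: envelop_mxM Ra; apply: envelop_mxM => //; apply: gring_mxP.
exists k; apply: (can_inj (@gring_mxK _ _ _)).
by rewrite !gring_mxA linearZ /= op_young -hk !mulmxA.
Qed.
End Young.
End YoungSymmetrizer.

Section Evaluation.
Import boolp classical_sets monalg.

(** * Evaluation of symmetrized polynomials *)

Local Open Scope quotient_scope.
Local Open Scope group_scope.
Local Open Scope ring_scope.

(** Among the matrices whose row space satisfies P take one of maximal rank; adjoining a vector of P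
    cannot raise the rank. *)
Lemma subspace_mx (K : fieldType) N (P : 'rV[K]_N -> Prop) :
    P 0 -> (forall c u v, P u -> P v -> P (c *: u + v)) ->
  exists M : 'M[K]_N, forall v, P v <-> (v <= M)%MS.
Proof.
move=> P0 PD.
pose Q r := `[< exists M : 'M[K]_N, (forall v, (v <= M)%MS -> P v) /\ \rank M = r >].
have Q0 : exists r, Q r.
  exists 0%N; apply/asboolP; exists 0; split; last exact: mxrank0.
  by move=> v; rewrite submx0 => /eqP->.
have Qle r : Q r -> (r <= N)%N.
  by move=> /asboolP[M [_ <-]]; apply: rank_leq_row.
case: (ex_maxnP Q0 Qle) => r /asboolP[M [PM rM]] maxr.
exists M => v; split=> [Pv|]; last exact: PM.
have /maxr : Q (\rank (M + v)%MS).
  apply/asboolP; exists (M + v)%MS; split=> // w /sub_addsmxP[[a b] /= ->].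
  have [c ->] : exists c, b *m v = c *: v.
    by exists (b 0 0); rewrite {1}(mx11_scalar b) mul_scalar_mx.
  by rewrite addrC; apply: PD => //; apply: PM; apply: submxMl.
rewrite -rM => le_rank; apply: submx_trans (addsmxSr M v) _.
by rewrite -(geq_leqif (mxrank_leqif_sup (addsmxSl M v))).
Qed.

Lemma char0_pgroup (K : fieldType) (gT : finGroupType) (G : {group gT}) :
  [pchar K] =i pred0 -> [pchar K]^'.-group G.
Proof.
move=> charK; rewrite /pgroup /pnat cardG_gt0; apply/allP => q _.
by rewrite inE /= charK.
Qed.

Section PermvarTheory.
Variables (K : fieldType) (n : nat).
Implicit Types (f g : freeAlg K 'I_n) (s t : 'S_n).

Lemma permvarM f s t : permvar (permvar f s) t = permvar f (s * t)%g.
Proof.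
by rewrite /permvar fsubst_comp; apply: eq_fsubst => i; rewrite fsubst_var permM.
Qed.

Lemma permvarD f g s : permvar (f + g) s = permvar f s + permvar g s.
Proof. exact: rmorphD. Qed.

Lemma permvarZ c f s : permvar (c *: f) s = c *: permvar f s.
Proof. exact: fsubstZ. Qed.

Lemma permvar0 s : permvar (0 : freeAlg K 'I_n) s = 0.
Proof. exact: rmorph0. Qed.

Lemma permvar_sum I (r : seq I) (P : pred I) (F : I -> freeAlg K 'I_n) s :
  permvar (\sum_(i <- r | P i) F i) s = \sum_(i <- r | P i) permvar (F i) s.
Proof. exact: rmorph_sum. Qed.

Definition perm_word s : freeAlg K 'I_n := \prod_(i < n) fvar K (s i).

Lemma permvar_word s t : permvar (perm_word s) t = perm_word (s * t)%g.
Proof.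
rewrite /permvar /perm_word rmorph_prod; apply: eq_bigr => i _.
by rewrite /= fsubst_var permM.
Qed.

Lemma lspan_subspace (V : lmodType K) (A : set V) : subspace (lspan A).
Proof.
split=> [|c u v Au Av]; first by move=> J [[]].
by move=> J hJ; have [[_ JD] _] := hJ; apply: JD; [apply: Au | apply: Av].
Qed.

Lemma lspan_gen (V : lmodType K) (A : set V) v : A v -> lspan A v.
Proof. by move=> Av J [_]; apply. Qed.

Lemma permvar_properPoly s f : properPoly K n f -> properPoly K n (permvar f s).
Proof.
have [S0 SD] : subspace (properPoly K n) := lspan_subspace _.
move=> Pf; apply: (Pf (fun g => properPoly K n (permvar g s))); split.
  split=> [|c u v Pu Pv]; first by rewrite permvar0; exact: S0.
  by rewrite permvarD permvarZ; apply: SD.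
move=> _ [cs cs1 ->]; apply: lspan_gen.
exists [seq map s c | c <- cs].
  by rewrite all_map; apply: sub_all cs1 => c /=; rewrite size_map.
rewrite /permvar rmorph_prod big_map; apply: eq_bigr => c _ /=.
rewrite rmorph_lcommutator -!map_comp; congr lcommutator.
by apply: eq_map => i /=; rewrite fsubst_var.
Qed.

Lemma permvar_multilinearPoly s f :
  multilinearPoly K n f -> multilinearPoly K n (permvar f s).
Proof.
have [S0 SD] : subspace (multilinearPoly K n) := lspan_subspace _.
move=> Pf; apply: (Pf (fun g => multilinearPoly K n (permvar g s))); split.
  split=> [|c u v Pu Pv]; first by rewrite permvar0; exact: S0.
  by rewrite permvarD permvarZ; apply: SD.
move=> _ [t ->]; apply: lspan_gen.
by exists (t * s)%g; apply: permvar_word.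
Qed.

Lemma Gamma_subspace : subspace (Gamma K n).
Proof.
have [S0 SD] : subspace (multilinearPoly K n) := lspan_subspace _.
have [T0 TD] : subspace (properPoly K n) := lspan_subspace _.
by split=> [|c u v [u1 u2] [v1 v2]]; split; [exact: S0|exact: T0|exact: SD|exact: TD].
Qed.

Lemma permvar_Gamma s f : Gamma K n f -> Gamma K n (permvar f s).
Proof.
by move=> [f1 f2]; split; [exact: permvar_multilinearPoly|exact: permvar_properPoly].
Qed.
End PermvarTheory.

(** * The module of proper multilinear polynomials inside the regular module *)

Section Affords.
Variables (K : fieldType) (p n : nat).
Hypothesis charK : [pchar K] =i pred0.
Local Notation G := [set: 'S_n]%G.
Local Notation aG := (regular_repr K G).
Local Notation N := (gcard G).

(** The regular module as a model of P_n: s corresponds to the word with letters x_(s i), and right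
    multiplication to the permutation of variables. *)
Definition multi_of (v : 'rV[K]_N) : freeAlg K 'I_n :=
  \sum_i v 0 i *: perm_word K (enum_val i).

Lemma multi_of_linear : linear multi_of.
Proof.
move=> c u v; rewrite /multi_of scaler_sumr -big_split /=.
by apply: eq_bigr => i _; rewrite !mxE scalerDl scalerA.
Qed.
HB.instance Definition _ :=
  GRing.isLinear.Build K 'rV[K]_N (freeAlg K 'I_n) *:%R multi_of multi_of_linear.

Lemma multi_ofZ c v : multi_of (c *: v) = c *: multi_of v.
Proof. exact: linearZ. Qed.

Lemma multi_of_delta s : multi_of (delta_mx 0 (gring_index G s)) = perm_word K s.
Proof.
rewrite /multi_of (bigD1 (gring_index G s)) //= big1 ?addr0.
  by rewrite mxE !eqxx scale1r gring_indexK ?inE.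
by move=> i ne; rewrite mxE eqxx /= (negPf ne) scale0r.
Qed.

Lemma multi_ofJ v s : multi_of (v *m aG s) = permvar (multi_of v) s.
Proof.
rewrite [v in LHS]row_sum_delta mulmx_suml linear_sum /= permvar_sum.
apply: eq_bigr => i _; rewrite -scalemxAl linearZ /= permvarZ permvar_word.
by rewrite -rowE rowK multi_of_delta.
Qed.

Lemma multi_of_surj f : multilinearPoly K n f -> exists v, f = multi_of v.
Proof.
move=> Pf; apply: (Pf (fun f => exists v, f = multi_of v)); split.
  split=> [|c _ _ [u ->] [v ->]]; first by exists 0; rewrite linear0.
  by exists (c *: u + v); rewrite linearP.
by move=> _ [s ->]; exists (delta_mx 0 (gring_index G s)); rewrite multi_of_delta.
Qed.
End Affords.

Section PiRelfree.
Variables (K : fieldType) (p n : nat).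
Lemma pi_relfreeP (c : K) (a b : freeAlg K 'I_n) :
  \pi_(relfree K p n) (c *: a + b) =
  (c *: (\pi_(relfree K p n) a : relfree K p n) + \pi_(relfree K p n) b : relfree K p n).
Proof.
have E : (c *: (\pi_(relfree K p n) a : relfree K p n) : relfree K p n) =
    quot_scale c (\pi_{ideal_quot (relIdeal K p n)} a) by [].
rewrite E.
rewrite (pi_quot_scale (@relIdealZ K p n) c a).
exact: (raddfD (\pi_{ideal_quot (relIdeal K p n)})).
Qed.
End PiRelfree.

Section Affords.
Variables (K : fieldType) (p n : nat).
Local Notation G := [set: 'S_n]%G.
Local Notation aG := (regular_repr K G).
Local Notation N := (gcard G).
Local Notation multi_of := (@multi_of K n).

Definition multi_pi (U : 'M[K]_N) (v : 'rV[K]_(\rank U)) : relfree K p n :=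
  \pi_(relfree K p n) (multi_of (val_submod v)).

Lemma multi_pi_linear U : linear (@multi_pi U).
Proof.
move=> c u v; rewrite /multi_pi.
have -> : multi_of (val_submod (c *: u + v)) =
    c *: multi_of (val_submod u) + multi_of (val_submod v).
  by rewrite -multi_of_linear; congr (multi_of _); rewrite linearP.
exact: pi_relfreeP.
Qed.
HB.instance Definition _ U :=
  GRing.isLinear.Build K 'rV[K]_(\rank U) (relfree K p n) *:%R (@multi_pi U)
    (@multi_pi_linear U).

Lemma pi_relfree_eq (f g : freeAlg K 'I_n) :
  \pi_(relfree K p n) f = \pi_(relfree K p n) g <-> f - g \in relIdeal K p n.
Proof. by split=> h; apply/(pi_quotP (relIdeal K p n)). Qed.

(** W is Gamma_n and Kr its part inside the ideal, so Gamma_n(N_p) is W / Kr. A complement U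
    realizes this quotient as a submodule of the regular module. *)
Lemma affords_complement (U Kr W : 'M[K]_N) (modU : mxmodule aG U) :
    (Kr + U :=: W)%MS -> (Kr :&: U = 0)%MS ->
    (forall v, Gamma K n (multi_of v) <-> (v <= W)%MS) ->
    (forall v, Gamma K n (multi_of v) /\ multi_of v \in relIdeal K p n <-> (v <= Kr)%MS) ->
  affords (@relfree_act K p n) (relGamma K p n) (submod_repr modU).
Proof.
move=> defW dxW WP KP.
have UW (v : 'rV_(\rank U)) : Gamma K n (multi_of (val_submod v)).
  by apply/WP; rewrite -defW; apply: submx_trans (addsmxSr _ _); apply: val_submodP.
exists (@multi_pi U); split.
- move=> u v /pi_relfree_eq h; apply/(@val_submod_inj _ _ U 1)/eqP.
  rewrite -subr_eq0 -submx0 -dxW sub_capmx.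
  have -> : val_submod u - val_submod v = val_submod (u - v) by rewrite linearB.
  rewrite val_submodP andbT; apply/KP; split; first exact: UW.
  have -> : multi_of (val_submod (u - v)) = multi_of (val_submod u) - multi_of (val_submod v).
    by rewrite -linearB; congr (multi_of _); rewrite linearB.
  exact: h.
- apply/seteqP; split=> [_ [v _ <-]|_ [f Gf <-]]; first by exists (multi_of (val_submod v)).
  have [v fv] := multi_of_surj Gf.1.
  have /WP : Gamma K n (multi_of v) by rewrite -fv.
  rewrite -defW => /sub_addsmxP[[a b] /= vE].
  exists (in_submod U (b *m U)) => //; rewrite /multi_pi in_submodK ?submxMl //.
  apply/pi_relfree_eq; rewrite fv -linearB /= vE opprD addrCA subrr addr0 linearN /=.
  rewrite rpredN; exact: ((KP (a *m Kr)).2 (submxMl _ _)).2.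
- move=> v s.
  change (multi_pi (v *m submod_repr modU s) = relfree_act (multi_pi v) s).
  rewrite /multi_pi.
  have -> : val_submod (v *m submod_repr modU s) = val_submod v *m aG s.
    by rewrite (val_submodJ modU) ?inE.
  by rewrite multi_ofJ /= pi_relfree_act.
Qed.
End Affords.

(** If v is the vector of f, then v e is the vector of the displayed sum. It lies outside Kr, which
    is what the multiplicity criterion asks of v. *)
Lemma appears_of_symmetrized (K : fieldType) (p : nat) (lam : seq nat)
    (f : freeAlg K 'I_(sumn lam)) :
    [pchar K] =i pred0 -> Gamma K (sumn lam) f ->
    \sum_(r in row_stab lam) \sum_(c in col_stab lam)
       (-1) ^+ c *: permvar f (r * c)%g \notin relIdeal K p (sumn lam) ->
  appears K p lam.
Proof.
set n := sumn lam => charK Gf nzf.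
pose G := [set: 'S_n]%G; pose aG := regular_repr K G.
have charG : [pchar K]^'.-group G by apply: char0_pgroup.
have two0 : 2%:R != 0 :> K by rewrite (proj1 (pcharf0P K) charK).
have [v fv] := multi_of_surj Gf.1.
have [G0 GD] := @Gamma_subspace K n.
have [W WP] : exists W : 'M[K]_(gcard G), forall v, Gamma K n (multi_of v) <-> (v <= W)%MS.
  apply: subspace_mx; first by rewrite linear0.
  by move=> c a b Ga Gb; rewrite multi_of_linear; apply: GD.
have [Kr KP] : exists Kr : 'M[K]_(gcard G), forall v,
    Gamma K n (multi_of v) /\ multi_of v \in relIdeal K p n <-> (v <= Kr)%MS.
  apply: subspace_mx; first by rewrite linear0; split=> //; apply: rpred0.
  move=> c a b [Ga Ia] [Gb Ib]; rewrite multi_of_linear; split; first exact: GD.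
  exact: (rpredD (relIdealZ c Ia) Ib).
have modP (M : 'M[K]_(gcard G)) (Q : freeAlg K 'I_n -> Prop) :
    (forall v, Q (multi_of v) <-> (v <= M)%MS) ->
    (forall g s, Q g -> Q (permvar g s)) -> mxmodule aG M.
  move=> MP QJ; apply/mxmoduleP => s _; apply/row_subP => i; rewrite row_mul.
  by apply/MP; rewrite multi_ofJ; apply: QJ; apply/MP; apply: row_sub.
have modW : mxmodule aG W by apply: modP WP _ => g s; apply: permvar_Gamma.
have modK : mxmodule aG Kr.
  apply: (modP _ (fun g => Gamma K n g /\ g \in relIdeal K p n) KP) => g s [h1 h2].
  by split; [apply: permvar_Gamma | apply: permvar_relIdeal].
have sKW : (Kr <= W)%MS.
  by apply/rV_subP => u /KP [/WP].
have [U modU defW /mxdirect_addsP dxW] :=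
  mx_reducibleS modW (submx1 W) (mx_Maschke_pchar aG charG) modK sKW.
pose e := young_sym K lam.
have vW : (v <= W)%MS by apply/WP; rewrite -fv.
have step (r c : 'S_n) (k : K) :
    multi_of (v *m (aG r *m (k *: aG c))) = k *: permvar f (r * c)%g.
  by rewrite -!scalemxAr multi_ofZ mulmxA !multi_ofJ permvarM -fv.
have nve : ~~ (v *m gring_mx aG e <= Kr)%MS.
  apply: contra nzf => /KP [_].
  set g := (X in _ -> X \in _).
  suff -> : multi_of (v *m gring_mx aG e) = g by [].
  rewrite /g {g} op_young /row_sum /col_altsum mulmx_suml mulmx_sumr linear_sum.
  apply: eq_bigr => r _ /=; rewrite mulmx_sumr mulmx_sumr linear_sum.
  by apply: eq_bigr => c _; apply: step.
have e0 : e != 0.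
  by apply: contraNneq nve => ->; rewrite linear0 mulmx0 sub0mx.
have simS := cyclic_mx_simple charG e0 (@young_sandwich K lam two0).
exists (\rank U), (submod_repr modU); split.
  exact: affords_complement defW dxW WP KP.
exact: (has_multiplicity_regular charG modU modK modW defW dxW simS vW nve).
Qed.

(** * Values of polynomials in Lie nilpotent algebras *)

Definition lie_nilpotent (B : nzRingType) (p : nat) : Prop :=
  forall s : seq B, size s = p.+1 -> lcommutator s = 0.

Section Evaluation.
Variables (K : fieldType) (B : algType K).

Definition ev (V : choiceType) (u : V -> B) (f : freeAlg K V) : B :=
  mmap (GRing.in_alg B) (word_eval u) f.

Section Morph.
Variables (V : choiceType) (u : V -> B).

Lemma ev_is_zmod_morphism : zmod_morphism (ev u).
Proof. by move=> f g; rewrite /ev raddfB. Qed.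

Lemma ev_is_monoid_morphism : monoid_morphism (ev u).
Proof.
have [|hM h1] := @commr_mmap_is_multiplicative {fmonom V} K B
  (GRing.in_alg B) (word_eval u); last by split.
by move=> g m m'; rewrite /GRing.comm /= mulr_algr mulr_algl.
Qed.

HB.instance Definition _ :=
  GRing.isZmodMorphism.Build (freeAlg K V) B (ev u) ev_is_zmod_morphism.
HB.instance Definition _ :=
  GRing.isMonoidMorphism.Build (freeAlg K V) B (ev u) ev_is_monoid_morphism.

Lemma evC (c : K) : ev u c%:MP = c%:A.
Proof. by rewrite /ev mmapC. Qed.

Lemma evZ (c : K) f : ev u (c *: f) = c *: ev u f.
Proof. by rewrite -mul_malgC rmorphM /= evC mulr_algl. Qed.

Lemma ev_var v : ev u (fvar K v) = u v.
Proof.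
by rewrite /ev /fvar mmapU /= scale1r mul1r /word_eval fmuE big_seq1.
Qed.
End Morph.

Lemma ev_fsubst (V W : choiceType) (u : W -> B) (w : V -> freeAlg K W) f :
  ev u (fsubst w f) = ev (fun x => ev u (w x)) f.
Proof.
rewrite /fsubst mmapE rmorph_sum [RHS]/ev mmapE; apply: eq_bigr => m _.
by rewrite rmorphM /= evC /word_eval rmorph_prod.
Qed.

Lemma eq_ev (V : choiceType) (u w : V -> B) : u =1 w -> ev u =1 ev w.
Proof.
move=> uw f; rewrite /ev !mmapE; apply: eq_bigr => m _.
by congr (_ * _); apply: eq_bigr => v _.
Qed.

Lemma ev_permvar n (u : 'I_n -> B) f (s : 'S_n) :
  ev u (permvar f s) = ev (u \o s) f.
Proof. by rewrite ev_fsubst; apply: eq_ev => i; rewrite ev_var. Qed.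

Lemma ev_relIdeal p n (u : 'I_n -> B) f :
  lie_nilpotent B p -> f \in relIdeal K p n -> ev u f = 0.
Proof.
move=> nilB /asboolP If.
(* The ideal lives in K<X>, so the evaluation is extended to all variables; those beyond the first n
   do not occur in [finclude f] and get the value 0. *)
pose u' (j : nat) : B := if insub j is Some i then u i else 0.
have -> : ev u f = ev u' (finclude f).
  by rewrite ev_fsubst; apply: eq_ev => i; rewrite ev_var /u' valK.
apply: (If (fun g => ev u' g = 0)); split.
  split=> [|g h g0 h0|a g g0]; first by rewrite rmorph0.
    by rewrite rmorphD /= g0 h0 addr0.
  by split; rewrite rmorphM /= g0 ?mulr0 ?mul0r.
by move=> _ [s sz ->]; rewrite rmorph_lcommutator nilB ?size_map.
Qed.

(* Words with a repeated letter vanish, so expanding the product of row sums leaves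
   only the row permutations. *)
Lemma sum_row_stab_word (lam : seq nat) (z : 'I_(sumn lam) -> B) (s : 'S_(sumn lam)) :
    (forall w : seq 'I_(sumn lam), ~~ uniq w -> \prod_(i <- w) z i = 0) ->
  \sum_(r in row_stab lam) \prod_i z (r (s i)) =
  \prod_i \sum_(x | crow x == crow (s i)) z x.
Proof.
move=> repz; set n := sumn lam in z s repz *.
rewrite (eq_bigr (fun i => \sum_x if crow x == crow (s i) then z x else 0)); last first.
  by move=> i _; rewrite big_mkcond.
rewrite bigA_distr_bigA /= (bigID (fun g : {ffun 'I_n -> 'I_n} => injectiveb g)) /=.
rewrite [X in _ = _ + X]big1 ?addr0; last first.
  move=> g /negP ninj.
  have [/forallP h|/forallPn[i hi]] := boolP [forall i, crow (g i) == crow (s i)].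
    rewrite (eq_bigr (fun i => z (g i))); last by move=> i _; rewrite h.
    rewrite -(big_map g predT z) repz //; apply/negP => ug; apply: ninj.
    have pe : perm_eq (index_enum 'I_n) (enum 'I_n).
      by apply: uniq_perm; rewrite ?index_enum_uniq ?enum_uniq // => i; rewrite mem_index_enum mem_enum.
    by rewrite /injectiveb /dinjectiveb -(perm_uniq (perm_map g pe)).
  have [s1 [s2 ->]] : exists s1 s2, index_enum 'I_n = s1 ++ i :: s2.
    have : i \in index_enum 'I_n by rewrite mem_index_enum.
    by case/splitPr => s1 s2; exists s1, s2.
  by rewrite big_cat big_cons /= (negPf hi) mul0r mulr0.
(* The identity is a mere default value: only injective g are left. Each of them is i |-> r (s i)
   for a unique permutation r, and the factors restrict r to the row stabilizer. *)
pose ip (g : {ffun 'I_n -> 'I_n}) : 'S_n := insubd (1%g : 'S_n) g.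
have ipE (g : {ffun 'I_n -> 'I_n}) i : injectiveb g -> ip g i = g i by move=> gi; rewrite -pvalE insubdK.
symmetry; rewrite (reindex_onto (fun r : 'S_n => [ffun i => r (s i)])
  (fun g : {ffun 'I_n -> 'I_n} => (s^-1 * ip g)%g)) /=; last first.
  move=> g ginj; apply/ffunP => i; rewrite ffunE permM permK.
  by rewrite ipE.
rewrite (bigID (fun r => r \in row_stab lam)) /= [X in _ + X]big1 ?addr0; last first.
  move=> r /andP[_ /row_stabP nr]; have [i hi] : exists i, crow (r i) != crow i.
    by apply: contra_notP nr => h i; apply/eqP; apply: contra_notT h => ?; exists i.
  have [s1 [s2 ->]] : exists s1 s2, index_enum 'I_n = s1 ++ ((s^-1)%g i) :: s2.
    have : ((s^-1)%g i) \in index_enum 'I_n by rewrite mem_index_enum.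
    by case/splitPr => s1 s2; exists s1, s2.
  by rewrite big_cat big_cons /= ffunE permKV (negPf hi) mul0r mulr0.
apply: eq_big => r; last first.
  move=> /andP[_ /row_stabP hr]; apply: eq_bigr => i _.
  by rewrite ffunE hr eqxx.
rewrite andbC -[RHS]andbT; congr andb; apply/andP; split.
  apply/injectiveP => i j; rewrite !ffunE => /perm_inj /perm_inj //.
apply/eqP/permP => i; rewrite permM ipE; last first.
  by apply/injectiveP => ? ?; rewrite !ffunE => /perm_inj /perm_inj.
by rewrite ffunE permKV.
Qed.
End Evaluation.

Section CommutatorProducts.
Variables (K : fieldType) (n : nat).
Local Notation F := (freeAlg K 'I_n).

(** Multilinearity in the variables of a list: unlike membership in P_n it can be stated for the
    single factors of a product, and contents add under multiplication. *)
Definition content_span (c : seq 'I_n) : set F :=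
  lspan [set f | exists2 w, perm_eq w c & f = \prod_(i <- w) fvar K i]%classic.

Lemma content_span_gen w c : perm_eq w c -> content_span c (\prod_(i <- w) fvar K i).
Proof. by move=> wc; apply: lspan_gen; exists w. Qed.

Lemma content_span_subspace c : subspace (content_span c).
Proof. exact: lspan_subspace. Qed.

Lemma freeAlg_scalerAl (k : K) (f g : F) : (k *: f) * g = k *: (f * g).
Proof. by rewrite -(mul_malgC k f) -mulrA; apply: mul_malgC. Qed.

Lemma freeAlg_scalerAr (k : K) (f g : F) : f * (k *: g) = k *: (f * g).
Proof.
rewrite -(mul_malgC k g) -(mul_malgC k (f * g)) mulrA [RHS]mulrA.
exact: (congr1 ( *%R^~ g) (esym (malgC_comm k f))).
Qed.

Lemma content_spanM c d f g :
  content_span c f -> content_span d g -> content_span (c ++ d) (f * g).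
Proof.
move=> Pf Pg; have [S0 SD] := content_span_subspace (c ++ d).
apply: (Pf (fun f => content_span (c ++ d) (f * g))); split.
  split=> [|k u v Pu Pv]; first by rewrite mul0r.
  rewrite mulrDl freeAlg_scalerAl; exact: (SD k _ _ Pu Pv).
move=> _ [w wc ->]; set h := \prod_(i <- w) _.
apply: (Pg (fun g => content_span (c ++ d) (h * g))); split.
  split=> [|k u v Pu Pv]; first by rewrite mulr0.
  rewrite mulrDr freeAlg_scalerAr; exact: (SD k _ _ Pu Pv).
move=> _ [w' wd ->]; rewrite /h -big_cat; apply: content_span_gen.
exact: perm_cat.
Qed.

Lemma eq_content_span c d f : perm_eq c d -> content_span c f -> content_span d f.
Proof.
move=> cd Pf; apply: (Pf (content_span d)); split; first exact: content_span_subspace.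
by move=> _ [w wc ->]; apply: content_span_gen; apply: perm_trans wc cd.
Qed.

Lemma content_span_var a : content_span [:: a] (fvar K a).
Proof. by have := content_span_gen (perm_refl [:: a]); rewrite big_seq1. Qed.

Lemma content_span_lcommutator c : (0 < size c)%N ->
  content_span c (lcommutator [seq fvar K i | i <- c]).
Proof.
case: c => // a s _; rewrite /lcommutator /=.
have := @content_span_var a.
rewrite -[a :: s]/([:: a] ++ s); elim: s [:: a] (fvar K a) => [|b s IHs] c x Px /=.
  by rewrite cats0.
rewrite -cat_rcons; apply: IHs.
have [_ SD] := content_span_subspace (rcons c b).
have Pb := @content_span_var b.
rewrite addrC -scaleN1r; apply: SD.
  apply: eq_content_span (content_spanM Pb Px).
  by rewrite -cats1 perm_catC.
by rewrite -cats1; apply: content_spanM.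
Qed.

Definition commutator_product (cs : seq (seq 'I_n)) : F :=
  \prod_(c <- cs) lcommutator [seq fvar K i | i <- c].

Lemma commutator_product_Gamma cs :
    all (fun c => 1 < size c)%N cs -> perm_eq (flatten cs) (enum 'I_n) ->
  Gamma K n (commutator_product cs).
Proof.
move=> cs1 pcs; split; last first.
  by apply: lspan_gen; exists cs.
have : content_span (enum 'I_n) (commutator_product cs).
  apply: eq_content_span pcs _; rewrite /commutator_product.
  elim: cs cs1 => [|c cs IHcs] /=.
    by rewrite big_nil => _; have := content_span_gen (perm_refl [::]); rewrite big_nil.
  case/andP=> c1 cs1; rewrite big_cons; apply: content_spanM (IHcs cs1).
  by apply: content_span_lcommutator; apply: ltnW.
move=> Pf; apply: (Pf (multilinearPoly K n)); split; first exact: lspan_subspace.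
move=> _ [w we ->]; apply: lspan_gen.
have /tuple_permP [s sE] : perm_eq w (ord_tuple n) by rewrite val_ord_tuple.
exists s; rewrite sE [index_enum _]unlock -enumT big_map.
by apply: eq_bigr => i _; rewrite tnth_ord_tuple.
Qed.
End CommutatorProducts.

(** This turns a product of commutators in row indices into a multilinear one in the cells: if every
    row index occurs as often as the row has cells, the occurrences can be matched with these
    cells. *)
Lemma lift_content (n : nat) (row : 'I_n -> nat) (rs : seq (seq nat)) :
    perm_eq (flatten rs) [seq row i | i <- enum 'I_n] ->
  exists2 cs : seq (seq 'I_n), [seq map row c | c <- cs] = rs &
    perm_eq (flatten cs) (enum 'I_n).
Proof.
move=> prs; pose R := [seq row i | i <- enum 'I_n].
have [s ps sE] : exists2 s : seq 'I_n, perm_eq s (enum 'I_n) & map row s = flatten rs.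
  case: (posnP n) => [n0|n0].
    have sz0 : size (enum 'I_n) = 0%N by rewrite size_enum_ord.
    exists (enum 'I_n) => //; rewrite (size0nil sz0) /=; apply/esym/size0nil.
    by rewrite (perm_size prs) size_map.
  case/(perm_iotaP 0%N): prs => Is; rewrite size_map => pIs ->.
  exists [seq nth (Ordinal n0) (enum 'I_n) i | i <- Is].
    by apply/(perm_iotaP (Ordinal n0)); exists Is.
  rewrite -map_comp; apply/eq_in_map => i; rewrite (perm_mem pIs) mem_iota add0n.
  by move=> /andP[_ lti] /=; rewrite (nth_map (Ordinal n0)).
exists (reshape (shape rs) s); last first.
  rewrite reshapeKr // -(size_map row) sE size_flatten //.
by rewrite map_reshape sE flattenK.
Qed.

Definition comm_prod (B : nzRingType) (y : nat -> B) (rs : seq (seq nat)) : B :=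
  \prod_(c <- rs) lcommutator (map y c).

Definition row_element (B : nzRingType) (lam : seq nat) (z : 'I_(sumn lam) -> B)
    (r : nat) : B :=
  \sum_(x | crow x == r) z x.

Section Criterion.
Variables (K : fieldType) (B : algType K) (lam : seq nat).
Local Notation n := (sumn lam).
Implicit Types (z : 'I_n -> B).

Lemma ev_commutator_product z (cs : seq (seq 'I_n)) :
  ev z (commutator_product K cs) = \prod_(c <- cs) lcommutator (map z c).
Proof.
rewrite /commutator_product rmorph_prod; apply: eq_bigr => c _ /=.
rewrite rmorph_lcommutator -map_comp; congr lcommutator.
by apply: eq_map => i /=; rewrite ev_var.
Qed.

Lemma sum_row_stab_ev z f :
    (forall w : seq 'I_n, ~~ uniq w -> \prod_(i <- w) z i = 0) ->
    multilinearPoly K n f ->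
  \sum_(r in row_stab lam) ev (z \o r) f = ev (fun x => row_element z (crow x)) f.
Proof.
move=> repz Pf; apply: (Pf (fun f => \sum_(r in row_stab lam) ev (z \o r) f =
  ev (fun x => row_element z (crow x)) f)); split.
  split=> [|k u v Pu Pv].
    by rewrite rmorph0 big1 // => r _; rewrite rmorph0.
  rewrite rmorphD /= evZ -Pu -Pv scaler_sumr -big_split /=.
  by apply: eq_bigr => r _; rewrite rmorphD /= evZ.
move=> _ [s ->]; rewrite rmorph_prod /=.
transitivity (\prod_i row_element z (crow (s i))); last first.
  by apply: eq_bigr => i _; rewrite ev_var.
rewrite -(sum_row_stab_word _ repz); apply: eq_bigr => r _.
by rewrite rmorph_prod; apply: eq_bigr => i _ /=; rewrite ev_var.
Qed.

Theorem appears_of_evaluation p z (rs : seq (seq nat)) :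
    [pchar K] =i pred0 -> lie_nilpotent B p ->
    (forall w : seq 'I_n, ~~ uniq w -> \prod_(i <- w) z i = 0) ->
    all (fun c => 1 < size c)%N rs ->
    perm_eq (flatten rs) [seq crow i | i <- enum 'I_n] ->
    \sum_(c in col_stab lam) (-1) ^+ c *: comm_prod (row_element (z \o c)) rs != 0 ->
  appears K p lam.
Proof.
move=> charK nilB repz rs1 prs nz0.
have [cs csE pcs] := lift_content prs.
have cs1 : all (fun c => 1 < size c)%N cs.
  by move: rs1; rewrite -csE all_map; apply: sub_all => c /=; rewrite size_map.
have Gf := commutator_product_Gamma K cs1 pcs.
apply: (appears_of_symmetrized charK Gf); apply: contra nz0 => /(ev_relIdeal z nilB).
rewrite rmorph_sum /= => ev0; apply/eqP; apply: etrans ev0.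
transitivity (\sum_(r in row_stab lam) \sum_(c in col_stab lam)
    (-1) ^+ c *: ev ((z \o c) \o r) (commutator_product K cs)); last first.
  apply: eq_bigr => r _; rewrite rmorph_sum /=; apply: eq_bigr => c _.
  rewrite evZ ev_permvar; congr (_ *: _); apply: eq_ev => i /=.
  by rewrite permM.
(* For a fixed column permutation c the letters z o c still have vanishing words with repetitions,
   so the inner sum over the row stabilizer collapses to row sums. *)
rewrite exchange_big /=; apply: eq_bigr => c _; rewrite -scaler_sumr.
rewrite (sum_row_stab_ev _ (proj1 Gf)); last first.
  move=> w nw; have := repz (map c w); rewrite big_map; apply.
  by rewrite map_inj_uniq //; apply: perm_inj.
rewrite ev_commutator_product /comm_prod -csE big_map; congr (_ *: _).
by apply: eq_bigr => d _; rewrite -map_comp.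
Qed.
End Criterion.
End Evaluation.

(** * Color algebras *)

Local Open Scope ring_scope.

Definition color_dot (u w : seq nat) : bool := odd (\sum_(a <- u) count_mem a w).

Section ColorAlgebra.
Variables (K : fieldType) (n : nat) (v : 'I_n -> seq nat).
Implicit Types (S T R U : {set 'I_n}) (i j : 'I_n).

(** The sign of sorting the product of the monomials S and T: every pair with the larger index on
    the left has to be exchanged. *)
Definition set_sgn S T : bool :=
  \big[addb/false]_(i in S) \big[addb/false]_(j in T | (j < i)%N) color_dot (v i) (v j).

Definition str_const S T : K := if [disjoint S & T] then (-1) ^+ set_sgn S T else 0.

Lemma set_sgnUl S T R : [disjoint S & T] ->
  set_sgn (S :|: T) R = set_sgn S R (+) set_sgn T R.
Proof. by move=> dST; rewrite /set_sgn -bigU //=; apply: eq_bigl => i; rewrite inE. Qed.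

Lemma set_sgnUr S T R : [disjoint S & T] ->
  set_sgn R (S :|: T) = set_sgn R S (+) set_sgn R T.
Proof.
move=> dST; rewrite /set_sgn -big_split; apply: eq_bigr => i _ /=.
by rewrite !big_mkcondr -bigU //=; apply: eq_bigl => j; rewrite inE.
Qed.

(** On both sides the disjointness conditions amount to pairwise disjointness, and the sign exponent
    is additive in each argument, hence a cocycle. *)
Lemma str_constA S T R :
  str_const S T * str_const (S :|: T) R = str_const S (T :|: R) * str_const T R.
Proof.
rewrite /str_const -!setI_eq0 setIUl setIUr !setU_eq0.
case: (boolP (S :&: T == set0)) => dST /=; last by rewrite mul0r mul0r.
case: (boolP (T :&: R == set0)) => dTR; rewrite ?andbF ?mulr0 //= andbT.
case: (boolP (S :&: R == set0)) => dSR; rewrite ?mulr0 ?mul0r //.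
rewrite setI_eq0 in dST; rewrite setI_eq0 in dTR.
by rewrite -!signr_addb set_sgnUl // set_sgnUr // !addbA.
Qed.

Lemma str_const0l S : str_const set0 S = 1.
Proof. by rewrite /str_const disjoints_subset sub0set /set_sgn big_set0. Qed.

Lemma str_const0r S : str_const S set0 = 1.
Proof.
rewrite /str_const disjoint_sym disjoints_subset sub0set /set_sgn big1 // => i _.
by rewrite big1 // => j; rewrite inE.
Qed.
End ColorAlgebra.

(* The algebra with basis the products of distinct generators z_i, where
   z_i z_i = 0 and z_i z_j = (-1)^(v_i . v_j) z_j z_i; the color vector v_i over
   F_2 is given as a multiset. *)
Definition calg (K : fieldType) (n : nat) (v : 'I_n -> seq nat) : Type :=
  {ffun {set 'I_n} -> K^o}.

Section ColorAlgebraRing.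
Variables (K : fieldType) (n : nat) (v : 'I_n -> seq nat).
Local Notation A := (calg K v).
Implicit Types (S T R U : {set 'I_n}) (i j : 'I_n) (x y : A).

HB.instance Definition _ := GRing.Lmodule.on A.

Definition cmono S : A := [ffun T => (T == S)%:R].
Definition calg_mul x y : A :=
  [ffun U => \sum_S \sum_T (S :|: T == U)%:R * (str_const K v S T * (x S * y T))].

Lemma calg_mulE x y U : calg_mul x y U =
  \sum_S \sum_T (S :|: T == U)%:R * (str_const K v S T * (x S * y T)).
Proof. by rewrite ffunE. Qed.

Lemma sum_calg_mul x y (G : {set 'I_n} -> K) :
  \sum_P G P * calg_mul x y P =
  \sum_S \sum_T G (S :|: T) * (str_const K v S T * (x S * y T)).
Proof.
under eq_bigr => P _ do rewrite calg_mulE mulr_sumr.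
rewrite exchange_big /=; apply: eq_bigr => S _.
under eq_bigr => P _ do rewrite mulr_sumr.
rewrite exchange_big /=; apply: eq_bigr => T _.
rewrite (bigD1 (S :|: T)) //= eqxx mul1r big1 ?addr0 // => P ne.
by rewrite eq_sym (negPf ne) mul0r mulr0.
Qed.

Lemma calg_mulA : associative calg_mul.
Proof.
move=> x y z; apply/ffunP => U; rewrite calg_mulE [RHS]calg_mulE.
transitivity (\sum_S \sum_P ((S :|: P == U)%:R * (str_const K v S P * x S)) * calg_mul y z P).
  by apply: eq_bigr => S _; apply: eq_bigr => P _; rewrite -!mulrA.
rewrite [RHS]exchange_big /=.
transitivity (\sum_R \sum_P ((P :|: R == U)%:R * (str_const K v P R * z R)) * calg_mul x y P);
    last first.
  by apply: eq_bigr => R _; apply: eq_bigr => P _; ring.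
rewrite (eq_bigr _ (fun S _ => sum_calg_mul y z _)).
rewrite [RHS](eq_bigr _ (fun R _ => sum_calg_mul x y _)).
rewrite [RHS]exchange_big /=; apply: eq_bigr => S _.
rewrite [RHS]exchange_big /=; apply: eq_bigr => T _; apply: eq_bigr => R _.
rewrite setUA -!mulrA; congr (_ * _).
rewrite [LHS](_ : _ = (str_const K v S (T :|: R) * str_const K v T R) * (x S * y T * z R)); last by ring.
by rewrite -str_constA; ring.
Qed.

Lemma sum_kronecker (f : {set 'I_n} -> K) U : \sum_S (S == U)%:R * f S = f U.
Proof.
rewrite (bigD1 U) //= eqxx mul1r big1 ?addr0 // => S ne.
by rewrite (negPf ne) mul0r.
Qed.

Lemma calg_mul1l : left_id (cmono set0) calg_mul.
Proof.
move=> x; apply/ffunP => U; rewrite calg_mulE (bigD1 set0) //= [X in _ + X]big1 ?addr0.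
  rewrite -[RHS](sum_kronecker (fun T => x T)); apply: eq_bigr => T _.
  by rewrite set0U str_const0l ffunE eqxx !mul1r.
by move=> S ne; rewrite big1 // => T _; rewrite ffunE (negPf ne) mul0r !mulr0.
Qed.

Lemma calg_mul1r : right_id (cmono set0) calg_mul.
Proof.
move=> x; apply/ffunP => U; rewrite calg_mulE exchange_big (bigD1 set0) //= [X in _ + X]big1 ?addr0.
  rewrite -[RHS](sum_kronecker (fun T => x T)); apply: eq_bigr => T _.
  by rewrite setU0 str_const0r ffunE eqxx mul1r mulr1.
by move=> S ne; rewrite big1 // => T _; rewrite ffunE (negPf ne) !mulr0.
Qed.

Lemma calg_mulDl : left_distributive calg_mul +%R.
Proof.
move=> x y z; apply/ffunP => U; rewrite [RHS]ffunE !calg_mulE -big_split; apply: eq_bigr => S _.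
rewrite -big_split; apply: eq_bigr => T _ /=; rewrite ffunE.
by rewrite mulrDl !mulrDr.
Qed.

Lemma calg_mulDr : right_distributive calg_mul +%R.
Proof.
move=> x y z; apply/ffunP => U; rewrite [RHS]ffunE !calg_mulE -big_split; apply: eq_bigr => S _.
rewrite -big_split; apply: eq_bigr => T _ /=; rewrite ffunE.
by rewrite !mulrDr.
Qed.

Lemma calg_one_neq0 : cmono set0 != 0.
Proof. by apply/eqP => /ffunP/(_ set0)/eqP; rewrite !ffunE eqxx oner_eq0. Qed.

HB.instance Definition _ := GRing.Zmodule_isNzRing.Build A
  calg_mulA calg_mul1l calg_mul1r calg_mulDl calg_mulDr calg_one_neq0.

Lemma calgME x y U : (x * y) U =
  \sum_S \sum_T (S :|: T == U)%:R * (str_const K v S T * (x S * y T)).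
Proof. exact: calg_mulE. Qed.

Lemma calg_scalerAl (c : K) x y : c *: (x * y) = c *: x * y.
Proof.
apply/ffunP => U; rewrite [LHS]ffunE !calgME scaler_sumr; apply: eq_bigr => S _.
rewrite scaler_sumr; apply: eq_bigr => T _; rewrite ffunE /GRing.scale /=; ring.
Qed.

Lemma calg_scalerAr (c : K) x y : c *: (x * y) = x * (c *: y).
Proof.
apply/ffunP => U; rewrite [LHS]ffunE !calgME scaler_sumr; apply: eq_bigr => S _.
rewrite scaler_sumr; apply: eq_bigr => T _; rewrite ffunE /GRing.scale /=; ring.
Qed.

HB.instance Definition _ := GRing.Lmodule_isLalgebra.Build K A calg_scalerAl.
HB.instance Definition _ := GRing.Lalgebra_isAlgebra.Build K A calg_scalerAr.
End ColorAlgebraRing.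

Lemma odd_sum I (r : seq I) (P : pred I) (F : I -> nat) :
  odd (\sum_(i <- r | P i) F i) = \big[addb/false]_(i <- r | P i) odd (F i).
Proof. exact: (big_morph odd oddD). Qed.

Lemma sum_count_sym (u w : seq nat) :
  (\sum_(a <- u) count_mem a w = \sum_(b <- w) count_mem b u)%N.
Proof.
under eq_bigr do rewrite -sum1_count big_mkcond.
under [RHS]eq_bigr do rewrite -sum1_count big_mkcond.
rewrite exchange_big /=; apply: eq_bigr => b _; apply: eq_bigr => a _.
by rewrite eq_sym.
Qed.

Lemma color_dotC u w : color_dot u w = color_dot w u.
Proof. by rewrite /color_dot sum_count_sym. Qed.

Section ColorAlgebraTheory.
Variables (K : fieldType) (n : nat) (v : 'I_n -> seq nat).
Local Notation A := (calg K v).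
Local Notation e := (cmono K v).
Implicit Types (S T R U : {set 'I_n}) (i j : 'I_n) (x y : A) (u w : seq nat).

Lemma cmonoE S T : e S T = (T == S)%:R.
Proof. by rewrite ffunE. Qed.

Lemma calg_decomp x : x = \sum_S x S *: e S.
Proof.
apply/ffunP => U; rewrite sum_ffunE -[LHS](sum_kronecker (fun S => x S)).
by apply: eq_bigr => S _; rewrite !ffunE mulrC eq_sym.
Qed.

Lemma cmonoM S T : e S * e T = str_const K v S T *: e (S :|: T).
Proof.
apply/ffunP => U; rewrite calgME ffunE cmonoE.
rewrite (bigD1 S) //= [X in _ + X]big1 ?addr0; last first.
  by move=> R ne; rewrite big1 // => R' _; rewrite cmonoE (negPf ne) mul0r !mulr0.
rewrite (bigD1 T) //= [X in _ + X]big1 ?addr0; last first.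
  by move=> R ne; rewrite !cmonoE (negPf ne) !mulr0.
by rewrite !cmonoE !eqxx !mulr1 eq_sym mulrC.
Qed.

Lemma calgM_neq0 x y U : (x * y) U != 0 ->
  exists S T, [/\ x S != 0, y T != 0, [disjoint S & T] & U = S :|: T].
Proof.
case: (boolP [exists S, [exists T, [&& x S != 0, y T != 0, [disjoint S & T] & U == S :|: T]]]).
  by case/existsP=> S /existsP[T /and4P[? ? ? /eqP ?]] _; exists S, T.
move/existsPn => h /eqP[]; rewrite calgME big1 // => S _; rewrite big1 // => T _.
have /existsPn/(_ T) := h S; rewrite /str_const [U == _]eq_sym.
by case: eqP => [x0|]; case: eqP => [y0|]; case: [disjoint _ & _]; case: eqP; rewrite //= ?x0 ?y0 ?(mul0r, mulr0).
Qed.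

Definition cnt (k : nat) S : nat := (\sum_(i in S) count_mem k (v i))%N.

Lemma cntU k S T : [disjoint S & T] -> cnt k (S :|: T) = (cnt k S + cnt k T)%N.
Proof. by move=> dST; rewrite /cnt -bigU //=; apply: eq_bigl => i; rewrite inE. Qed.

(** Disjoint sets have no common index, so every pair is exchanged in exactly one of the two
    sortings; together they give the scalar product of the total color vectors. *)
Lemma set_sgn_sym S T : [disjoint S & T] ->
  set_sgn v S T (+) set_sgn v T S = odd (\sum_(i in S) \sum_(a <- v i) cnt a T).
Proof.
move=> dST; rewrite /set_sgn.
rewrite [X in _ (+) X](exchange_big_dep (mem S)) /=; last by move=> ? ? _ /andP[].
rewrite -big_split odd_sum; apply: eq_bigr => i iS /=.
rewrite /cnt exchange_big /= odd_sum.
rewrite [RHS](bigID (fun j : 'I_n => (j < i)%N)) /=; congr addb.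
apply: eq_big => [j|j _]; last exact: color_dotC.
rewrite iS /=; case jT: (j \in T) => //=; rewrite -leqNgt ltn_neqAle.
suff -> : (i : nat) != j by [].
by apply: contraTneq jT => /val_inj <-; rewrite (disjointFr dST).
Qed.

(** Homogeneity for the grading by color vectors over F_2. It is a condition on the support, so 0 is
    homogeneous of every degree. *)
Definition chom w x : Prop :=
  forall S, x S != 0 -> forall k, odd (cnt k S) = odd (count_mem k w).

Lemma chom_parity S T u w : [disjoint S & T] ->
    (forall k, odd (cnt k S) = odd (count_mem k w)) ->
    (forall k, odd (cnt k T) = odd (count_mem k u)) ->
  set_sgn v S T (+) set_sgn v T S = color_dot w u.
Proof.
move=> dST hS hT; rewrite set_sgn_sym // odd_sum.
transitivity (\big[addb/false]_(i in S) odd (\sum_(a <- v i) count_mem a u)%N).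
  apply: eq_bigr => i _; rewrite !odd_sum.
  by apply: eq_bigr => a _; rewrite hT.
rewrite -odd_sum.
transitivity (odd (\sum_(i in S) \sum_(b <- u) count_mem b (v i))).
  by congr odd; apply: eq_bigr => i _; rewrite sum_count_sym.
rewrite exchange_big /= color_dotC /color_dot !odd_sum.
by apply: eq_bigr => b _; rewrite -hS /cnt.
Qed.

Lemma cmono_comm S T u w :
    (forall k, odd (cnt k S) = odd (count_mem k w)) ->
    (forall k, odd (cnt k T) = odd (count_mem k u)) ->
  e T * e S = (-1) ^+ color_dot w u *: (e S * e T).
Proof.
move=> hS hT; rewrite !cmonoM setUC scalerA; congr (_ *: _).
rewrite /str_const disjoint_sym; case: (boolP [disjoint S & T]) => dST; last by rewrite mulr0.
by rewrite -signr_addb -(chom_parity dST hS hT) addbAC addbb.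
Qed.

Lemma chom_comm w u x y : chom w x -> chom u y ->
  y * x = (-1) ^+ color_dot w u *: (x * y).
Proof.
move=> hx hy; rewrite [in LHS](calg_decomp x) [in LHS](calg_decomp y) [in RHS](calg_decomp x) [in RHS](calg_decomp y).
rewrite mulr_suml mulr_suml scaler_sumr.
transitivity (\sum_T \sum_S (y T * x S) *: (e T * e S)).
  apply: eq_bigr => T _; rewrite mulr_sumr; apply: eq_bigr => S _.
  by rewrite -scalerAl -scalerAr scalerA.
rewrite exchange_big /=; apply: eq_bigr => S _.
rewrite mulr_sumr scaler_sumr; apply: eq_bigr => T _.
rewrite -scalerAl -scalerAr !scalerA.
have [x0|xS] := eqVneq (x S) 0; first by rewrite x0 !(mulr0, mul0r, scale0r).
have [y0|yT] := eqVneq (y T) 0; first by rewrite y0 !(mulr0, mul0r, scale0r).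
rewrite (cmono_comm (hx S xS) (hy T yT)) scalerA; congr (_ *: _); ring.
Qed.
End ColorAlgebraTheory.

Section ColorAlgebraLetters.
Variables (K : fieldType) (n : nat) (v : 'I_n -> seq nat).
Local Notation A := (calg K v).
Local Notation e := (cmono K v).
Local Notation cnt := (@cnt n v).
Local Notation chom := (@chom K n v).
Implicit Types (S T R U : {set 'I_n}) (i j : 'I_n) (x y : A) (u w : seq nat).

Lemma chomM u w x y : chom w x -> chom u y -> chom (w ++ u) (x * y).
Proof.
move=> hx hy U /calgM_neq0[S [T [xS yT dST ->]]] k.
by rewrite cntU // count_cat !oddD (hx S xS) (hy T yT).
Qed.

Lemma chomD w x y : chom w x -> chom w y -> chom w (x + y).
Proof.
move=> hx hy U; rewrite ffunE => nz.
have [xU|] := eqVneq (x U) 0; last exact: hx.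
by apply: hy; apply: contraNneq nz => ->; rewrite xU addr0.
Qed.

Lemma chomZ w (c : K) x : chom w x -> chom w (c *: x).
Proof.
move=> hx U; rewrite ffunE => nz; apply: hx.
by apply: contraNneq nz => ->; rewrite scaler0.
Qed.

Lemma chom0 w : chom w 0.
Proof. by move=> U; rewrite ffunE eqxx. Qed.

Lemma chom_sum w I (r : seq I) (P : pred I) (F : I -> A) :
  (forall j : I, P j -> chom w (F j)) -> chom w (\sum_(i <- r | P i) F i).
Proof. by move=> hF; elim/big_rec: _ => [|i x Pi hx]; [exact: chom0 | exact: chomD (hF i Pi) hx]. Qed.

Lemma chom1 : chom [::] 1.
Proof.
rewrite (_ : 1 = e set0) // => U; rewrite cmonoE; case: (U =P set0) => [-> _ k|].
  by rewrite /cnt big_set0.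
by rewrite eqxx.
Qed.

Lemma chom_parity_eq w w' x :
  (forall k, odd (count_mem k w) = odd (count_mem k w')) -> chom w x -> chom w' x.
Proof. by move=> ww hx S xS k; rewrite (hx S xS) ww. Qed.

Lemma chom_letter i : chom (v i) (e [set i]).
Proof.
move=> U; rewrite cmonoE; case: (U =P [set i]) => [-> _ k|]; last by rewrite eqxx.
by rewrite /cnt big_set1.
Qed.

(** Recording the support S with the nonvanishing makes the latter multiplicative: products of pure
    elements with disjoint supports are pure. *)
Definition pure S x : Prop := exists2 c : K, c != 0 & x = c *: e S.

Lemma pure_neq0 S x : pure S x -> x != 0.
Proof.
case=> c c0 ->; rewrite scaler_eq0 (negPf c0) /=; apply/eqP => /ffunP/(_ S)/eqP.
by rewrite cmonoE ffunE eqxx oner_eq0.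
Qed.

Lemma pureM S T x y : [disjoint S & T] -> pure S x -> pure T y -> pure (S :|: T) (x * y).
Proof.
move=> dST [c c0 ->] [d d0 ->]; exists (c * d * str_const K v S T).
  by rewrite /str_const dST !mulf_neq0 // signr_eq0.
by rewrite -scalerAl -scalerAr cmonoM !scalerA.
Qed.

Lemma pureZ S (c : K) x : c != 0 -> pure S x -> pure S (c *: x).
Proof. by move=> c0 [d d0 ->]; exists (c * d); rewrite ?mulf_neq0 // scalerA. Qed.

Lemma pure1 : pure set0 1.
Proof. by exists 1; rewrite ?oner_eq0 // scale1r. Qed.

Lemma pure_cmono S : pure S (e S).
Proof. by exists 1; rewrite ?oner_eq0 // scale1r. Qed.

Definition letter i : A := e [set i].

Definition divl i x : Prop := forall S, x S != 0 -> i \in S.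

Lemma divl_letter i : divl i (letter i).
Proof. by move=> S; rewrite cmonoE; case: (S =P [set i]) => [-> _|_]; rewrite ?inE // eqxx. Qed.

Lemma divlMl i x y : divl i x -> divl i (x * y).
Proof. by move=> dx U /calgM_neq0[S [T [/dx iS _ _ ->]]]; rewrite inE iS. Qed.

Lemma divlMr i x y : divl i y -> divl i (x * y).
Proof. by move=> dy U /calgM_neq0[S [T [_ /dy iT _ ->]]]; rewrite inE iT orbT. Qed.

Lemma divlD i x y : divl i x -> divl i y -> divl i (x + y).
Proof.
move=> dx dy U; rewrite ffunE => nz.
have [xU|] := eqVneq (x U) 0; last exact: dx.
by apply: dy; apply: contraNneq nz => ->; rewrite xU addr0.
Qed.

Lemma divlZ i (c : K) x : divl i x -> divl i (c *: x).
Proof.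
move=> dx U; rewrite ffunE => nz; apply: dx.
by apply: contraNneq nz => ->; rewrite scaler0.
Qed.

Lemma divlN i x : divl i x -> divl i (- x).
Proof. by rewrite -scaleN1r; apply: divlZ. Qed.

Lemma divlB i x y : divl i x -> divl i y -> divl i (x - y).
Proof. by move=> dx dy; apply: divlD dx (divlN dy). Qed.

Lemma divl_mul0 i x y : divl i x -> divl i y -> x * y = 0.
Proof.
move=> dx dy; apply/ffunP => U; rewrite [RHS]ffunE; apply/eqP; apply: contraT.
move=> /calgM_neq0[S [T [/dx iS /dy iT dST _]]].
by rewrite (disjointFr dST iS) in iT.
Qed.

Lemma divl_prod i (w : seq 'I_n) : i \in w -> divl i (\prod_(j <- w) letter j).
Proof.
elim: w => //= j w IHw; rewrite inE big_cons => /orP[/eqP->|/IHw h].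
  exact/divlMl/divl_letter.
exact: divlMr.
Qed.

Lemma prod_letters_repeat (w : seq 'I_n) : ~~ uniq w -> \prod_(i <- w) letter i = 0.
Proof.
elim: w => //= i w IHw; rewrite big_cons negb_and negbK => /orP[iw|/IHw->]; last by rewrite mulr0.
exact: divl_mul0 (@divl_letter i) (divl_prod iw).
Qed.

Section Potential.
Variables (pot : {set 'I_n} -> nat) (d p : nat).
Hypothesis pot_drop : forall S T, [disjoint S & T] ->
  set_sgn v S T (+) set_sgn v T S -> (pot (S :|: T) + d <= pot S)%N.
Hypothesis pot_le : forall S, (pot S < d * p)%N.

(* A nonzero commutator of monomials lowers the potential by d. *)
Lemma lie_nilpotent_of_potential : lie_nilpotent A p.
Proof.
(* The invariant after t brackets; for t = p it leaves no monomial. *)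
move=> s szs; pose reach t x := forall S, x S != 0 -> (pot S + d * t < d * p)%N.
have step t x y : reach t x -> reach t.+1 (x * y - y * x).
  move=> rx U nz.
  have [S [T [xS dST cST ->]]] : exists S T, [/\ x S != 0, [disjoint S & T],
      set_sgn v S T (+) set_sgn v T S & U = S :|: T].
    case: (boolP [exists S : {set 'I_n}, [exists T : {set 'I_n}, [&& x S != 0, [disjoint S & T],
        set_sgn v S T (+) set_sgn v T S & U == S :|: T]]]).
      by case/existsP=> S /existsP[T /and4P[? ? ? /eqP ?]]; exists S, T.
    move/existsPn => h; case/eqP: nz.
    rewrite {1 2}(calg_decomp x) mulr_suml mulr_sumr -sumrB sum_ffunE big1 // => S _.
    rewrite {1 2}(calg_decomp y) mulr_suml mulr_sumr -sumrB sum_ffunE big1 // => T _.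
    rewrite -!scalerAl -!scalerAr scalerA scalerA [y T * _]mulrC -scalerBr !cmonoM.
    have /existsPn/(_ T) := h S.
    have [->|xS] := eqVneq (x S) 0; first by rewrite mul0r scale0r ffunE.
    rewrite [T :|: S]setUC /str_const [[disjoint T & S]]disjoint_sym.
    case: [disjoint S & T] => /=; last by rewrite !scale0r subrr scaler0 ffunE.
    rewrite -scalerBl; case: (boolP (_ (+) _)) => [_ /= ne|].
      by rewrite !ffunE (negPf ne) /GRing.scale /= !mulr0.
    rewrite negb_add => /eqP -> _.
    by rewrite subrr scale0r scaler0 ffunE.
  have := pot_drop dST cST; have := rx S xS; lia.
have reach0 x : reach 0%N x by move=> S _; rewrite muln0 addn0.
have fold t (r : seq A) x : reach t x ->
    reach (t + size r)%N (foldl (fun a b : A => a * b - b * a) x r).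
  elim: r t x => [|y r IHr] t x rx /=; first by rewrite addn0.
  by rewrite addnS -addSn; apply: IHr; apply: step.
case: s szs => // x r [szr]; apply/ffunP => U; rewrite [RHS]ffunE; apply/eqP.
apply: contraT => nz; have := fold 0%N r x (reach0 x) U.
by rewrite /lcommutator /= in nz *; move=> /(_ nz); rewrite szr; lia.
Qed.
End Potential.
End ColorAlgebraLetters.

(** * Two bounds for the Lie class of a color algebra *)

Local Open Scope nat_scope.

Lemma bool_add_le (a b : bool) (x y : nat) : x + 2 <= y -> a + x + 1 <= b + y.
Proof. by case: a; case: b => /=; lia. Qed.

Lemma bool_add_lt (a : bool) (x y p : nat) : y + 2 <= p -> x <= y -> a + x < 1 * p.
Proof. by case: a => /=; lia. Qed.

Section Nilpotency.
Variables (K : fieldType) (n : nat) (v : 'I_n -> seq nat) (C : nat).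
Hypothesis ltC : forall i a, a \in v i -> a < C.+1.
Local Notation A := (calg K v).
Local Notation cnt := (@cnt n v).
Implicit Types (S T : {set 'I_n}).

Definition color_total k := \sum_i count_mem k (v i).

Lemma cnt_le k S : cnt k S <= color_total k.
Proof.
rewrite /cnt /color_total [X in _ <= X](bigID (mem S)) /=; exact: leq_addr.
Qed.

Lemma sum_colors (u : seq nat) (f : nat -> nat) : all (fun a => a < C.+1) u ->
  \sum_(a <- u) f a = \sum_(k < C.+1) count_mem (k : nat) u * f k.
Proof.
elim: u => [_|a u IHu /= /andP[ltaC /IHu IH]]; first by rewrite big_nil big1.
rewrite big_cons IH.
under [RHS]eq_bigr do rewrite mulnDl.
rewrite big_split /=; congr (_ + _).
rewrite (bigD1 (Ordinal ltaC)) //= eqxx mul1n big1 ?addn0 // => k ne.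
have -> : (a == k) = false; last by [].
by apply: contraNF ne => /eqP e; apply/eqP/val_inj.
Qed.

(** The exponent is the sum over the colors k of [cnt k S * cnt k T]; if it is odd, one of its terms
    is. *)
Lemma anticommute_color S T : [disjoint S & T] -> set_sgn v S T (+) set_sgn v T S ->
  exists k : 'I_C.+1, odd (cnt k S) && odd (cnt k T).
Proof.
move=> dST; rewrite set_sgn_sym // => ho; apply/existsP; apply: contraLR ho.
move=> /existsPn h.
have -> : \sum_(i in S) \sum_(a <- v i) cnt a T = \sum_(k < C.+1) cnt k S * cnt k T.
  under eq_bigr => i _.
    rewrite sum_colors; last by apply/allP => a; apply: ltC.
  over.
  rewrite exchange_big /=; apply: eq_bigr => k _.
  by rewrite -big_distrl.
rewrite odd_sum big1 // => k _; rewrite oddM; apply/negbTE; exact: h.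
Qed.

(* Disjoint sets with anticommuting monomials share an odd color, for which this
   term drops by at least 2. *)
Definition pot_term k S := color_total k - cnt k S + odd (cnt k S).

(** If T has t letters of color k, the difference falls by t, and the parity term changes only for
    odd t. When both counts are odd the parity term falls too, so the drop is t + 1 >= 2. *)
Lemma pot_term_drop k S T : [disjoint S & T] ->
  pot_term k (S :|: T) + 2 * (odd (cnt k S) && odd (cnt k T)) <= pot_term k S.
Proof.
move=> dST; have := cnt_le k (S :|: T).
rewrite /pot_term cntU // oddD.
have := odd_double_half (cnt k S); have := odd_double_half (cnt k T).
case: (odd (cnt k S)); case: (odd (cnt k T)) => /=; lia.
Qed.

Lemma pot_term_mono k S T : [disjoint S & T] -> pot_term k (S :|: T) <= pot_term k S.
Proof. by move/(pot_term_drop k); apply: leq_trans; apply: leq_addr. Qed.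

Lemma pot_term_le k S : pot_term k S <= color_total k.
Proof.
have := cnt_le k S; rewrite /pot_term.
by have := odd_double_half (cnt k S); case: (odd _) => /=; lia.
Qed.

Lemma lie_nilpotent_total p : \sum_(k < C.+1) color_total k < 2 * p -> lie_nilpotent A p.
Proof.
move=> lep; apply: (@lie_nilpotent_of_potential _ _ _ (fun S => \sum_(k < C.+1) pot_term k S) 2).
  move=> S T dST /(anticommute_color dST)[k0 hk].
  rewrite (bigD1 k0) //= [X in _ <= X](bigD1 k0) //=.
  have := pot_term_drop k0 dST; rewrite hk muln1.
  have : \sum_(i < C.+1 | i != k0) pot_term i (S :|: T) <= \sum_(i < C.+1 | i != k0) pot_term i S.
    by apply: leq_sum => k _; apply: pot_term_mono.
  by move=> h1 h2; rewrite addnAC; apply: leq_add.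
by move=> S; apply: leq_ltn_trans lep; apply: leq_sum => k _; apply: pot_term_le.
Qed.

(* Only the parity of the degree in color 0 enters the potential, whence the
   term 2 whatever the number of letters of that color. *)
Lemma lie_nilpotent_finite_colors p :
  \sum_(k < C) color_total k.+1 + 2 <= p -> lie_nilpotent A p.
Proof.
move=> lep; apply: (@lie_nilpotent_of_potential _ _ _
    (fun S => odd (cnt 0 S) + \sum_(k < C) pot_term k.+1 S) 1).
  move=> S T dST /(anticommute_color dST)[k0 /andP[kS kT]].
  have le_rest : \sum_(i < C) pot_term i.+1 (S :|: T) <= \sum_(i < C) pot_term i.+1 S.
    by apply: leq_sum => k _; apply: pot_term_mono.
  (* If the common odd color is 0, its parity falls from 1 to 0. Otherwise another color drops by 2,
     which outweighs a possible rise of the parity of color 0 by 1. *)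
  case: (unliftP ord0 k0) => [j kE|kE]; rewrite kE /= in kS kT; last first.
    by rewrite cntU // oddD kS kT add0n addn1 add1n ltnS; exact: le_rest.
  rewrite cntU // oddD.
  suff : \sum_(i < C) pot_term i.+1 (S :|: T) + 2 <= \sum_(i < C) pot_term i.+1 S.
    exact: bool_add_le.
  rewrite (bigD1 j) //= [X in _ <= X](bigD1 j) //=.
  have : \sum_(i < C | i != j) pot_term i.+1 (S :|: T) <= \sum_(i < C | i != j) pot_term i.+1 S.
    by apply: leq_sum => k _; apply: pot_term_mono.
  have := pot_term_drop j.+1 dST; rewrite kS kT muln1 => h1 h2.
  by rewrite addnAC; apply: leq_add.
move=> S; have : \sum_(k < C) pot_term k.+1 S <= \sum_(k < C) color_total k.+1.
  by apply: leq_sum => k _; apply: pot_term_le.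
exact: bool_add_lt.
Qed.
End Nilpotency.

(** * Signs produced by column permutations *)

Local Open Scope ring_scope.

Section Alternation.
Variables (K : fieldType) (n : nat) (v : 'I_n -> seq nat).
Local Notation z := (@letter K n v).
Implicit Types (i j : 'I_n).

Lemma chom_prod (w : seq 'I_n) : @chom K n v (flatten (map v w)) (\prod_(i <- w) z i).
Proof.
elim: w => [|i w IHw] /=; first by rewrite big_nil; apply: chom1.
by rewrite big_cons; exact: (chomM (@chom_letter K n v i) IHw).
Qed.

(** Two letters of the same color get the same sign in passing the letters between them; only their
    own anticommutation remains. *)
Lemma swap_letters i j (m : seq 'I_n) : v i = v j -> color_dot (v i) (v i) ->
  z i * (\prod_(k <- m) z k * z j) = - (z j * (\prod_(k <- m) z k * z i)).
Proof.
move=> vij oi; set M := \prod_(k <- m) z k.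
have hM : chom (flatten (map v m)) M by apply: chom_prod.
have hi : chom (v i) (z i) := @chom_letter K n v i.
have hj : chom (v i) (z j) by rewrite vij; exact: (@chom_letter K n v j).
rewrite (chom_comm hi hM) (chom_comm hj hM) -!scalerAr !mulrA.
by rewrite (chom_comm hi hj) oi expr1 scaleN1r mulNr scalerN opprK.
Qed.

Lemma swap_word (w : seq 'I_n) i j : uniq w -> i \in w -> j \in w -> i != j ->
    v i = v j -> color_dot (v i) (v i) ->
  \prod_(k <- w) z (tperm i j k) = - \prod_(k <- w) z k.
Proof.
move=> uw iw jw ne vij oi.
wlog lt_ij : i j iw jw ne vij oi / (index i w < index j w)%N => [hw|].
  case: (ltngtP (index i w) (index j w)) => [|lt_ji|e]; first exact: hw.
    by rewrite tpermC; apply: hw; rewrite // 1?eq_sym // -vij.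
  by rewrite -(nth_index i iw) e nth_index ?eqxx in ne.
case/splitPr: iw uw jw lt_ij => w1 w2 uw jw lt_ij.
have [i1 iw2] : i \notin w1 /\ i \notin w2.
  by move: uw; rewrite cat_uniq /= => /and3P[_ /norP[-> _] /andP[-> _]].
have jw2 : j \in w2.
  move: jw; rewrite mem_cat inE eq_sym (negPf ne) /= => /orP[j1|//].
  by move: lt_ij; rewrite !index_cat (negPf i1) j1 /= eqxx addn0 ltnNge ltnW // index_mem.
case/splitPr: jw2 uw iw2 {jw lt_ij} => w2' w3 uw.
rewrite mem_cat inE negb_or (negPf ne) /= => /andP[i2 i3].
have [j1 j2 j3] : [/\ j \notin w1, j \notin w2' & j \notin w3].
  move: uw; rewrite -cat_cons catA cat_uniq => /and3P[_ /= /norP[]].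
  by rewrite mem_cat inE !negb_or => /and3P[-> _ ->] _ /andP[-> _].
have fixw (u : seq 'I_n) : i \notin u -> j \notin u ->
    \prod_(k <- u) z (tperm i j k) = \prod_(k <- u) z k.
  move=> iu ju; rewrite !big_seq; apply: eq_bigr => k ku.
  by rewrite tpermD //; apply: contraTneq ku => <-.
rewrite !(big_cat, big_cons) /= tpermL tpermR !fixw // -mulrN; congr (_ * _).
have := swap_letters w2' vij oi; set M := \prod_(_ <- w2') _; set P := \prod_(_ <- w3) _ => sw.
by rewrite !(mulrA M) (mulrA (z i)) (mulrA (z j)) sw mulNr opprK.
Qed.

Definition color_sign_perm (c : 'S_n) : Prop :=
  forall i, v (c i) = v i /\ (c i != i -> color_dot (v i) (v i)).

Lemma color_sign_perm1 : color_sign_perm 1%g.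
Proof. by move=> i; rewrite perm1 eqxx. Qed.

(** Induction on the number of moved letters: composing c with the transposition of i and c i fixes
    i, moves nothing new and respects the colors. *)
Lemma alternating_word (c : 'S_n) (w : seq 'I_n) : perm_eq w (enum 'I_n) ->
    color_sign_perm c ->
  \prod_(k <- w) z (c k) = (-1) ^+ c *: \prod_(k <- w) z k.
Proof.
move=> pw; have [N] := ubnP #|[set i | c i != i]|.
elim: N c => // N IHN c ltN csc.
case: (boolP [exists i, c i != i]) => [/existsP[i ci]|/existsPn h]; last first.
  have -> : c = 1%g by apply/permP => i; rewrite perm1; apply/eqP; rewrite -[_ == _]negbK.
  rewrite odd_perm1 expr0 scale1r; apply: eq_bigr => k _; by rewrite perm1.
pose c' := (c * tperm i (c i))%g.
have cE k : c k = tperm i (c i) (c' k) by rewrite permM tpermK.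
have fixc k : c k = k -> c' k = k.
  move=> ck; rewrite permM ck tpermD //; first by apply: contraNneq ci => ->; rewrite ck.
  by apply: contraNneq ci => e; apply/eqP/(@perm_inj _ c); rewrite e ck.
have c'i : c' i = i by rewrite permM tpermR.
have csc' : color_sign_perm c'.
  move=> k; split=> [|c'k]; last first.
    by apply: (csc k).2; apply: contraNneq c'k => /fixc->.
  rewrite permM; case: tpermP => [e|e|_ _].
  - by rewrite (csc i).1 -e (csc k).1.
  - by rewrite -(csc i).1 -e (csc k).1.
  - exact: (csc k).1.
have lt' : (#|[set i | c' i != i]| < N)%N.
  apply: leq_trans (_ : #|[set i | c i != i]| <= N)%N; last by rewrite -ltnS.
  apply: proper_card; apply/properP; split.
    by apply/fintype.subsetP => k; rewrite !inE; apply: contraNneq => /fixc->.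
  by exists i; rewrite !inE ?ci // c'i eqxx.
rewrite (eq_bigr (fun k => z (tperm i (c i) (c' k)))) => [|k _]; last by rewrite -cE.
rewrite -(big_map c' predT (fun k => z (tperm i (c i) k))) swap_word.
- rewrite big_map (IHN c' lt' csc') /c' odd_permM odd_tperm eq_sym ci addbT.
  by case: (odd_perm c); rewrite /= ?expr1 ?expr0 ?scale1r ?scaleN1r ?opprK.
- by rewrite map_inj_uniq ?(perm_uniq pw) ?enum_uniq //; apply: perm_inj.
- by apply/mapP; exists i; rewrite ?c'i // (perm_mem pw) mem_enum.
- by apply/mapP; exists ((c'^-1)%g (c i)); rewrite ?permKV // (perm_mem pw) mem_enum.
- by rewrite eq_sym.
- by rewrite (csc i).1.
- exact: (csc i).2.
Qed.
End Alternation.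

Section AlternationRows.
Variables (K : fieldType) (lam : seq nat) (v : 'I_(sumn lam) -> seq nat).
Local Notation n := (sumn lam).
Local Notation z := (@letter K n v).

Lemma ev_alternating (g c : 'S_n) f : color_sign_perm v c -> multilinearPoly K n f ->
  ev (z \o (g * c)%g) f = (-1) ^+ c *: ev (z \o g) f.
Proof.
move=> csc Pf; apply: (Pf (fun f => ev (z \o (g * c)%g) f = (-1) ^+ c *: ev (z \o g) f)); split.
  split=> [|k x y Px Py]; first by rewrite !rmorph0 scaler0.
  by rewrite !rmorphD /= !evZ Px Py scalerDr !scalerA [_ * k]mulrC.
move=> _ [s ->]; rewrite !rmorph_prod /=.
pose w := [seq g (s i) | i <- enum 'I_n].
have pw : perm_eq w (enum 'I_n).
  apply: uniq_perm; last 1 first.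
  - move=> i; rewrite mem_enum; apply/mapP.
    by exists ((s^-1)%g ((g^-1)%g i)); rewrite ?permKV // mem_enum.
  - by rewrite map_inj_uniq ?enum_uniq // => i j /perm_inj/perm_inj.
  - exact: enum_uniq.
transitivity (\prod_(k <- w) z (c k)).
  rewrite big_map enumT [index_enum _]unlock; apply: eq_bigr => i _.
  by rewrite ev_var /= permM.
rewrite (@alternating_word K n v c w pw csc); congr (_ *: _).
rewrite big_map enumT [index_enum _]unlock; apply: eq_bigr => i _.
by rewrite ev_var.
Qed.

(** Row sums mix letters of many colors, so the sign cannot be read off directly; the product is
    expanded back into multilinear evaluations over the row stabilizer, where every word contains
    each letter once. *)
Lemma comm_prod_alternating (g c : 'S_n) (rs : seq (seq nat)) :
    color_sign_perm v c -> all (fun r => 1 < size r)%N rs ->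
    perm_eq (flatten rs) [seq crow i | i <- enum 'I_n] ->
  comm_prod (row_element (z \o (g * c)%g)) rs =
  (-1) ^+ c *: comm_prod (row_element (z \o g)) rs.
Proof.
move=> csc rs1 prs; have [cs csE pcs] := lift_content prs.
have cs1 : all (fun c => 1 < size c)%N cs.
  by move: rs1; rewrite -csE all_map; apply: sub_all => d /=; rewrite size_map.
have Gf := commutator_product_Gamma K cs1 pcs.
have toev (h : 'S_n) : comm_prod (row_element (z \o h)) rs =
    \sum_(r in row_stab lam) ev (z \o (r * h)%g) (commutator_product K cs).
  transitivity (\sum_(r in row_stab lam) ev ((z \o h) \o r) (commutator_product K cs)); last first.
    by apply: eq_bigr => r _; apply: eq_ev => i /=; rewrite permM.
  rewrite (sum_row_stab_ev _ (proj1 Gf)); last first.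
    move=> w nw; have := @prod_letters_repeat K n v (map h w); rewrite big_map; apply.
    by rewrite map_inj_uniq //; apply: perm_inj.
  rewrite ev_commutator_product /comm_prod -csE big_map.
  by apply: eq_bigr => d _; rewrite -map_comp.
rewrite !toev scaler_sumr; apply: eq_bigr => r _.
by rewrite mulgA; apply: ev_alternating csc (proj1 Gf).
Qed.

(** The sign of c0 cancels against the one produced by its letters. Every column permutation thus
    contributes a natural multiple of one element X, and the identity a positive one, so in
    characteristic 0 nothing cancels. *)
Theorem appears_of_alternating p (rs : seq (seq nat)) (X : calg K v) :
    [pchar K] =i pred0 -> lie_nilpotent (calg K v) p ->
    all (fun r => 1 < size r)%N rs ->
    perm_eq (flatten rs) [seq crow i | i <- enum 'I_n] -> X != 0 ->
    (forall c, c \in col_stab lam -> exists m : nat, exists g, exists2 c0,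
      color_sign_perm v c0 & c = (g * c0)%g /\
      (-1) ^+ g *: comm_prod (row_element (z \o g)) rs = m%:R *: X) ->
    (exists m : nat, comm_prod (row_element z) rs = m.+1%:R *: X) ->
  appears K p lam.
Proof.
move=> charK nilA rs1 prs X0 hc [m1 h1].
apply: (appears_of_evaluation charK nilA (@prod_letters_repeat K n v) rs1 prs).
pose F (c : 'S_n) := (-1) ^+ c *: comm_prod (row_element (z \o c)) rs.
have {}hc c : c \in col_stab lam -> exists m : nat, F c = m%:R *: X.
  move=> /hc[m [g [c0 csc [-> hE]]]]; exists m; rewrite /F comm_prod_alternating //.
  rewrite -hE.
  by rewrite scalerA odd_permM signr_addb -mulrA -signr_addb addbb mulr1.
have F1 : F 1%g = m1.+1%:R *: X.
  rewrite /F odd_perm1 expr0 scale1r -h1; apply: eq_bigr => d _; congr lcommutator.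
  by apply: eq_map => r; apply: eq_bigr => x _; rewrite /= perm1.
have one : 1%g \in col_stab lam by apply/col_stabP => i; rewrite perm1.
have [m hm] : exists m : nat, \sum_(c in col_stab lam | c != 1%g) F c = m%:R *: X.
  elim/big_rec: _ => [|c x /andP[/hc[k ->] _] [m ->]]; first by exists 0%N; rewrite scale0r.
  by exists (k + m)%N; rewrite natrD scalerDl.
rewrite (bigD1 1%g) //= -/(F _) F1 hm -scalerDl -natrD addSn scaler_eq0 (negPf X0) orbF.
by rewrite (proj1 (pcharf0P K) charK).
Qed.
End AlternationRows.

(** * Iterated commutators *)

Definition ad (B : nzRingType) (y x : B) : B := x * y - y * x.

Lemma lcommutatorE (B : nzRingType) (x : B) (s : seq B) :
  lcommutator (x :: s) = foldl (fun u w => ad w u) x s.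
Proof. by []. Qed.

Lemma foldl_ad_nseq (B : nzRingType) (x y : B) (k : nat) (s : seq B) :
  foldl (fun u w => ad w u) x (nseq k y ++ s) = foldl (fun u w => ad w u) (iter k (ad y) x) s.
Proof. by elim: k x => // k IHk x; rewrite /= IHk -iterSr. Qed.

Ltac cdot := by rewrite /color_dot !big_cons big_nil.

Section Ad.
Variables (B : nzRingType).
Implicit Types (x y z : B).

Lemma adD y x x' : ad y (x + x') = ad y x + ad y x'.
Proof. by rewrite /ad mulrDl mulrDr opprD addrACA. Qed.

Lemma adDl y y' x : ad (y + y') x = ad y x + ad y' x.
Proof. by rewrite /ad mulrDl mulrDr opprD addrACA. Qed.

Lemma adMn y x k : ad y (x *+ k) = ad y x *+ k.
Proof. by rewrite /ad mulrnAl mulrnAr -mulrnBl. Qed.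

Lemma ad_comm y x : y * x = x * y -> ad y x = 0.
Proof. by rewrite /ad => ->; rewrite subrr. Qed.

Lemma ad_anti y x : y * x = - (x * y) -> ad y x = (x * y) *+ 2.
Proof. by rewrite /ad => ->; rewrite opprK. Qed.

Lemma ad_sum I (r : seq I) y (F : I -> B) : ad y (\sum_(i <- r) F i) = \sum_(i <- r) ad y (F i).
Proof. by rewrite /ad mulr_suml mulr_sumr sumrB. Qed.

Lemma ad_suml I (r : seq I) x (F : I -> B) : ad (\sum_(i <- r) F i) x = \sum_(i <- r) ad (F i) x.
Proof. by rewrite /ad mulr_suml mulr_sumr sumrB. Qed.

Lemma expr_add_sq0 m x k : m * x = x * m -> m * m = 0 ->
  (m + x) ^+ k.+1 = x ^+ k.+1 + (m * x ^+ k) *+ k.+1.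
Proof.
move=> mx mm; elim: k => [|k IHk]; first by rewrite !expr1 expr0 mulr1 mulr1n addrC.
rewrite exprS IHk mulrDl !mulrDr -mulrnAr !mulrA mm mul0r addr0.
rewrite -exprS addrC -addrA; congr (_ + _).
by rewrite -mx mulrnAr -mulrA -exprS -mulrSr.
Qed.

(** Since z is central, the factor h can be moved next to each d in the expansion. *)
Lemma mul_expr_absorb h d z q : (forall x, z * x = x * z) -> h * d = 0 ->
  h * (d + z) ^+ q = h * z ^+ q.
Proof.
move=> cz hd; elim: q => // q IHq.
by rewrite !exprS !mulrA mulrDr hd add0r -!cz -!mulrA IHq.
Qed.
End Ad.

Lemma disjoint_bigcup_seq (T : finType) (I : eqType) (s : seq I) (S : I -> {set T}) (U : {set T}) :
  {in s, forall j, [disjoint S j & U]} -> [disjoint \bigcup_(j <- s) S j & U].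
Proof.
move=> d; rewrite big_seq; apply: (big_ind (fun R : {set T} => [disjoint R & U])) => [|R R'|j /d //].
  by rewrite disjoints_subset sub0set.
by rewrite -!setI_eq0 setIUl => /eqP-> /eqP->; rewrite setU0.
Qed.

Section ColorAlgebraPowers.
Variables (K : fieldType) (n : nat) (v : 'I_n -> seq nat).
Hypothesis charK : [pchar K] =i pred0.
Local Notation A := (calg K v).
Local Notation e := (cmono K v).
Local Notation chom := (@chom K n v).
Implicit Types (S T : {set 'I_n}) (x y a b g : A) (u w : seq nat).

Lemma pure_mul_self S x : S != set0 -> pure S x -> x * x = 0.
Proof.
case/set0Pn => i iS [c _ ->]; rewrite -scalerAl -scalerAr cmonoM /str_const.
case: (boolP [disjoint S & S]) => [/disjoint_setI0|_]; last by rewrite scale0r !scaler0.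
by rewrite setIid => S0; rewrite S0 inE in iS.
Qed.

Lemma pureMn S x k : pure S x -> pure S (x *+ k.+1).
Proof. by move=> px; rewrite -scaler_nat; apply: pureZ px; rewrite (proj1 (pcharf0P K) charK). Qed.

Lemma pow_sum_pure (I : eqType) (s : seq I) (m : I -> A) (S : I -> {set 'I_n}) :
    uniq s -> {in s &, forall i j, m i * m j = m j * m i} ->
    {in s, forall i, S i != set0 /\ pure (S i) (m i)} ->
    {in s &, forall i j, i != j -> [disjoint S i & S j]} ->
  pure (\bigcup_(i <- s) S i) ((\sum_(i <- s) m i) ^+ size s) /\
  forall k, (size s < k)%N -> (\sum_(i <- s) m i) ^+ k = 0.
Proof.
elim: s => [_ _ _ _|i s IHs /= /andP[is_ us] cm pm dm].
  rewrite !big_nil expr0; split; first exact: pure1.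
  by case=> // k _; rewrite expr0n.
have sub j : j \in s -> j \in i :: s by rewrite inE => ->; rewrite orbT.
have i0 : i \in i :: s by rewrite inE eqxx.
have [j k js ks|j js|j k js ks|px x0] := IHs us.
- by apply: cm; apply: sub.
- exact: (pm j (sub j js)).
- by apply: dm; apply: sub.
rewrite !big_cons; set x := \sum_(_ <- _) _ in px x0 *.
have cx : m i * x = x * m i.
  by rewrite /x mulr_sumr mulr_suml !big_seq; apply: eq_bigr => j js; apply: cm => //; apply: sub.
have mm : m i * m i = 0 by have [h1 h2] := pm i i0; apply: pure_mul_self h1 h2.
split=> [|[//|k] /= lt_k]; last first.
  by rewrite expr_add_sq0 // (x0 k lt_k) (x0 k.+1 (ltnW lt_k)) mulr0 mul0rn addr0.
rewrite /= expr_add_sq0 // x0 // add0r.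
apply: pureMn; apply: pureM px; last exact: (pm i i0).2.
rewrite disjoint_sym; apply: disjoint_bigcup_seq => j js.
by apply: dm; rewrite // ?sub //; apply: contraNneq is_ => <-.
Qed.

Lemma acomm w u x y : chom w x -> chom u y -> color_dot w u -> y * x = - (x * y).
Proof. by move=> hx hy d; rewrite (chom_comm hx hy) d expr1 scaleN1r. Qed.

Lemma ccomm w u x y : chom w x -> chom u y -> ~~ color_dot w u -> y * x = x * y.
Proof. by move=> hx hy d; rewrite (chom_comm hx hy) (negPf d) expr0 scale1r. Qed.

Lemma chom_cmono S : chom (flatten (map v (enum S))) (e S).
Proof.
move=> T; rewrite cmonoE; case: (T =P S) => [-> _ k|_]; last by rewrite eqxx.
by rewrite count_flatten sumnE !big_map big_enum.
Qed.

Lemma chom_nil_central x y : chom [::] x -> x * y = y * x.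
Proof.
move=> hx; rewrite (calg_decomp y) mulr_sumr mulr_suml; apply: eq_bigr => S _.
rewrite -scalerAl -scalerAr; congr (_ *: _).
apply: ccomm (@chom_cmono S) hx _.
by rewrite color_dotC /color_dot big_nil.
Qed.

Lemma two_neq0 : 2%:R != 0 :> K.
Proof. by rewrite (proj1 (pcharf0P K) charK). Qed.

Lemma self_opp0 x : x = - x -> x = 0.
Proof.
move/eqP; rewrite -addr_eq0 -mulr2n -scaler_nat scaler_eq0 (negPf two_neq0) /=.
by move/eqP.
Qed.

(** An element of odd color anticommutes with itself, so its square is 0; y only contributes a sign
    on being moved out. *)
Lemma chom_sandwich0 w u x y : chom w x -> color_dot w w -> chom u y -> x * y * x = 0.
Proof.
move=> hx dw hy; have xx : x * x = 0 by apply: self_opp0; exact: (acomm hx hx dw).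
by rewrite -mulrA (chom_comm hx hy) -scalerAr mulrA xx mul0r scaler0.
Qed.

Lemma chomX w x k : chom w x -> chom (if odd k then w else [::]) (x ^+ k).
Proof.
move=> hx; elim: k => [|k IHk]; first by rewrite expr0; apply: chom1.
rewrite exprS; apply: chom_parity_eq (chomM hx IHk) => i.
rewrite count_cat /=; case: (odd k) => /=; rewrite ?addn0 // oddD addbb //.
Qed.

Lemma chomMn w x k : chom w x -> chom w (x *+ k).
Proof. by move=> hx; rewrite -scaler_nat; apply: chomZ. Qed.

Section Orthogonal.
Variables (J : seq nat) (f g : nat -> A).
Hypotheses (hf : forall j, chom [:: j] (f j)) (hg : forall j, chom [:: j] (g j)).

Lemma color_dot1 i j : color_dot [:: i] [:: j] = (i == j).
Proof. by rewrite /color_dot big_seq1 /= addn0 oddb eq_sym. Qed.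

Lemma ad_orthogonal : uniq J ->
  ad (\sum_(j <- J) g j) (\sum_(j <- J) f j) = \sum_(j <- J) (f j * g j) *+ 2.
Proof.
move=> uJ; rewrite ad_sum [LHS]big_seq [RHS]big_seq; apply: eq_bigr => i iJ.
rewrite ad_suml (bigD1_seq i) //= big1 ?addr0 => [|j ij].
  by apply: ad_anti; apply: acomm (@hf i) (@hg i) _; rewrite color_dot1.
by apply: ad_comm; apply: ccomm (@hf i) (@hg j) _; rewrite color_dot1 eq_sym.
Qed.

Lemma chom_ad_orthogonal : uniq J -> chom [::] (ad (\sum_(j <- J) g j) (\sum_(j <- J) f j)).
Proof.
move=> uJ; rewrite ad_orthogonal //; apply: chom_sum => j _; apply: chomMn.
by apply: chom_parity_eq (chomM (@hf j) (@hg j)) => k; rewrite /= addn0 oddD addbb.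
Qed.
End Orthogonal.

(* The first summand has color [:: 0], the second [:: 0; 1] (which anticommutes
   with [:: 0] and commutes with itself), the third commutes with both. *)
Section IteratedAd.
Variables (a0 g0 b0 : A).
Hypotheses (ha0 : chom [:: 0%N] a0) (hg0 : chom [:: 0%N; 1%N] g0).
Hypotheses (ba : forall a, chom [:: 0%N] a -> b0 * a = a * b0)
           (bg : forall g, chom [:: 1%N] g -> b0 * g = g * b0).
Local Notation y0 := (a0 + g0 + b0).

Let a1gs a s : chom [:: 0%N] a -> chom (if odd s then [:: 1%N] else [:: 0%N]) (a * g0 ^+ s).
Proof.
move=> ha; apply: chom_parity_eq (chomM ha (chomX hg0)) => k.
by case: (odd s); rewrite /= ?addn0 // addnA oddD addnn odd_double.
Qed.

(** For even s the element a g0^s has color 0 and anticommutes with both a0 and g0; for odd s it has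
    color 1 and anticommutes with g0 only. The term ending in a0, created at odd steps, has trivial
    color, is central and dies at the next bracket. *)
Lemma iter_ad_alpha a s : chom [:: 0%N] a ->
  iter s (ad y0) a = (a * g0 ^+ s + (a * g0 ^+ s.-1 * a0) *+ odd s) *+ 2 ^ s.
Proof.
move=> ha; elim: s => [|s IHs]; first by rewrite /= expr0 mulr1 mulr0n addr0.
rewrite iterS {}IHs adMn expnS mulrnA; congr (_ *+ _).
have hx := @a1gs a s ha; rewrite adD /= adMn; case: (boolP (odd s)) hx => os hx.
  rewrite mulr0n addr0 mulr1n.
  rewrite [X in _ + X](_ : _ = 0) ?addr0; last first.
    apply: ad_comm; apply/esym/chom_nil_central.
    have := @a1gs a s.-1 ha; have -> : odd s.-1 = false by case: (s) os => //= m /negPf.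
    move=> h; apply: chom_parity_eq (chomM h ha0) => k.
    by rewrite /= addn0 oddD addbb.
  rewrite !adDl [X in X + _ + _](_ : _ = 0); last by apply: ad_comm; apply: ccomm hx ha0 _; cdot.
  rewrite [X in _ + X](_ : _ = 0); last by apply: ad_comm; apply: bg.
  rewrite add0r addr0 ad_anti; last by apply: acomm hx hg0 _; cdot.
  by rewrite -mulrA -exprSr.
rewrite mulr0n addr0 !adDl [X in _ + X](_ : _ = 0); last by apply: ad_comm; apply: ba.
rewrite addr0 !ad_anti; last 2 first.
- by apply: acomm hx hg0 _; cdot.
- by apply: acomm hx ha0 _; cdot.
by rewrite -mulrnDl addrC exprSr !mulrA.
Qed.

(** The first bracket can only pick a0, since g and g0 commute; all later ones pick g0, because a
    second a0 would enclose a product between two equal odd elements. *)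
Lemma iter_ad_gamma g s : chom [:: 0%N; 1%N] g -> b0 * g = g * b0 ->
  iter s.+1 (ad y0) g = (g * a0 * g0 ^+ s) *+ 2 ^ s.+1.
Proof.
move=> hg bg1; elim: s => [|s IHs].
  rewrite /= expr0 mulr1 expn1 !adDl.
  rewrite [X in _ + X](_ : _ = 0) ?addr0; last exact: ad_comm.
  rewrite [X in _ + X](_ : _ = 0) ?addr0; last by apply: ad_comm; apply: ccomm hg hg0 _; cdot.
  by apply: ad_anti; apply: acomm hg ha0 _; cdot.
rewrite iterS {}IHs adMn [in RHS]expnS mulrnA; congr (_ *+ _).
have hx : chom (if odd s then [:: 0%N] else [:: 1%N]) (g * a0 * g0 ^+ s).
  apply: chom_parity_eq (chomM (chomM hg ha0) (chomX hg0)) => k.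
  case: (odd s); rewrite /= ?addn0; lia.
rewrite !adDl.
have gx : g0 * (g * a0 * g0 ^+ s) = - (g * a0 * g0 ^+ s * g0).
  by apply: acomm hx hg0 _; case: (odd s); cdot.
rewrite (ad_anti gx) [in RHS]exprSr [in RHS]mulrA.
rewrite [X in X + _ + _](_ : _ = 0) ?add0r; last first.
  case: (boolP (odd s)) hx => os hx; last by apply: ad_comm; apply: ccomm hx ha0 _; cdot.
  rewrite ad_anti; last by apply: acomm hx ha0 _; cdot.
  rewrite -!mulrA (mulrA a0) (chom_sandwich0 ha0 _ (chomX hg0)) ?mulr0 ?mul0rn //.
  cdot.
rewrite [X in _ + X](_ : _ = 0) ?addr0 //; apply: ad_comm.
by case: (odd s) hx => hx; [exact: ba | exact: bg].
Qed.

Lemma iter_ad_central b s : chom [::] (ad y0 b) -> iter s.+2 (ad y0) b = 0.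
Proof.
move=> hb; elim: s => [|s IHs].
  by rewrite /=; apply: ad_comm; apply/esym/chom_nil_central.
by rewrite iterS IHs /ad mul0r mulr0 subrr.
Qed.
End IteratedAd.
End ColorAlgebraPowers.

Section Weights.
Variables (K : fieldType) (n : nat) (v : 'I_n -> seq nat).
Local Open Scope nat_scope.

Let C := \max_x \max_(a <- v x) a.

Let ltC x a : a \in v x -> a < C.+1.
Proof.
move=> ax; rewrite ltnS; apply: leq_trans (leq_bigmax x).
by rewrite (big_rem a) //= leq_maxl.
Qed.

Lemma lie_nilpotent_size p : \sum_x size (v x) < 2 * p -> lie_nilpotent (calg K v) p.
Proof.
move=> lep; apply: (lie_nilpotent_total ltC); apply: leq_ltn_trans lep.
rewrite /color_total exchange_big /=; apply: leq_sum => x _.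
rewrite -sum1_size (@sum_colors C (v x) (fun=> 1)); last by apply/allP => a; apply: ltC.
by apply: leq_sum => k _; rewrite muln1.
Qed.

Lemma lie_nilpotent_weight p :
  \sum_x size [seq a <- v x | a != 0] + 2 <= p -> lie_nilpotent (calg K v) p.
Proof.
move=> lep; apply: (lie_nilpotent_finite_colors ltC); apply: leq_trans lep.
rewrite leq_add2r /color_total exchange_big /=; apply: leq_sum => x _.
have -> : size [seq a <- v x | a != 0] = \sum_(a <- v x) (a != 0).
  by rewrite size_filter -sum1_count big_mkcond; apply: eq_bigr => a _; case: (a != 0).
rewrite (@sum_colors C (v x) (fun a => a != 0)); last by apply/allP => a; apply: ltC.
by rewrite big_ord_recl /= muln0 add0n; apply: leq_sum => k _; rewrite muln1.
Qed.
End Weights.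

Section ShapeWeights.
Variables (K : fieldType) (lam : seq nat) (v : 'I_(sumn lam) -> seq nat).
Local Open Scope nat_scope.

Lemma leq_size_col0 : all (leq 1) lam -> size lam <= #|[set x : 'I_(sumn lam) | ccol x == 0]|.
Proof.
move=> pos; have cell (r : 'I_(size lam)) : {x : 'I_(sumn lam) | (crow x == r) && (ccol x == 0)}.
  apply: sigW; have [|x xr xc] := @cellP lam r 0; last by exists x; rewrite xr xc !eqxx.
  by move/(all_nthP 0): pos => /(_ r (ltn_ord r)).
rewrite -{1}(card_ord (size lam)) -(card_imset _ (_ : injective (fun r => sval (cell r)))).
  by apply: subset_leq_card; apply/subsetP => _ /imsetP[r _ ->]; rewrite inE; case: (cell r) => x /= /andP[].
move=> r r' e; apply: val_inj; move: e.
by case: (cell r) => x /= /andP[/eqP<- _]; case: (cell r') => x' /= /andP[/eqP<- _] ->.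
Qed.

(** The first alternative counts nonzero colors: one for each cell outside column 0, which has at
    least [size lam] cells, and one more on S. The second counts all colors, with two of them on
    D. *)
Lemma lie_nilpotent_shape p (s d : nat) (S D : {set 'I_(sumn lam)}) :
    all (leq 1) lam -> #|S| <= s -> #|D| <= d ->
    (forall x, size [seq a <- v x | a != 0] <= (ccol x != 0) + (x \in S)) ->
    (forall x, size (v x) <= 1 + (x \in D)) ->
    (sumn lam + s + 2 <= p + size lam) || (sumn lam + d < 2 * p) ->
  lie_nilpotent (calg K v) p.
Proof.
move=> pos leS leD wS wD /orP[lep|lep].
  apply: lie_nilpotent_weight.
  have h1 : \sum_x size [seq a <- v x | a != 0] <= \sum_x ((ccol x != 0) + (x \in S)).
    by apply: leq_sum => x _; apply: wS.
  rewrite big_split /= in h1.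
  have h2 : \sum_x (x \in S) = #|S| by rewrite -sum1_card [RHS]big_mkcond; apply: eq_bigr => x _; case: (x \in S).
  have h3 : \sum_(x : 'I_(sumn lam)) (ccol x != 0 : nat) + #|[set x : 'I_(sumn lam) | ccol x == 0]| = sumn lam.
    rewrite -sum1_card [X in _ + X]big_mkcond -big_split /= -[RHS]card_ord -sum1_card; apply: eq_bigr => x _.
    by rewrite inE; case: eqP.
  have h4 := leq_size_col0 pos.
  move: h1 h3; rewrite h2; set a := \sum_x size _; set b := \sum_x _; move: a b; lia.
apply: lie_nilpotent_size.
have h1 : \sum_x size (v x) <= \sum_x (1 + (x \in D)) by apply: leq_sum => x _; apply: wD.
rewrite big_split /= sum1_card card_ord in h1.
have h2 : \sum_x (x \in D) = #|D| by rewrite -sum1_card [RHS]big_mkcond; apply: eq_bigr => x _; case: (x \in D).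
move: h1; rewrite h2; set a := \sum_x size _; move: a; lia.
Qed.

Lemma card_row_interval r a b : b <= nth 0 lam r ->
  #|[set x : 'I_(sumn lam) | (crow x == r) && (a <= ccol x < b)]| = b - a.
Proof.
move=> leb; have cell (j : 'I_(b - a)) : {x : 'I_(sumn lam) | (crow x == r) && (ccol x == a + j)}.
  apply: sigW; have [|x xr xc] := @cellP lam r (a + j); last by exists x; rewrite xr xc !eqxx.
  by apply: leq_trans leb; have := ltn_ord j; lia.
rewrite -[RHS](card_ord (b - a)) -(card_imset _ (_ : injective (fun j => sval (cell j)))).
  apply: eq_card => x; rewrite inE; apply/andP/imsetP => [[xr /andP[ax xb]]|[j _ ->]].
    have lt : ccol x - a < b - a by lia.
    exists (Ordinal lt) => //; case: (cell _) => y /= /andP[/eqP yr /eqP yc].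
    by apply: cell_inj; [rewrite yr (eqP xr) | rewrite yc; lia].
  by case: (cell j) => y /= /andP[-> /eqP->]; have := ltn_ord j; split=> //; lia.
move=> j k e; apply: val_inj; move: e.
case: (cell j) => x /= /andP[_ /eqP xc]; case: (cell k) => y /= /andP[_ /eqP yc] e.
by move: yc; rewrite -e xc; lia.
Qed.
End ShapeWeights.

(** * Row sums split by color and pairs of rows *)

Section Parts.
Variables (K : fieldType) (lam : seq nat) (v : 'I_(sumn lam) -> seq nat).
Hypothesis charK : [pchar K] =i pred0.
Local Notation n := (sumn lam).
Local Notation A := (calg K v).
Local Notation z := (@letter K n v).
Local Notation pure := (@pure K n v).
Local Notation chom := (@chom K n v).
Implicit Types (c g : 'S_n) (w : seq nat).

(* The cells of color w that c brings into row r. *)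
Definition cells c r w : {set 'I_n} :=
  [set y | (crow ((c^-1)%g y) == r) && (v y == w)].

Definition part c r w : A := \sum_(y in cells c r w) z y.

Lemma chom_part c r w : chom w (part c r w).
Proof.
apply: chom_sum => y; rewrite inE => /andP[_ /eqP <-]; exact: (@chom_letter K n v y).
Qed.

Lemma disjoint_cells c r w r' w' : (r != r') || (w != w') ->
  [disjoint cells c r w & cells c r' w'].
Proof.
move=> ne; rewrite -setI_eq0; apply/eqP/setP => y; rewrite !inE.
by case: eqP => [->|] //=; case: eqP => [->|]; rewrite ?andbF //=; case/orP: ne => /negPf->; rewrite ?andbF.
Qed.

Lemma card_cells c r w : #|cells c r w| = #|[set x | (crow x == r) && (v (c x) == w)]|.
Proof.
rewrite -(card_imset _ (@perm_inj _ (c^-1)%g)); apply: eq_card => x.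
rewrite inE; apply/imsetP/idP => [[y]|h].
  by rewrite inE => h ->; rewrite permKV.
by exists (c x); rewrite ?inE permK.
Qed.

Lemma part_pow c r w : ~~ color_dot w w ->
  pure (cells c r w) (part c r w ^+ #|cells c r w|) /\
  forall k, (#|cells c r w| < k)%N -> part c r w ^+ k = 0.
Proof.
move=> dw; have := @pow_sum_pure K n v charK _ (enum (cells c r w)) z (fun y => [set y]).
rewrite big_enum /= -/(part c r w) -cardE big_enum /=.
have -> : \bigcup_(i in cells c r w) [set i] = cells c r w.
  apply/setP => y; apply/bigcupP/idP => [[x xS]|yS]; first by rewrite inE => /eqP->.
  by exists y; rewrite // inE.
apply=> [|x y|y _|x y _ _ ne]; first exact: enum_uniq.
- rewrite !mem_enum !inE => /andP[_ /eqP vx] /andP[_ /eqP vy].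
  by apply: (ccomm (@chom_letter K n v y) (@chom_letter K n v x)); rewrite vx vy.
- split; last exact: (@pure_cmono K n v [set y]).
  by apply/set0Pn; exists y; rewrite inE.
- by rewrite disjoints1 inE.
Qed.

Lemma part_single c r w : #|cells c r w| = 1%N -> pure (cells c r w) (part c r w).
Proof.
by move=> /eqP/cards1P[y e]; rewrite /part e big_set1; exact: (@pure_cmono K n v [set y]).
Qed.

Lemma part_empty c r w : #|cells c r w| = 0%N -> part c r w = 0.
Proof. by move/cards0_eq => e; rewrite /part e big_set0. Qed.

Lemma row_parts c r (ws : seq (seq nat)) : uniq ws ->
    (forall x, crow x = r -> v (c x) \in ws) ->
  row_element (z \o c) r = \sum_(w <- ws) part c r w.
Proof.
move=> uws hws; rewrite /row_element (reindex_inj (@perm_inj _ (c^-1)%g)) /=.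
under eq_bigr do rewrite permKV.
under [RHS]eq_bigr do rewrite /part big_mkcond.
rewrite exchange_big big_mkcond; apply: eq_bigr => y _ /=.
case: eqP => [yr|yr].
  rewrite (bigD1_seq (v y)) //=; last by rewrite -(permKV c y) hws.
  by rewrite inE yr !eqxx /= big1 ?addr0 // => w; rewrite inE eq_sym => /negPf->; rewrite andbF.
by rewrite big1 // => w _; rewrite inE; case: eqP yr.
Qed.

Lemma mem_cells1 r w y : (y \in cells 1 r w) = (crow y == r) && (v y == w).
Proof. by rewrite inE invg1 perm1. Qed.

Lemma row_element1 : row_element (z \o (1%g : 'S_n)) =1 row_element z.
Proof. by move=> r; apply: eq_bigr => x _; rewrite /= perm1. Qed.

Lemma eq_comm_prod (y y' : nat -> A) rs : y =1 y' -> comm_prod y rs = comm_prod y' rs.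
Proof. by move=> e; apply: eq_bigr => c _; congr lcommutator; apply: eq_map. Qed.

Lemma pair_power (c : 'S_n) r r' (J : seq nat) : uniq J -> r != r' ->
    {in J, forall j, #|cells c r [:: j]| = 1%N /\ #|cells c r' [:: j]| = 1%N} ->
  pure (\bigcup_(j <- J) (cells c r [:: j] :|: cells c r' [:: j]))
    (ad (\sum_(j <- J) part c r' [:: j]) (\sum_(j <- J) part c r [:: j]) ^+ size J).
Proof.
move=> uJ ne hJ.
rewrite (@ad_orthogonal K n v J _ _ (fun j => @chom_part c r [:: j]) (fun j => @chom_part c r' [:: j]) uJ).
apply: (proj1 (@pow_sum_pure K n v charK _ J _ (fun j => cells c r [:: j] :|: cells c r' [:: j]) uJ _ _ _)).
- move=> i j _ _; apply: chom_nil_central; apply: chomMn.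
  by apply: chom_parity_eq (chomM (@chom_part c r [:: i]) (@chom_part c r' [:: i])) => k; rewrite /= addn0 oddD addbb.
- move=> j jJ; have [h1 h2] := hJ j jJ; split.
    by apply/set0Pn; move/eqP/cards1P: h1 => [y e]; exists y; rewrite e !inE eqxx.
  apply: pureMn => //; apply: pureM (part_single h1) (part_single h2).
  by apply: disjoint_cells; rewrite ne.
- move=> i j _ _ ij; rewrite -setI_eq0 setIUl !setIUr !setU_eq0 !setI_eq0.
  by rewrite !disjoint_cells //; apply/orP; right; apply: contraNneq ij => -[->].
Qed.
End Parts.

(** The color of column t. Color 1 is skipped: it is reserved for the even color [[:: 0; 1]] of the
    arm and of special cells. *)
Definition kappa (t : nat) : nat := if t == 0%N then 0%N else t.+1.

Lemma kappa_inj : injective kappa.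
Proof. by move=> [|s] [|t] //= [->]. Qed.

(** Starting at row o, 2m rows are taken two by two; a pair of length l contributes the l-th power
    of its commutator, which uses up all cells of both rows. *)
Definition row_pairs (lam : seq nat) (o m : nat) : seq (seq nat) :=
  flatten [seq nseq (nth 0%N lam (o + t.*2)) [:: o + t.*2; (o + t.*2).+1]%N | t <- iota 0 m].

Lemma row_pairsS lam o m : row_pairs lam o m.+1 =
  row_pairs lam o m ++ nseq (nth 0%N lam (o + m.*2)) [:: o + m.*2; (o + m.*2).+1]%N.
Proof. by rewrite /row_pairs -addn1 iotaD map_cat flatten_cat /= cats0 add0n. Qed.

Lemma size_row_pairs lam o m : all (fun c => 1 < size c)%N (row_pairs lam o m).
Proof. by elim: m => // m IHm; rewrite row_pairsS all_cat IHm all_nseq orbT. Qed.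

Lemma count_row_pairs lam o m r :
    (forall t, (t < m)%N -> nth 0%N lam (o + t.*2) = nth 0%N lam (o + t.*2).+1) ->
  count_mem r (flatten (row_pairs lam o m)) = (if (o <= r < o + m.*2)%N then nth 0%N lam r else 0%N).
Proof.
elim: m => [|m IHm] h; first by rewrite /= addn0 ltnNge; case: (o <= r)%N.
rewrite row_pairsS flatten_cat count_cat IHm; last by move=> t lt; apply: h; apply: ltnW.
have hm := h m (ltnSn m).
have -> k (a b : nat) : count_mem r (flatten (nseq k [:: a; b])) = (k * ((a == r) + (b == r)))%N.
  by elim: k => //= k ->; rewrite mulSn addnA.
rewrite doubleS !addnS.
case: (eqVneq (o + m.*2)%N r) => [e|n1].
  rewrite -e ltnn andbF; have -> : ((o + m.*2).+1 == o + m.*2)%N = false by lia.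
  by have -> : (o <= o + m.*2 < (o + m.*2).+2)%N = true; [lia | rewrite muln1].
case: (eqVneq (o + m.*2).+1 r) => [e|n2].
  rewrite -e hm; have -> : (o <= (o + m.*2).+1 < o + m.*2)%N = false by lia.
  by have -> : (o <= (o + m.*2).+1 < (o + m.*2).+2)%N = true; [lia | rewrite muln1].
by rewrite muln0 addn0 (_ : (o <= r < (o + m.*2).+2) = (o <= r < o + m.*2))%N //; lia.
Qed.

Section RowPairs.
Variables (K : fieldType) (lam : seq nat) (v : 'I_(sumn lam) -> seq nat).
Hypothesis charK : [pchar K] =i pred0.
Local Notation n := (sumn lam).
Local Notation A := (calg K v).
Local Notation z := (@letter K n v).
Local Notation pure := (@pure K n v).
Local Notation cells := (@cells lam v).
Local Notation part := (@part K lam v).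
Implicit Types (c g : 'S_n) (w : seq nat).

Lemma card_cells_interval c r a b w : (b <= nth 0%N lam r)%N ->
    (forall x, crow x = r -> (v (c x) == w) = (a <= ccol x < b)%N) ->
  #|cells c r w| = (b - a)%N.
Proof.
move=> leb h; rewrite card_cells -(card_row_interval a leb); apply: eq_card => x.
by rewrite !inE; case: eqP => //= /h ->.
Qed.

Lemma card_cells_at c r t w : (t < nth 0%N lam r)%N ->
    (forall x, crow x = r -> (v (c x) == w) = (ccol x == t)) -> #|cells c r w| = 1%N.
Proof.
move=> lt h; rewrite (@card_cells_interval c r t t.+1) ?subSnn // => x /h ->.
by rewrite ltnS eqn_leq andbC.
Qed.

Lemma card_cells0 c r w : (forall x, crow x = r -> v (c x) != w) -> #|cells c r w| = 0%N.
Proof.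
by move=> h; rewrite card_cells; apply: eq_card0 => x; rewrite !inE; case: eqP => //= /h /negPf.
Qed.

Lemma comm_prod_cat (y : nat -> A) rs rs' :
  comm_prod y (rs ++ rs') = comm_prod y rs * comm_prod y rs'.
Proof. by rewrite /comm_prod big_cat. Qed.

Lemma comm_prod_nseq (y : nat -> A) k a b :
  comm_prod y (nseq k [:: a; b]) = ad (y b) (y a) ^+ k.
Proof. by rewrite /comm_prod big_nseq -Monoid.iteropE. Qed.

Lemma comm_prod_eq_in (y y' : nat -> A) rs : {in flatten rs, y =1 y'} ->
  comm_prod y rs = comm_prod y' rs.
Proof.
move=> e; rewrite /comm_prod [LHS]big_seq [RHS]big_seq; apply: eq_bigr => d drs.
by congr lcommutator; apply/eq_in_map => r rd; apply: e; apply/flattenP; exists d.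
Qed.

Definition standard_row r : Prop := forall x : 'I_n, crow x = r -> v x = [:: kappa (ccol x)].

Lemma row_standard r : standard_row r ->
  row_element z r = \sum_(j <- map kappa (iota 0 (nth 0%N lam r))) part 1%g r [:: j].
Proof.
move=> sr; rewrite -row_element1.
rewrite (@row_parts K lam v 1%g r [seq [:: kappa j] | j <- iota 0 (nth 0%N lam r)]).
- by rewrite !big_map.
- by rewrite map_inj_uniq ?iota_uniq // => i j [] /kappa_inj.
- move=> x xr; rewrite perm1 sr //; apply/mapP; exists (ccol x) => //.
  by rewrite mem_iota -xr ccol_lt.
Qed.

Lemma card_standard r t : standard_row r -> (t < nth 0%N lam r)%N -> #|cells 1%g r [:: kappa t]| = 1%N.
Proof.
move=> sr lt; apply: (card_cells_at lt) => x xr; rewrite perm1 sr // eqseq_cons eqxx andbT.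
by apply/eqP/eqP => [/kappa_inj|->].
Qed.

Lemma mem_cells_row r w x : x \in cells 1%g r w -> crow x = r.
Proof. by rewrite mem_cells1 => /andP[/eqP]. Qed.

Lemma standard_pair_pure r r' : r != r' -> nth 0%N lam r = nth 0%N lam r' ->
    standard_row r -> standard_row r' ->
  exists2 S : {set 'I_n}, (forall x, x \in S -> crow x = r \/ crow x = r') &
    pure S (ad (row_element z r') (row_element z r) ^+ nth 0%N lam r).
Proof.
move=> ne len sr sr'; rewrite (row_standard sr) (row_standard sr') -len.
set J := map _ _.
have := @pair_power K lam v charK 1%g r r' J; rewrite {3}/J size_map size_iota => h.
eexists; last first; first (apply: h => //).
- by rewrite map_inj_uniq ?iota_uniq //; apply: kappa_inj.
- move=> j /mapP[t]; rewrite mem_iota add0n => /andP[_ lt] jt.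
  by rewrite jt; split; apply: card_standard; rewrite // -?len.
- move=> x; apply: (big_rec (fun U : {set 'I_n} => x \in U -> crow x = r \/ crow x = r')) => [|j U _ IH].
    by rewrite inE.
  by rewrite !in_setU => /orP[/orP[]/mem_cells_row->|/IH]; auto.
Qed.

Lemma row_pairs_pure o m :
    (forall t, (t < m)%N -> nth 0%N lam (o + t.*2) = nth 0%N lam (o + t.*2).+1) ->
    (forall r, (o <= r < o + m.*2)%N -> standard_row r) ->
  exists2 S : {set 'I_n}, (forall x, x \in S -> (o <= crow x < o + m.*2)%N) &
    pure S (comm_prod (row_element z) (row_pairs lam o m)).
Proof.
elim: m => [|m IHm] h sr.
  exists set0 => [x|]; first by rewrite inE.
  by rewrite /row_pairs /comm_prod big_nil; apply: pure1.
have [t lt|r rm|S rS pS] := IHm; first by apply: h; apply: ltnW.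
  by apply: sr; lia.
have [|||S' rS' pS'] := @standard_pair_pure (o + m.*2)%N (o + m.*2).+1 _ (h m (ltnSn m)).
- by rewrite -addn1; lia.
- by apply: sr; lia.
- by apply: sr; lia.
exists (S :|: S') => [x|]; first by rewrite inE => /orP[/rS|/rS']; lia.
rewrite row_pairsS comm_prod_cat comm_prod_nseq; apply: pureM pS pS'.
rewrite -setI_eq0; apply/eqP/setP => x; rewrite !inE; apply/negP => /andP[/rS h1 /rS' h2]; lia.
Qed.

(** The paired rows contribute a pure factor whose support is disjoint from S. A factor g that fixes
    these rows leaves this contribution unchanged, so only the commutators [hd] in the other rows
    have to be examined. *)
Theorem appears_of_head p hd o m (S : {set 'I_n}) (X : A) :
    lie_nilpotent A p -> all (fun d => 1 < size d)%N hd ->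
    (forall t, (t < m)%N -> nth 0%N lam (o + t.*2) = nth 0%N lam (o + t.*2).+1) ->
    (forall r, (o <= r < o + m.*2)%N -> standard_row r) ->
    (forall r, count_mem r (flatten hd) = if (o <= r < o + m.*2)%N then 0%N else nth 0%N lam r) ->
    pure S X -> (forall x, x \in S -> ~~ (o <= crow x < o + m.*2)%N) ->
    (exists k : nat, comm_prod (row_element z) hd = X *+ k.+1) ->
    (forall c, c \in col_stab lam ->
      comm_prod (row_element (z \o c)) hd = 0 \/
      exists k : nat, exists g, exists2 c0, color_sign_perm v c0 & c = (g * c0)%g /\
       (forall x, (o <= crow x < o + m.*2)%N -> g x = x) /\
       (-1) ^+ g *: comm_prod (row_element (z \o g)) hd = X *+ k) ->
  appears K p lam.
Proof.
move=> nilA hd1 len sr cnt pX rX [k0 hk0] hc.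
have [S' rS' pS'] := row_pairs_pure len sr.
set tl := row_pairs lam o m in pS'; set Y := comm_prod _ tl in pS'.
have XY : X * Y != 0.
  apply: pure_neq0 (pureM _ pX pS'); rewrite -setI_eq0; apply/eqP/setP => x; rewrite !inE.
  by apply/negP => /andP[/rX/negP xr /rS'].
apply: (appears_of_alternating (rs := hd ++ tl) charK nilA _ _ XY).
- by rewrite all_cat hd1 size_row_pairs.
- apply/allP => r _; apply/eqP; rewrite flatten_cat count_cat cnt count_row_pairs //.
  have -> : count_mem r [seq crow i | i <- enum 'I_n] = nth 0%N lam r.
    rewrite -[RHS]subn0 -(@card_row_interval lam r 0 _ (leqnn _)).
    rewrite count_map enumT cardE /enum_mem size_filter; apply: eq_count => x.
    by rewrite /= !inE /=; case: eqP => //= <-; rewrite ccol_lt.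
  by case: ifP => _; rewrite ?addn0.
- move=> c /hc[c0|[k [g [c0 csc [-> [gx hg]]]]]].
    exists 0%N, c, 1%g; [exact: color_sign_perm1|split; first by rewrite mulg1].
    by rewrite comm_prod_cat c0 mul0r scaler0 scale0r.
  exists k, g, c0 => //; split=> //; rewrite comm_prod_cat scalerAl hg.
  rewrite [X in _ * X](_ : _ = Y) ?scaler_nat ?mulrnAl //.
  apply: comm_prod_eq_in => r; rewrite -has_pred1 has_count count_row_pairs //.
  case: ifP => // rm _; apply: eq_bigr => x /eqP xr.
  by rewrite /= gx // xr.
exists k0; rewrite comm_prod_cat hk0 scaler_nat mulrnAl //.
Qed.

(* The permutations fixing the special cells act on equally colored odd letters
   only, and all contribute the same element to the alternating sum. *)
Corollary appears_of_special p hd o m (S : {set 'I_n}) (sp : pred 'I_n) :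
    lie_nilpotent A p -> all (fun d => 1 < size d)%N hd ->
    (forall t, (t < m)%N -> nth 0%N lam (o + t.*2) = nth 0%N lam (o + t.*2).+1) ->
    (forall r, (o <= r < o + m.*2)%N -> standard_row r) ->
    (forall r, count_mem r (flatten hd) = if (o <= r < o + m.*2)%N then 0%N else nth 0%N lam r) ->
    (forall x, x \in S -> ~~ (o <= crow x < o + m.*2)%N) ->
    pure S (comm_prod (row_element z) hd) ->
    (forall x y, ~~ sp x -> ~~ sp y -> ccol x = ccol y -> v x = v y) ->
    (forall x, ~~ sp x -> color_dot (v x) (v x)) ->
    (forall c, c \in col_stab lam -> (exists2 x, sp x & c x != x) ->
      comm_prod (row_element (z \o c)) hd = 0) ->
  appears K p lam.
Proof.
move=> nilA hd1 len sr cnt rX pX spv spd hc.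
apply: (appears_of_head nilA hd1 len sr cnt pX rX); first by exists 0%N.
move=> c cc; case: (boolP [exists x, sp x && (c x != x)]) => [/existsP[x /andP[spx cx]]|/existsPn h].
  by left; apply: hc => //; exists x.
have fixsp x : sp x -> c x = x.
  by move=> spx; apply/eqP; have := h x; rewrite spx negbK.
right; exists 1%N, 1%g, c; last split; rewrite ?mul1g //; last first.
  split=> [x _|]; first by rewrite perm1.
  by rewrite odd_perm1 scale1r mulr1n; apply: eq_comm_prod; apply: row_element1.
move=> x; have [spx|spx] := boolP (sp x); first by rewrite fixsp ?eqxx.
split=> [|_]; last exact: spd.
apply: spv => //; last by move/col_stabP: cc.
by apply: contra spx => spc; rewrite -(perm_inj (fixsp _ spc)).
Qed.
End RowPairs.

Section RowBrackets.
Variables (K : fieldType) (n : nat) (v : 'I_n -> seq nat).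
Hypothesis charK : [pchar K] =i pred0.
Local Notation A := (calg K v).
Local Notation chom := (@chom K n v).
Implicit Types (x y a b g : A) (u w : seq nat).

(** Satisfied by sums over the additional columns, whose colors are at least 2 and do not interact
    with those of column 0 and the arm. *)
Definition neutral b : Prop :=
  forall u x, all (fun k => k < 2)%N u -> chom u x -> b * x = x * b.

Lemma neutral_sum (J : seq nat) (f : nat -> A) : all (leq 2) J ->
  (forall j, chom [:: j] (f j)) -> neutral (\sum_(j <- J) f j).
Proof.
move=> hJ hf u x hu hx; rewrite mulr_suml mulr_sumr !big_seq; apply: eq_bigr => j jJ.
apply: ccomm hx (@hf j) _; rewrite /color_dot big1_seq // => k /andP[_ ku] /=.
have := allP hJ j jJ; have /= := allP hu k ku; rewrite addn0; lia.
Qed.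

Section TwoRows.
Variables (a0 g0 b0 a1 g1 b1 : A).
Hypotheses (ha0 : chom [:: 0%N] a0) (hg0 : chom [:: 0; 1]%N g0) (hb0 : neutral b0).
Hypotheses (ha1 : chom [:: 0%N] a1) (hg1 : chom [:: 0; 1]%N g1) (hb1 : neutral b1).
Hypothesis hbb : chom [::] (ad b0 b1).
Local Notation y0 := (a0 + g0 + b0).
Local Notation y1 := (a1 + g1 + b1).

Lemma ad_neutral : ad y0 b1 = ad b0 b1.
Proof.
rewrite !adDl [X in X + _ + _ = _](_ : _ = 0) ?add0r; last first.
  by apply: ad_comm; apply/esym; exact: (@hb1 [:: 0%N] a0).
rewrite [X in X + _ = _](_ : _ = 0) ?add0r //.
by apply: ad_comm; apply/esym; exact: (@hb1 [:: 0; 1]%N g0).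
Qed.

Lemma iter_adD (y x x' : A) s : iter s (ad y) (x + x') = iter s (ad y) x + iter s (ad y) x'.
Proof. by elim: s => //= s ->; rewrite adD. Qed.

(** The three summands of y1 evolve independently. The neutral one yields the central element
    [b1, b0] after one bracket and 0 afterwards, whence the term for s = 0. *)
Lemma iter_ad_row s : iter s.+1 (ad y0) y1 =
  (a1 * g0 ^+ s.+1 + (a1 * g0 ^+ s * a0) *+ ~~ odd s + g1 * a0 * g0 ^+ s) *+ 2 ^ s.+1
  + (ad b0 b1) *+ (s == 0)%N.
Proof.
have ba a : chom [:: 0%N] a -> b0 * a = a * b0 by move=> ha; exact: (@hb0 [:: 0%N] a).
have bg g : chom [:: 1%N] g -> b0 * g = g * b0 by move=> hg; exact: (@hb0 [:: 1%N] g).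
rewrite 2!iter_adD (@iter_ad_alpha K n v a0 g0 b0) //.
rewrite (@iter_ad_gamma K n v charK a0 g0 b0) //; last exact: (@hb0 [:: 0; 1]%N g1).
rewrite [in RHS]mulrnDl; congr (_ + _).
case: s => [|s]; first by rewrite /= ad_neutral mulr1n.
by rewrite mulr0n; apply: iter_ad_central; rewrite ad_neutral.
Qed.

Lemma ad_rows : ad y0 y1 = (a1 * g0 + a1 * a0 + g1 * a0) *+ 2 + ad b0 b1.
Proof. by have := iter_ad_row 0; rewrite /= !expr0 !mulr1 expr1. Qed.

Section ThirdRow.
Variables (a2 g2 b2 : A) (s : nat).
Hypotheses (ha2 : chom [:: 0%N] a2) (hg2 : chom [:: 0; 1]%N g2) (hb2 : neutral b2).
Hypothesis os : ~~ odd s.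
Local Notation y2 := (a2 + g2 + b2).

Let h1 : chom [:: 1%N] (a1 * g0 ^+ s.+1).
Proof.
apply: chom_parity_eq (chomM ha1 (chomX hg0)) => k; rewrite /= os /=; lia.
Qed.

Let h2 : chom [:: 1%N] (g1 * a0 * g0 ^+ s).
Proof.
apply: chom_parity_eq (chomM (chomM hg1 ha0) (chomX hg0)) => k; rewrite (negPf os) /= ; lia.
Qed.

Let H := a1 * g0 ^+ s.+1 + g1 * a0 * g0 ^+ s.

Let hH : chom [:: 1%N] H.
Proof. exact: (chomD h1 h2). Qed.

(** For even s the noncentral part H has color 1, which commutes with a2 and b2 and anticommutes
    with g2: the third row enters only through its letters of even color. *)
Lemma ad_third : ad y2 (iter s.+1 (ad y0) y1) = (H * g2) *+ 2 ^ s.+2.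
Proof.
have h3 : chom [::] (a1 * g0 ^+ s * a0).
  apply: chom_parity_eq (chomM (chomM ha1 (chomX hg0)) ha0) => k.
  by rewrite (negPf os) /=; lia.
rewrite iter_ad_row adD [X in _ + X = _](_ : _ = 0); last first.
  by rewrite adMn ad_comm ?mul0rn //; apply/esym; apply: chom_nil_central.
rewrite addr0 adMn (addrAC (a1 * _)) adD -/H [X in (_ + X) *+ _ = _](_ : _ = 0); last first.
  by rewrite adMn ad_comm ?mul0rn //; apply/esym; apply: chom_nil_central.
rewrite addr0 !adDl [X in (_ + X) *+ _ = _](_ : _ = 0); last first.
  by apply: ad_comm; exact: (@hb2 [:: 1%N] H).
rewrite [X in (X + _ + _) *+ _ = _](_ : _ = 0); last by apply: ad_comm; apply: ccomm hH ha2 _; cdot.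
rewrite add0r addr0 ad_anti; last by apply: acomm hH hg2 _; cdot.
by rewrite -mulrnA -expnS.
Qed.

(** H g2 has color 0 again, so a0 and g0 both contribute; the term with a0 on both sides
    vanishes. *)
Lemma ad_fourth : ad y0 (ad y2 (iter s.+1 (ad y0) y1)) =
  (a1 * g0 ^+ s.+1 * g2 * a0 + a1 * g0 ^+ s.+2 * g2 + g1 * a0 * g0 ^+ s.+1 * g2) *+ 2 ^ s.+3.
Proof.
have hHg : chom [:: 0%N] (H * g2).
  by apply: chom_parity_eq (chomM hH hg2) => k; rewrite /=; lia.
have gg : g2 * g0 = g0 * g2 by apply: ccomm hg0 hg2 _; cdot.
rewrite ad_third adMn !adDl [X in (_ + X) *+ _ = _](_ : _ = 0); last first.
  by apply: ad_comm; exact: (@hb0 [:: 0%N] (H * g2)).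
rewrite addr0 ad_anti; last by apply: acomm hHg ha0 _; cdot.
rewrite ad_anti; last by apply: acomm hHg hg0 _; cdot.
rewrite -mulrnDl -mulrnA -expnS; congr (_ *+ _).
rewrite {1}/H -[H * g2 * g0]mulrA gg mulrA /H !mulrDl.
rewrite -!(mulrA _ (g0 ^+ _) g0) -!exprSr.
rewrite -!addrA; congr (_ + _).
rewrite [X in X + _ = _](_ : _ = 0) ?add0r //.
rewrite -!mulrA (mulrA (g0 ^+ s)) (mulrA a0).
rewrite (chom_sandwich0 charK ha0 _ (chomM (chomX hg0) hg2)) ?mulr0 //.
cdot.
Qed.
End ThirdRow.
End TwoRows.
End RowBrackets.

(** * Hooks with additional columns *)

(* A hook with arm length a and q additional columns of height e. *)
Definition hook_shape (a q e h : nat) : seq nat :=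
  (a + q + 1)%N :: nseq e.-1 q.+1 ++ nseq (h - e) 1%N.

Section HookShape.
Variables (a q e h : nat).
Local Notation lam := (hook_shape a q e h).
Local Open Scope nat_scope.
Hypotheses (e1 : 0 < e) (eh : e <= h).

Lemma size_hook_shape : size lam = h.
Proof. by rewrite /= size_cat !size_nseq; lia. Qed.

Lemma nth_hook_shape r : nth 0 lam r =
  (r == 0) * a + (r < e) * q + (r < h).
Proof.
case: r => [|r] /=; first by rewrite e1 (leq_trans e1 eh) mul1n mul1n.
rewrite nth_cat size_nseq !nth_nseq; case: ltnP => h1.
  have -> : r.+1 < e by lia.
  have -> : r.+1 < h by lia.
  lia.
have -> : r.+1 < e = false by lia.
have -> : (r - e.-1 < h - e) = (r.+1 < h) by lia.
by case: (r.+1 < h).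
Qed.

Lemma hook_shape_pos : all (leq 1) lam.
Proof. by rewrite /= all_cat !all_nseq addn1 /= !orbT. Qed.

Lemma sumn_hook_shape : sumn lam = a + e * q + h.
Proof. by rewrite /= sumn_cat !sumn_nseq mul1n; nia. Qed.
End HookShape.

Section HookColors.
Variables (K : fieldType) (a q e h : nat) (Ov : nat -> nat -> bool).
Local Notation lam := (hook_shape a q e h).
Local Notation n := (sumn lam).
Hypothesis charK : [pchar K] =i pred0.
Hypotheses (e1 : (0 < e)%N) (eh : (e <= h)%N).
Hypothesis Ov_col : forall r t, Ov r t -> (t <= q)%N && (t <= 1)%N.
Hypothesis Ov_uniq : forall r r' t, Ov r t -> Ov r' t -> r = r'.

(* Color 0 is the one whose multiplicity does not affect the Lie class. Ov marks
   the special cells, which get the color [:: 0; 1] of the arm. *)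
Definition hook_color (x : 'I_n) : seq nat :=
  if Ov (crow x) (ccol x) then [:: 0; 1]%N
  else if (ccol x <= q)%N then [:: kappa (ccol x)] else [:: 0; 1]%N.

Local Notation v := hook_color.
Local Notation A := (calg K v).
Local Notation z := (@letter K n v).
Local Notation pure := (@pure K n v).
Local Notation cells := (@cells lam v).
Local Notation part := (@part K lam v).
Local Notation chom := (@chom K n v).
Implicit Types (c : 'S_n) (r t : nat).

(* c brings a special letter into the cell (r, t). *)
Definition hit c r t : bool :=
  [exists x : 'I_n, [&& crow x == r, ccol x == t & Ov (crow (c x)) (ccol (c x))]].

Lemma col_stab_col c x : c \in col_stab lam -> ccol (c x) = ccol x.
Proof. by move/col_stabP. Qed.

Lemma arm_row (x : 'I_n) : (q < ccol x)%N -> crow x = 0%N.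
Proof.
have := ccol_lt x; rewrite nth_hook_shape //; case: eqP => // _.
by case: (_ < e)%N; case: (_ < h)%N => /=; lia.
Qed.

Lemma arm_fixed c (x : 'I_n) : c \in col_stab lam -> (q < ccol x)%N -> c x = x.
Proof.
move=> cc xq; have cx := col_stab_col x cc.
by apply: (cell_inj _ cx); rewrite !arm_row // cx.
Qed.

Lemma hit1 c (x : 'I_n) : hit c (crow x) (ccol x) = Ov (crow (c x)) (ccol (c x)).
Proof.
apply/existsP/idP => [[y /and3P[/eqP yr /eqP yc]]|h1]; last by exists x; rewrite !eqxx.
by rewrite (cell_inj yr yc).
Qed.

Lemma hit_out c r t : (nth 0%N lam r <= t)%N -> hit c r t = false.
Proof.
move=> le; apply/existsP => -[x /and3P[/eqP xr /eqP xt _]].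
by have := ccol_lt x; rewrite xr xt ltnNge le.
Qed.

Lemma hit_id r t : (t < nth 0%N lam r)%N -> hit 1%g r t = Ov r t.
Proof. by move/cellP => [x <- <-]; rewrite hit1 perm1. Qed.

Lemma hit_uniq c r r' t : c \in col_stab lam -> hit c r t -> hit c r' t -> r = r'.
Proof.
move=> cc /existsP[x /and3P[/eqP<- /eqP xt xO]] /existsP[y /and3P[/eqP<- /eqP yt yO]].
suff -> : x = y by [].
apply/(@perm_inj _ c)/cell_inj; last by rewrite !col_stab_col // xt yt.
by apply: Ov_uniq xO _; rewrite !col_stab_col // xt -yt -(col_stab_col y cc).
Qed.

Lemma hit_noOv c r t : c \in col_stab lam -> (forall r, ~~ Ov r t) -> hit c r t = false.
Proof.
move=> cc no; apply/existsP => -[x /and3P[_ /eqP xt]].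
by rewrite (col_stab_col x cc) xt (negPf (no _)).
Qed.

Lemma hit_moved c (x : 'I_n) : c \in col_stab lam -> Ov (crow x) (ccol x) -> c x != x ->
  hit c (crow x) (ccol x) = false.
Proof.
move=> cc xO; rewrite hit1; apply: contraNF => cO; apply/eqP.
apply: cell_inj; last exact: col_stab_col.
by apply: (Ov_uniq _ xO); rewrite -(col_stab_col x cc).
Qed.

Lemma hit_arm c r t : c \in col_stab lam -> (1 < t)%N -> hit c r t = false.
Proof. by move=> cc lt; apply: hit_noOv => // r'; apply/negP => /Ov_col; lia. Qed.

Lemma color_moved c x : c \in col_stab lam ->
  v (c x) = if hit c (crow x) (ccol x) || (q < ccol x)%N then [:: 0; 1]%N else [:: kappa (ccol x)].
Proof.
move=> cc; rewrite /hook_color hit1 col_stab_col //.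
by case: (Ov _ _) => //=; rewrite leqNgt; case: ltnP.
Qed.

Lemma card_alpha c r : c \in col_stab lam -> (r < h)%N -> ~~ hit c r 0 -> #|cells c r [:: 0%N]| = 1%N.
Proof.
move=> cc rh nh; apply: (@card_cells_at _ _ c r 0%N); first by rewrite nth_hook_shape // rh addn1.
move=> x xr; rewrite color_moved // xr; case: (ccol x) nh => [|t] nh.
  by rewrite (negPf nh).
by case: (_ || _).
Qed.

Lemma card_alpha0 c r : c \in col_stab lam -> hit c r 0 -> #|cells c r [:: 0%N]| = 0%N.
Proof.
move=> cc hr; apply: card_cells0 => x xr; rewrite color_moved // xr.
by case: (ccol x) => [|t]; rewrite ?hr //; case: (_ || _).
Qed.

Lemma card_kappa c r t : c \in col_stab lam -> (t < nth 0%N lam r)%N -> (0 < t <= q)%N ->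
  ~~ hit c r t -> #|cells c r [:: kappa t]| = 1%N.
Proof.
move=> cc lt tq nh; apply: (card_cells_at lt) => x xr; rewrite color_moved // xr.
case: (ccol x =P t) => [->|ne].
  by rewrite (negPf nh) /= ltnNge; case/andP: tq => _ ->; rewrite eqxx.
case: (_ || _); first by apply/eqP.
by apply/eqP => -[/kappa_inj].
Qed.

Lemma card_kappa0 c r t : c \in col_stab lam -> (nth 0%N lam r <= t)%N || hit c r t ->
  (0 < t)%N -> #|cells c r [:: kappa t]| = 0%N.
Proof.
move=> cc lt tq; apply: card_cells0 => x xr; rewrite color_moved // xr.
case: ifP => [_|/negbT]; first by rewrite eqseq_cons andbF.
rewrite negb_or => /andP[nh _]; apply/eqP => -[/kappa_inj et].
by move: lt (ccol_lt x); rewrite et xr in nh *; rewrite (negPf nh) orbF ltnNge => ->.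
Qed.

Lemma card_gamma c r : c \in col_stab lam -> (r < h)%N ->
  #|cells c r [:: 0; 1]%N| = ((r == 0)%N * a + hit c r 0 + hit c r 1)%N.
Proof.
move=> cc rh; have cell0 : (0 < nth 0%N lam r)%N by rewrite nth_hook_shape // rh addn1.
have arms : #|[set x : 'I_n | (crow x == r) && (q < ccol x)%N]| = ((r == 0)%N * a)%N.
  case: (r =P 0%N) => [->|/eqP rn].
    have le : (a + q + 1 <= nth 0%N lam 0)%N by [].
    rewrite mul1n; transitivity (a + q + 1 - q.+1)%N; last by lia.
    rewrite -(@card_row_interval lam 0 q.+1 _ le); apply: eq_card => x; rewrite !inE.
    by case: eqP => //= x0; have := ccol_lt x; rewrite x0 /= => ->; rewrite andbT.
  rewrite mul0n; apply: eq_card0 => x; rewrite !inE; apply/negP => /andP[/eqP xr /arm_row].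
  by rewrite xr => /eqP; rewrite (negPf rn).
have at_ t : #|[set x : 'I_n | [&& crow x == r, ccol x == t & hit c r t]]| = hit c r t.
  case: (boolP (hit c r t)) => [hr|_]; last first.
    by apply: eq_card0 => x; rewrite !inE !andbF.
  have [x xr xt] : exists2 x : 'I_n, crow x = r & ccol x = t.
    by case/existsP: hr => x /and3P[/eqP ? /eqP ? _]; exists x.
  apply/eqP/cards1P; exists x; apply/setP => y; rewrite !inE.
  apply/and3P/eqP => [[/eqP yr /eqP yt _]|->]; last by rewrite xr xt !eqxx.
  by apply: cell_inj; rewrite ?xr ?xt.
have ind (P : pred 'I_n) : #|[set x | P x]| = (\sum_x P x)%N.
  rewrite -sum1_card [LHS]big_mkcond; apply: eq_bigr => x _; rewrite inE; case: (P x) => //.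

rewrite card_cells -arms -!at_ !ind -!big_split. apply: eq_bigr => x _ /=.
case: eqP => //= xr; rewrite color_moved // xr.
have hq : hit c r (ccol x) -> ~~ (q < ccol x)%N.
  case/existsP=> y /and3P[_ /eqP yt /Ov_col]; rewrite (col_stab_col y cc) yt -leqNgt.
  by case/andP.
case: (ccol x) hq => [|[|t]] hq; rewrite /= ?eqxx.
- by case: (hit c r 0).
- by move: hq; case: (hit c r 1) => [/(_ isT)/negPf->|_] //=; case: (q < 1)%N.
- by rewrite hit_arm //=; case: (q < t.+2)%N.
Qed.

Definition inner : seq nat := map kappa (iota 1 q).
Definition bsum c r : A := \sum_(j <- inner) part c r [:: j].

Lemma inner_uniq : uniq inner.
Proof. by rewrite map_inj_uniq ?iota_uniq //; apply: kappa_inj. Qed.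

Lemma inner_ge2 : all (leq 2) inner.
Proof. by apply/allP => j /mapP[t]; rewrite mem_iota => /andP[t0 _] ->; rewrite /kappa; case: t t0. Qed.

Lemma row_hook c r : c \in col_stab lam ->
  row_element (z \o c) r = part c r [:: 0%N] + part c r [:: 0; 1]%N + bsum c r.
Proof.
move=> cc; rewrite (@row_parts K lam v c r
  ([:: 0%N] :: [:: 0; 1]%N :: [seq [:: j] | j <- inner])).
- by rewrite !big_cons big_map addrA.
- rewrite /= map_inj_uniq ?inner_uniq => [|i j [] //]; rewrite andbT.
  rewrite inE /=; apply/andP; split; apply/mapP => -[j ji] //.
  by case=> j0; have := allP inner_ge2 j ji; rewrite -j0.
move=> x xr; rewrite color_moved //; case: ifP => [_|/negbT]; first by rewrite !inE eqxx orbT.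
rewrite negb_or -leqNgt => /andP[_ xq]; case: (posnP (ccol x)) => [->|x0]; first by rewrite !inE.
rewrite !inE; apply/orP; right; apply/orP; right; apply/mapP; exists (kappa (ccol x)) => //.
by apply: map_f; rewrite mem_iota; lia.
Qed.

Lemma neutral_bsum c r : @neutral K n v (bsum c r).
Proof. by apply: neutral_sum inner_ge2 _ => j; apply: chom_part. Qed.

Lemma chom_ad_bsum c r r' : chom [::] (ad (bsum c r) (bsum c r')).
Proof. by apply: chom_ad_orthogonal inner_uniq => j; apply: chom_part. Qed.

Lemma bsum_single c r : c \in col_stab lam -> (e <= r)%N -> bsum c r = 0.
Proof.
move=> cc er; rewrite /bsum big_map big_seq big1 // => t; rewrite mem_iota => /andP[t0 tq].
apply: part_empty; apply: card_kappa0 => //; rewrite nth_hook_shape //.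
have -> : (r < e)%N = false by lia.
by case: (r =P 0%N) => [r0|]; [lia | case: (r < h)%N; rewrite /= ?t0; lia].
Qed.

Lemma iter_ad_hook c r s : c \in col_stab lam ->
  iter s.+1 (ad (row_element (z \o c) 0)) (row_element (z \o c) r) =
  (part c r [:: 0%N] * part c 0%N [:: 0; 1]%N ^+ s.+1 +
   (part c r [:: 0%N] * part c 0%N [:: 0; 1]%N ^+ s * part c 0%N [:: 0%N]) *+ ~~ odd s +
   part c r [:: 0; 1]%N * part c 0%N [:: 0%N] * part c 0%N [:: 0; 1]%N ^+ s) *+ 2 ^ s.+1
  + (ad (bsum c 0%N) (bsum c r)) *+ (s == 0)%N.
Proof.
move=> cc; rewrite !row_hook //.
by apply: iter_ad_row => //; (try exact: chom_part); (try exact: neutral_bsum); exact: chom_ad_bsum.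
Qed.

Lemma ad_hook c r r' : c \in col_stab lam ->
  ad (row_element (z \o c) r') (row_element (z \o c) r) =
  (part c r [:: 0%N] * part c r' [:: 0; 1]%N + part c r [:: 0%N] * part c r' [:: 0%N] +
   part c r [:: 0; 1]%N * part c r' [:: 0%N]) *+ 2 + ad (bsum c r') (bsum c r).
Proof.
move=> cc; rewrite !row_hook //.
by apply: ad_rows => //; (try exact: chom_part); (try exact: neutral_bsum); exact: chom_ad_bsum.
Qed.

Lemma bsum_pair_pure r r' : r != r' -> (r < e)%N -> (r' < e)%N ->
    (forall t, (0 < t)%N -> ~~ Ov r t && ~~ Ov r' t) ->
  pure (\bigcup_(j <- inner) (cells 1%g r [:: j] :|: cells 1%g r' [:: j]))
    (ad (bsum 1%g r') (bsum 1%g r) ^+ q).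
Proof.
move=> ne re re' no.
have one : 1%g \in col_stab lam by apply/col_stabP => x; rewrite perm1.
have := @pair_power K lam v charK 1%g r r' inner inner_uniq ne.
rewrite size_map size_iota; apply=> j /mapP[t]; rewrite mem_iota => tq ->.
have [t0 tq'] : (0 < t)%N /\ (t <= q)%N by lia.
have lt i : (i < e)%N -> (t < nth 0%N lam i)%N.
  by move=> ie; rewrite nth_hook_shape // ie (leq_trans ie eh); lia.
have /andP[n1 n2] := no t t0.
by split; apply: card_kappa; rewrite ?hit_id ?lt ?t0.
Qed.

Lemma lie_nilpotent_hook p (s s1 : bool) :
    (forall r, Ov r 0%N -> s) -> (forall r, Ov r 1%N -> s1) ->
    (sumn lam + s + 2 <= p + h)%N || (sumn lam + (a + s + s1) < 2 * p)%N ->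
  lie_nilpotent A p.
Proof.
move=> hs hs1 lep.
pose T t := [set x : 'I_n | (ccol x == t) && Ov (crow x) t].
have cardT t (b : bool) : (forall r, Ov r t -> b) -> (#|T t| <= b)%N.
  move=> hb; case: (set_0Vmem (T t)) => [->|[x]]; first by rewrite cards0.
  rewrite inE => /andP[/eqP xt xO]; rewrite (hb _ xO).
  apply: leq_trans (_ : _ <= #|[set x]|)%N _; last by rewrite cards1.
  apply: subset_leq_card.
  apply/subsetP => y; rewrite !inE => /andP[/eqP yt yO]; apply/eqP/cell_inj; last by rewrite yt xt.
  exact: Ov_uniq yO xO.
pose R := [set x : 'I_n | (crow x == 0%N) && (q.+1 <= ccol x < a + q + 1)%N].
apply: (@lie_nilpotent_shape K lam v p s (a + s + s1) (T 0%N) (R :|: T 0%N :|: T 1%N)).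
- exact: hook_shape_pos.
- exact: cardT.
- apply: leq_trans (leq_card_setU _ _) _; apply: leq_add; last exact: cardT.
  apply: leq_trans (leq_card_setU _ _) _; apply: leq_add; last exact: cardT.
  by rewrite card_row_interval //; lia.
- move=> x; rewrite /hook_color inE; case: ifP => xO.
    by case: eqP xO => //= ->  ->.
  by case: ifP => /=; case: (ccol x) => //=.
- move=> x; rewrite /hook_color !inE; case: ifP => xO.
    have := Ov_col xO; move: xO.
    by case: (ccol x) => [|[|t]] /= xO; rewrite ?andbF ?xO ?orbT.
  case: ifP => //= /negbT; rewrite -ltnNge => xq; have x0 := arm_row xq.
  by rewrite x0 xq; have := ccol_lt x; rewrite x0 /= => ->.
- by rewrite size_hook_shape.
Qed.

Lemma standard_hook r : (0 < r)%N -> (forall t, ~~ Ov r t) -> @standard_row lam v r.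
Proof.
move=> r0 no x xr; rewrite /hook_color xr (negPf (no _)); case: leqP => // /arm_row.
by rewrite xr => r00; rewrite r00 in r0.
Qed.

Section Appears.
Variables (p : nat) (hd : seq (seq nat)) (o m : nat) (S : {set 'I_n}).
Hypotheses (nilA : lie_nilpotent A p) (hd1 : all (fun d => 1 < size d)%N hd).
Hypotheses (o0 : (0 < o)%N) (omh : (o + m.*2 <= h)%N) (oe : odd o = odd e).
Hypothesis noOv : forall r t, (o <= r < o + m.*2)%N -> ~~ Ov r t.
Hypothesis cnt : forall r, count_mem r (flatten hd) =
  if (o <= r < o + m.*2)%N then 0%N else nth 0%N lam r.
Hypothesis rS : forall x, x \in S -> ~~ (o <= crow x < o + m.*2)%N.

(** As o and e have the same parity, no pair straddles row e, where the length changes from q + 1 to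
    1. *)
Let len t : (t < m)%N -> nth 0%N lam (o + t.*2) = nth 0%N lam (o + t.*2).+1.
Proof.
move=> tm; rewrite !nth_hook_shape //.
have -> : ((o + t.*2).+1 < e)%N = (o + t.*2 < e)%N.
  have := odd_double_half o; have := odd_double_half e; rewrite oe.
  case: (odd e) => /=; lia.
have -> : (o + t.*2 == 0)%N = false by lia.
have -> : (o + t.*2 < h)%N by lia.
by have -> : ((o + t.*2).+1 < h)%N by lia.
Qed.

Let std r : (o <= r < o + m.*2)%N -> @standard_row lam v r.
Proof. by move=> rr; apply: standard_hook => [|t]; [lia | exact: noOv]. Qed.

Lemma appears_hook_multiple X (k0 : nat) : pure S X ->
    comm_prod (row_element z) hd = X *+ k0.+1 ->
    (forall c, c \in col_stab lam ->
      comm_prod (row_element (z \o c)) hd = 0 \/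
      exists k : nat, exists g, exists2 c0, color_sign_perm v c0 & c = (g * c0)%g /\
       (forall x, (o <= crow x < o + m.*2)%N -> g x = x) /\
       (-1) ^+ g *: comm_prod (row_element (z \o g)) hd = X *+ k) ->
  appears K p lam.
Proof.
move=> pX X1 hc; apply: (@appears_of_head K lam v charK p hd o m S X) => //.
by exists k0.
Qed.

Lemma color_sign_hook c : c \in col_stab lam -> (forall x : 'I_n, Ov (crow x) (ccol x) -> c x = x) ->
  color_sign_perm v c.
Proof.
move=> cc fixO x; case: (boolP (c x == x)) => [/eqP->|cx] //.
have nO : ~~ Ov (crow x) (ccol x) by apply: contra cx => /fixO->.
have nO' : ~~ Ov (crow (c x)) (ccol (c x)).
  by apply: contra cx => /fixO/perm_inj->.
have xq : (ccol x <= q)%N by rewrite leqNgt; apply: contra cx => /(arm_fixed cc)->.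
rewrite /hook_color (negPf nO) (negPf nO') (col_stab_col x cc) xq; split=> // _.
by rewrite color_dot1 eqxx.
Qed.

(** If every special cell still holds its special letter, then c moves only letters of equal odd
    color and counts like the identity. *)
Lemma appears_hook : pure S (comm_prod (row_element z) hd) ->
    (forall c, c \in col_stab lam ->
      (exists x : 'I_n, Ov (crow x) (ccol x) && ~~ hit c (crow x) (ccol x)) ->
      comm_prod (row_element (z \o c)) hd = 0) ->
  appears K p lam.
Proof.
move=> pX hc; apply: (@appears_hook_multiple _ 0 pX) => // c cc.
case: (boolP [exists x : 'I_n, Ov (crow x) (ccol x) && ~~ hit c (crow x) (ccol x)]).
  by move/existsP => hx; left; apply: hc.
move/existsPn => nx; right; exists 1%N, 1%g, c; last split; rewrite ?mul1g //; last first.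
  split=> [x _|]; first by rewrite perm1.
  by rewrite odd_perm1 scale1r; apply: eq_comm_prod; apply: row_element1.
apply: color_sign_hook => // x xO; apply/eqP; apply: contraT => cx.
by have := nx x; rewrite xO (hit_moved cc xO cx).
Qed.
End Appears.
End HookColors.

Arguments hook_shape : simpl never.

Lemma lcommutator_nseq (B : nzRingType) (y : nat -> B) i j k rest :
  lcommutator (map y (i :: nseq k j ++ rest)) =
  foldl (fun u w => ad w u) (iter k (ad (y j)) (y i)) (map y rest).
Proof. by rewrite map_cons lcommutatorE map_cat map_nseq foldl_ad_nseq. Qed.

Lemma lcommutator_nseq0 (B : nzRingType) (y : nat -> B) i j k :
  lcommutator (map y (i :: nseq k j)) = iter k (ad (y j)) (y i).
Proof. by rewrite -[nseq k j]cats0 lcommutator_nseq. Qed.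

Lemma lcommutator_nseq1 (B : nzRingType) (y : nat -> B) i j k l :
  lcommutator (map y (i :: nseq k j ++ [:: l])) = ad (y l) (iter k (ad (y j)) (y i)).
Proof. by rewrite lcommutator_nseq. Qed.

Lemma lcommutator_nseq2 (B : nzRingType) (y : nat -> B) i j k l l' :
  lcommutator (map y (i :: nseq k j ++ [:: l; l'])) =
  ad (y l') (ad (y l) (iter k (ad (y j)) (y i))).
Proof. by rewrite lcommutator_nseq. Qed.

Lemma comm_prod_cons (B : nzRingType) (y : nat -> B) d rs :
  comm_prod y (d :: rs) = lcommutator (map y d) * comm_prod y rs.
Proof. by rewrite /comm_prod big_cons. Qed.

Lemma count_flatten_nseq2 (k i j r : nat) :
  count_mem r (flatten (nseq k [:: i; j])) = (k * ((i == r) + (j == r)))%N.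
Proof. by elim: k => //= k ->; rewrite mulSn addnA. Qed.

Section InnerCells.
Variables (K : fieldType) (a q e h : nat) (Ov : nat -> nat -> bool).
Local Notation lam := (hook_shape a q e h).
Local Notation v := (@hook_color a q e h Ov).
Local Notation cells := (@cells lam v).

Definition inner_cells r r' : {set 'I_(sumn lam)} :=
  \bigcup_(j <- inner q) (cells 1%g r [:: j] :|: cells 1%g r' [:: j]).

Lemma crow_inner_cells r r' x : x \in inner_cells r r' -> crow x = r \/ crow x = r'.
Proof.
apply: (big_rec (fun U : {set 'I__} => x \in U -> crow x = r \/ crow x = r')) => [|j U _ IH].
  by rewrite inE.
by rewrite !in_setU => /orP[/orP[]/mem_cells_row->|/IH]; auto.
Qed.

Lemma disjoint_inner_cells r r' i w : all (fun k => k < 2)%N w ->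
  [disjoint cells 1%g i w & inner_cells r r'].
Proof.
move=> hw; rewrite disjoint_sym; apply: disjoint_bigcup_seq => j /(allP (inner_ge2 q)) j2.
have nw : [:: j] != w by apply: contraTneq hw => <-; rewrite /= andbT -leqNgt j2.
by rewrite -setI_eq0 setIUl setU_eq0 !setI_eq0 !disjoint_cells ?nw ?orbT.
Qed.
End InnerCells.

Ltac disj :=
  rewrite -setI_eq0 ?(setIUl, setIUr, setU_eq0) !setI_eq0; repeat (apply/andP; split);
  solve [by apply: disjoint_cells; apply/orP; solve [by left | left; lia | by right] | by apply: disjoint_inner_cells].

Lemma pureMn_exp2 (K : fieldType) n (v : 'I_n -> seq nat) (S : {set 'I_n}) (x : calg K v) k :
  [pchar K] =i pred0 -> pure S x -> pure S (x *+ 2 ^ k).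
Proof. by move=> charK px; case: (2 ^ k)%N (expn_gt0 2 k) => // m _; apply: pureMn. Qed.

Lemma gamma_even : ~~ color_dot [:: 0; 1]%N [:: 0; 1]%N.
Proof. cdot. Qed.

Section HookParts.
Variables (K : fieldType) (a q e h : nat) (Ov : nat -> nat -> bool).
Hypothesis charK : [pchar K] =i pred0.
Hypotheses (e1 : (0 < e)%N) (eh : (e <= h)%N).
Hypothesis Ov_col : forall r t, Ov r t -> (t <= q)%N && (t <= 1)%N.
Hypothesis Ov_uniq : forall r r' t, Ov r t -> Ov r' t -> r = r'.
Local Notation lam := (hook_shape a q e h).
Local Notation v := (@hook_color a q e h Ov).
Local Notation A := (calg K v).
Local Notation z := (@letter K (sumn lam) v).
Local Notation part := (@part K lam v).
Local Notation cells := (@cells lam v).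
Local Notation pure := (@pure K (sumn lam) v).
Local Notation chom := (@chom K (sumn lam) v).
Local Notation hit := (@hit a q e h Ov).
Local Notation alpha c r := (part c r [:: 0%N]).
Local Notation gamma c r := (part c r [:: 0; 1]%N).
Local Notation Z c r r' := (ad (bsum K Ov c r') (bsum K Ov c r)).
Implicit Types (c : 'S_(sumn lam)).

Lemma col_stab1 : 1%g \in col_stab lam.
Proof. by apply/col_stabP => x; rewrite perm1. Qed.

Lemma gamma_pow0 c r k : c \in col_stab lam -> (r < h)%N ->
  ((r == 0)%N * a + hit c r 0 + hit c r 1 < k)%N -> gamma c r ^+ k = 0.
Proof.
move=> cc rh lt; have [_ ->//] := @part_pow K lam v charK c r [:: 0; 1]%N gamma_even.
by rewrite card_gamma.
Qed.

Lemma gamma0 c r : c \in col_stab lam -> (0 < r < h)%N ->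
  ~~ hit c r 0 -> ~~ hit c r 1 -> gamma c r = 0.
Proof.
move=> cc /andP[r0 rh] h0 h1; have := @gamma_pow0 c r 1 cc rh.
by rewrite expr1 (negPf h0) (negPf h1); case: r r0 {rh h0 h1} => // r _; apply.
Qed.

Lemma alpha0 c r : c \in col_stab lam -> hit c r 0 -> alpha c r = 0.
Proof. by move=> cc hr; apply: part_empty; apply: card_alpha0. Qed.

Lemma gamma_pure r k : (r < h)%N -> (((r == 0)%N * a + hit 1%g r 0 + hit 1%g r 1)%N = k)%N ->
  pure (cells 1%g r [:: 0; 1]%N) (gamma 1%g r ^+ k).
Proof.
move=> rh <-; have [] := @part_pow K lam v charK 1%g r [:: 0; 1]%N gamma_even.
by rewrite card_gamma // col_stab1.
Qed.

Lemma alpha_pure r : (r < h)%N -> ~~ Ov r 0 -> pure (cells 1%g r [:: 0%N]) (alpha 1%g r).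
Proof.
move=> rh nO; apply: part_single; apply: card_alpha; rewrite ?col_stab1 // hit_id //.
by rewrite nth_hook_shape // rh addn1.
Qed.

Lemma Z_pure r r' : r != r' -> (r < e)%N -> (r' < e)%N ->
    (forall t, (0 < t)%N -> ~~ Ov r t && ~~ Ov r' t) ->
  pure (@inner_cells a q e h Ov r r') (Z 1%g r r' ^+ q).
Proof. exact: bsum_pair_pure. Qed.

Lemma Z_central c r r' x : Z c r r' * x = x * Z c r r'.
Proof. exact/chom_nil_central/chom_ad_bsum. Qed.

Lemma alpha_absorb c r u x y k : chom u x ->
  alpha c r * x * ((alpha c r * y) *+ k) = 0.
Proof.
move=> hx; rewrite mulrnAr -mulrA (mulrA x) (mulrA (alpha c r)) (mulrA _ x).
rewrite (chom_sandwich0 charK (@chom_part K lam v c r [:: 0%N]) _ hx).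
  by rewrite mul0r mul0rn.
cdot.
Qed.

(** The odd factor [alpha c r] of the first commutator kills every further occurrence of itself, so
    each later commutator contributes only its central part Z. *)
Lemma absorb_tail c r x y u k r1 r2 l : chom u x ->
  (alpha c r * x *+ k) * (alpha c r * y *+ 2 + Z c r1 r2) ^+ l = (alpha c r * x *+ k) * Z c r1 r2 ^+ l.
Proof.
move=> hx; rewrite mul_expr_absorb //; first exact: Z_central.
by rewrite mulrnAl (alpha_absorb _ _ _ _ hx) mul0rn.
Qed.

Lemma iter_ad_row_gt0 c r s : c \in col_stab lam -> (0 < s)%N ->
  iter s (ad (row_element (z \o c) 0%N)) (row_element (z \o c) r) =
  (alpha c r * gamma c 0%N ^+ s + (alpha c r * (gamma c 0%N ^+ s.-1 * alpha c 0%N)) *+ odd s +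
   gamma c r * alpha c 0%N * gamma c 0%N ^+ s.-1) *+ 2 ^ s
  + Z c r 0%N *+ (s == 1)%N.
Proof. by move=> cc; case: s => // s _; rewrite iter_ad_hook // mulrA. Qed.

Lemma ad_third_row c r r2 s : c \in col_stab lam -> odd s ->
  ad (row_element (z \o c) r2)
    (iter s (ad (row_element (z \o c) 0%N)) (row_element (z \o c) r)) =
  ((alpha c r * gamma c 0%N ^+ s + gamma c r * alpha c 0%N * gamma c 0%N ^+ s.-1) *
    gamma c r2) *+ 2 ^ s.+1.
Proof.
move=> cc; case: s => // s os; rewrite !row_hook //.
by apply: ad_third => //; (try exact: chom_part); (try exact: neutral_bsum); exact: chom_ad_bsum.
Qed.

Lemma ad_fourth_row c r r2 s : c \in col_stab lam -> odd s ->
  ad (row_element (z \o c) 0%N) (ad (row_element (z \o c) r2)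
    (iter s (ad (row_element (z \o c) 0%N)) (row_element (z \o c) r))) =
  (alpha c r * (gamma c 0%N ^+ s * (gamma c r2 * alpha c 0%N)) +
   alpha c r * gamma c 0%N ^+ s.+1 * gamma c r2 +
   gamma c r * alpha c 0%N * gamma c 0%N ^+ s * gamma c r2) *+ 2 ^ s.+2.
Proof.
move=> cc; case: s => // s os; rewrite !row_hook //.
have -> : alpha c r * (gamma c 0%N ^+ s.+1 * (gamma c r2 * alpha c 0%N)) =
  alpha c r * gamma c 0%N ^+ s.+1 * gamma c r2 * alpha c 0%N by rewrite !mulrA.
by apply: ad_fourth => //; (try exact: chom_part); (try exact: neutral_bsum); exact: chom_ad_bsum.
Qed.
End HookParts.

(** * The families of partitions *)

Section Families.
Variables (K : fieldType) (a q e h p : nat).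
Hypothesis charK : [pchar K] =i pred0.
Hypotheses (e1 : (1 < e)%N) (eh : (e <= h)%N).
Local Notation lam := (hook_shape a q e h).

Let e0 : (0 < e)%N := ltnW e1.

Section EvenArm.
Hypotheses (ev_e : ~~ odd e) (ev_a : ~~ odd a) (a1 : (0 < a)%N).
Hypothesis lep : (sumn lam + 2 <= p + h)%N || (sumn lam + a < 2 * p)%N.

Let Ov (r t : nat) : bool := false.
Local Notation v := (@hook_color a q e h Ov).
Local Notation z := (@letter K (sumn lam) v).
Local Notation cells := (@cells lam v).
Local Notation alpha r := (@part K lam v 1%g r [:: 0%N]).
Local Notation gamma r := (@part K lam v 1%g r [:: 0; 1]%N).
Local Notation Z r := (ad (bsum K Ov 1%g 0%N) (bsum K Ov (a := a) (e := e) (h := h) 1%g r)).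

Local Notation cp := (@chom_part _ _ _ _ _ _).

Let Oc r t : Ov r t -> (t <= q)%N && (t <= 1)%N. Proof. by []. Qed.
Let Ou r r' t : Ov r t -> Ov r' t -> r = r'. Proof. by []. Qed.
Let one := @col_stab1 a q e h.

Let hit0 r t : hit Ov (1%g : 'S_(sumn lam)) r t = false.
Proof. exact: (@hit_noOv a q e h Ov 1%g r t one). Qed.

Let nilA : lie_nilpotent (calg K v) p.
Proof. by apply: (@lie_nilpotent_hook K a q e h Ov e0 eh Oc Ou p false false) => //; rewrite !addn0. Qed.

Let gam1 r : (0 < r < h)%N -> gamma r = 0.
Proof. by move=> rh; apply: gamma0; rewrite ?hit0. Qed.

Let D0E : ad (row_element (z \o (1%g : 'S_(sumn lam))) 0%N) (row_element (z \o (1%g : 'S_(sumn lam))) 1%N) =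
  (alpha 1%N * (gamma 0%N + alpha 0%N)) *+ 2 + Z 1%N.
Proof.
have h1 : (0 < 1 < h)%N by lia.
by rewrite (@ad_hook K a q e h Ov) // (gam1 h1) mul0r addr0 -mulrDr.
Qed.

(** The first commutator contains y_0 an odd number a + 1 of times. The power a + 1 of the arm
    vanishes, and what remains is alpha_1 gamma_0^a alpha_0. *)
Theorem appears_hook_even_even : ~~ odd h -> appears K p lam.
Proof.
move=> ev_h; pose m := h./2.-1; have hm : (2 + m.*2 = h)%N.
  by rewrite /m; have := odd_double_half h; rewrite (negPf ev_h) add0n; lia.
pose hd := [:: 1%N & nseq a.+1 0%N] :: nseq q [:: 1; 0]%N.
pose S := cells 1%g 1%N [:: 0%N] :|: cells 1%g 0%N [:: 0; 1]%N :|: cells 1%g 0%N [:: 0%N]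
  :|: @inner_cells a q e h Ov 1%N 0%N.
apply: (appears_hook (Ov := Ov) (hd := hd) (o := 2) (m := m) (S := S) charK e0 eh Ou) => //.
- by rewrite /= all_nseq orbT.
- by rewrite hm.
- by rewrite (negPf ev_e).
- move=> r; rewrite hm nth_hook_shape //= count_cat count_nseq count_flatten_nseq2.
  case: r => [|[|r]] /=; [lia|lia|].
  by case: ltnP => rh /=; lia.
- move=> x; rewrite hm !in_setU => xS; suff : (crow x < 2)%N by lia.
  by case/orP: xS => [/orP[/orP[]/mem_cells_row->|/mem_cells_row->]|/crow_inner_cells[]->].
- rewrite -(eq_comm_prod _ (@row_element1 K lam v)) comm_prod_cons comm_prod_nseq.
  rewrite lcommutator_nseq0 (@iter_ad_row_gt0 K a q e h Ov) // oddS ev_a (@gam1 1%N); last by lia.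
  rewrite !mul0r addr0 eqSS (gtn_eqF a1) mulr0n addr0.
  rewrite (@gamma_pow0 K a q e h Ov charK) ?hit0 ?mulr0 ?add0r ?mulr1n; try lia; try done.
  rewrite D0E.
  rewrite (absorb_tail charK _ _ _ _ _ _ _ (chomM (chomX cp) cp)).
  rewrite mulrA.
  apply: pureM; [|apply: pureMn_exp2 => //; do 2?apply: pureM|apply: Z_pure => //; lia].
  + disj.
  + disj.
  + disj.
  + by apply: alpha_pure => //; lia.
  + by apply: gamma_pure; rewrite ?hit0 //; lia.
  + by apply: alpha_pure => //; lia.
- by move=> c _ [x].
Qed.

(** The unpaired last row forms a commutator with y_0. The first commutator, with y_0 an even number
    a of times, gives alpha_1 gamma_0^a; this exhausts the arm, so the second one can only give its
    term with alpha_0. *)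
Theorem appears_hook_even_odd : odd h -> appears K p lam.
Proof.
move=> odd_h; pose m := h./2.-1; have hm : (2 + m.*2 = h.-1)%N.
  by rewrite /m; have := odd_double_half h; rewrite odd_h; lia.
have eh' : (e <= h.-1)%N.
  have : e != h by apply: contraNneq ev_e => ->.
  lia.
pose hd := [:: 1%N & nseq a 0%N] :: [:: h.-1; 0]%N :: nseq q [:: 1; 0]%N.
pose S := cells 1%g 1%N [:: 0%N] :|: (cells 1%g 0%N [:: 0; 1]%N :|:
  (cells 1%g h.-1 [:: 0%N] :|: cells 1%g 0%N [:: 0%N])) :|: @inner_cells a q e h Ov 1%N 0%N.
apply: (appears_hook (Ov := Ov) (hd := hd) (o := 2) (m := m) (S := S) charK e0 eh Ou) => //.
- by rewrite /= size_nseq ltnS a1 all_nseq orbT.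
- by rewrite hm; lia.
- by rewrite (negPf ev_e).
- move=> r; rewrite hm nth_hook_shape //= count_cat count_nseq /= count_flatten_nseq2.
  case: r => [|[|r]] /=; [lia|lia|].
  by case: (ltngtP r.+2 h.-1) => rh /=; lia.
- move=> x; rewrite hm !in_setU => xS; suff : (crow x < 2)%N \/ crow x = h.-1 by lia.
  case/orP: xS => [/orP[/mem_cells_row->|/orP[/mem_cells_row->|/orP[]/mem_cells_row->]]|/crow_inner_cells[]->]; auto.
- rewrite -(eq_comm_prod _ (@row_element1 K lam v)) !comm_prod_cons comm_prod_nseq.
  rewrite lcommutator_nseq0 (lcommutator_nseq0 _ _ _ 1) [iter 1 _ _]/=.
  rewrite (@iter_ad_row_gt0 K a q e h Ov) // (negPf ev_a) (@gam1 1%N); last by lia.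
  have -> : (a == 1)%N = false by case: (a) ev_a => [|[]].
  rewrite !mul0r !mulr0n !addr0 (ad_hook Ov charK e0 eh h.-1 0%N one) (@gam1 h.-1); last by lia.
  rewrite (bsum_single K Ov e0 eh one eh') mul0r addr0 [ad _ 0]ad_comm ?mulr0 ?mul0r // addr0 -mulrDr mulrA.
  have -> : (alpha 1%N * gamma 0%N ^+ a *+ 2 ^ a) * ((alpha h.-1 * (gamma 0%N + alpha 0%N)) *+ 2) =
     (alpha 1%N * (gamma 0%N ^+ a * (alpha h.-1 * alpha 0%N))) *+ 2 ^ a.+1.
    rewrite mulrnAl mulrnAr -mulrnA -expnS; congr (_ *+ _).
    rewrite -!mulrA !mulrDr [X in X + _ = _](_ : _ = 0) ?add0r //.
    rewrite (acomm cp cp); last by cdot.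
    rewrite mulrN (mulrA (_ ^+ _)) -exprSr (@gamma_pow0 K a q e h Ov charK) ?hit0 ?mul0r ?oppr0 ?mulr0 //; lia.
  rewrite D0E.
  rewrite (absorb_tail charK _ _ _ _ _ _ _ (chomM (chomX cp) (chomM cp cp))).
  apply: pureM; [|apply: pureMn_exp2 => //; do 3?apply: pureM|apply: Z_pure => //; lia].
  + disj.
  + disj.
  + by apply: alpha_pure => //; lia.
  + disj.
  + by apply: gamma_pure; rewrite ?hit0 //; lia.
  + disj.
  + by apply: alpha_pure => //; lia.
  + by apply: alpha_pure => //; lia.
- by move=> c _ [x].
Qed.
End EvenArm.
End Families.

Section OddOdd.
Variables (K : fieldType) (a q e h p : nat).
Hypothesis charK : [pchar K] =i pred0.
Hypotheses (e1 : (1 < e)%N) (eh : (e <= h)%N).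
Local Notation lam := (hook_shape a q e h).
Hypotheses (ev_e : ~~ odd e) (odd_a : odd a) (odd_h : odd h).
Hypothesis lep : (sumn lam + 3 <= p + h)%N || (sumn lam + a.+1 < 2 * p)%N.

Let e0 : (0 < e)%N := ltnW e1.
Let Ov (r t : nat) : bool := (r == h.-1) && (t == 0%N).
Local Notation v := (@hook_color a q e h Ov).
Local Notation cells := (@cells lam v).
Local Notation gamma c r := (@part K lam v c r [:: 0; 1]%N).
Local Notation cp := (@chom_part _ _ _ _ _ _).

Let Oc r t : Ov r t -> (t <= q)%N && (t <= 1)%N. Proof. by case/andP=> _ /eqP->. Qed.
Let Ou r r' t : Ov r t -> Ov r' t -> r = r'.
Proof. by case/andP=> /eqP-> _ /andP[/eqP-> _]. Qed.
Let one := @col_stab1 a q e h.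

Let eh' : (e <= h.-1)%N.
Proof. have : e != h by apply: contraNneq ev_e => ->. by lia. Qed.

Let nilA : lie_nilpotent (calg K v) p.
Proof.
apply: (@lie_nilpotent_hook K a q e h Ov e0 eh Oc Ou p true false) => //.
  by move=> r /andP[_ /eqP].
by move: lep; lia.
Qed.

Let hitE r t : (t < nth 0%N lam r)%N -> hit Ov (1%g : 'S_(sumn lam)) r t = Ov r t.
Proof. exact: hit_id. Qed.

Let hit0 r : r != h.-1 -> hit Ov (1%g : 'S_(sumn lam)) r 0%N = false.
Proof.
move=> rh; case: (ltnP 0 (nth 0%N lam r)) => [lt|ge]; first by rewrite hitE // /Ov (negPf rh).
exact: hit_out.
Qed.

Let hit_1 c r : c \in col_stab lam -> hit Ov c r 1 = false.
Proof. by move=> cc; apply: hit_noOv => // r'; rewrite /Ov andbF. Qed.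

(** The last row is unpaired and joins the first commutator by its special cell:
    [y_1, y_0, ..., y_0, y_(h-1), y_0] gives alpha_1 gamma_0^a gamma_(h-1) alpha_0. If the special
    letter leaves the last row, gamma_(h-1) and the commutator vanish. *)
Theorem appears_hook_odd_odd : appears K p lam.
Proof.
pose m := h./2.-1; have hm : (2 + m.*2 = h.-1)%N.
  by rewrite /m; have := odd_double_half h; rewrite odd_h; lia.
pose hd := [:: 1%N & nseq a 0%N ++ [:: h.-1; 0%N]] :: nseq q [:: 1; 0]%N.
pose S := cells 1%g 1%N [:: 0%N] :|: (cells 1%g 0%N [:: 0; 1]%N :|:
  (cells 1%g h.-1 [:: 0; 1]%N :|: cells 1%g 0%N [:: 0%N])) :|: @inner_cells a q e h Ov 1%N 0%N.
have a0 : (0 < a)%N by case: (a) odd_a.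
apply: (appears_hook (Ov := Ov) (hd := hd) (o := 2) (m := m) (S := S) charK e0 eh Ou) => //.
- by rewrite /= size_cat /= addnC all_nseq orbT.
- by rewrite hm; lia.
- by rewrite (negPf ev_e).
- by move=> r t; rewrite hm /Ov; lia.
- move=> r; rewrite hm nth_hook_shape //= !count_cat count_nseq /= count_flatten_nseq2.
  case: r => [|[|r]] /=; [lia|lia|].
  by case: (ltngtP r.+2 h.-1) => rh /=; lia.
- move=> x; rewrite hm !in_setU => xS; suff : (crow x < 2)%N \/ crow x = h.-1 by lia.
  case/orP: xS => [/orP[/mem_cells_row->|/orP[/mem_cells_row->|/orP[]/mem_cells_row->]]|/crow_inner_cells[]->]; auto.
- rewrite -(eq_comm_prod _ (@row_element1 K lam v)) !comm_prod_cons comm_prod_nseq.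
  rewrite lcommutator_nseq2 ad_fourth_row //.
  have g1 : gamma 1%g 1%N = 0.
    by apply: gamma0; rewrite ?hit_1 ?hit0 //; lia.
  rewrite (ad_hook Ov charK e0 eh 1%N 0%N one) g1 !mul0r !addr0.
  rewrite (@gamma_pow0 K a q e h Ov charK e0 eh Oc 1%g 0%N a.+1) ?hit0 ?hit_1 //; try lia.
  rewrite mulr0 mul0r addr0 -mulrDr.
  rewrite (absorb_tail charK _ _ _ _ _ _ _ (chomM (chomX cp) (chomM cp cp))).
  apply: pureM; [|apply: pureMn_exp2 => //; do 3?apply: pureM|apply: Z_pure => //; try lia].
  + disj.
  + disj.
  + by apply: alpha_pure => //; rewrite /Ov; lia.
  + disj.
  + by apply: gamma_pure; rewrite ?hit0 ?hit_1 //; lia.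
  + disj.
  + rewrite -[gamma 1%g h.-1]expr1; apply: gamma_pure => //; first by lia.
    rewrite hit_1 // hitE /Ov ?eqxx; first by lia.
    by rewrite nth_hook_shape //; lia.
  + by apply: alpha_pure => //; rewrite /Ov; lia.
  + by move=> t t0; rewrite /Ov; lia.
move=> c cc [x /andP[xO nh]].
have g0 : gamma c h.-1 = 0.
  apply: gamma0; rewrite ?hit_1 //; first by lia.
  by case/andP: xO nh => /eqP-> /eqP->.
by rewrite comm_prod_cons lcommutator_nseq2 ad_fourth_row // g0 !(mulr0, mul0r) !addr0 mul0rn mul0r.
Qed.
End OddOdd.

Section CornerGamma.
Variables (K : fieldType) (a q e h p : nat) (b : bool) (R l o m : nat).
Hypothesis charK : [pchar K] =i pred0.
Hypotheses (e0 : (0 < e)%N) (eh : (e <= h)%N).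
Local Notation lam := (hook_shape a q e h).
Hypotheses (bq : b -> (0 < q)%N) (R0 : (0 < R)%N) (Rh : (R < h)%N) (odd_N : odd (a + b)).
Hypotheses (o0 : (0 < o)%N) (omh : (o + m.*2 <= h)%N) (oe : odd o = odd e).
Hypothesis Ro : ~~ (o <= R < o + m.*2)%N.
Hypothesis lep : (sumn lam + 3 <= p + h)%N || (sumn lam + (a + 1 + b) < 2 * p)%N.

(** The flag b makes the cell (0, 1) special along with the corner, so that a + b can be made odd
    for either parity of a. *)
Let Ov (r t : nat) : bool := (r == 0%N) && ((t == 0%N) || b && (t == 1%N)).
Local Notation v := (@hook_color a q e h Ov).
Local Notation A := (calg K v).
Local Notation z := (@letter K (sumn lam) v).
Local Notation cells := (@cells lam v).
Local Notation alpha c r := (@part K lam v c r [:: 0%N]).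
Local Notation gamma c r := (@part K lam v c r [:: 0; 1]%N).
Local Notation Z c r r' := (ad (bsum K (a := a) (q := q) (e := e) (h := h) Ov c r') (bsum K (a := a) (q := q) (e := e) (h := h) Ov c r)).
Local Notation cp := (@chom_part _ _ _ _ _ _).
Local Notation hit := (@hit a q e h Ov).
Implicit Types (c : 'S_(sumn lam)).

Let hd := [:: R & nseq (a + b).+1 0%N] :: nseq l [:: R; 0]%N.
Hypothesis cnt : forall r, count_mem r (flatten hd) =
  if (o <= r < o + m.*2)%N then 0%N else nth 0%N lam r.
Variable SZ : {set 'I_(sumn lam)}.
Hypothesis pSZ : pure SZ (Z 1%g R 0%N ^+ l).
Hypothesis rSZ : forall x, x \in SZ -> (crow x = 0%N \/ crow x = R).
Hypothesis dSZ : forall c r w, all (fun k => k < 2)%N w -> [disjoint cells c r w & SZ].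

Let Oc r t : Ov r t -> (t <= q)%N && (t <= 1)%N.
Proof. by case/andP=> _ /orP[/eqP->//|/andP[/bq q0 /eqP->]]; rewrite q0. Qed.
Let Ou r r' t : Ov r t -> Ov r' t -> r = r'.
Proof. by case/andP=> /eqP-> _ /andP[/eqP-> _]. Qed.
Let one := @col_stab1 a q e h.

Let nilA : lie_nilpotent A p.
Proof.
apply: (@lie_nilpotent_hook K a q e h Ov e0 eh Oc Ou p true b) => //.
  by move=> r /andP[_]; rewrite andbT.
by move: lep; lia.
Qed.

Let nth_pos r : (r < h)%N -> (0 < nth 0%N lam r)%N.
Proof. by move=> rh; rewrite nth_hook_shape // rh addn1. Qed.

Let color_alpha x : v x = [:: 0%N] -> ccol x = 0%N /\ ~~ Ov (crow x) (ccol x).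
Proof.
rewrite /hook_color; case: ifP => // xO; case: leqP => // _ []; rewrite /kappa.
by case: (ccol x).
Qed.

Let color_gamma x : v x = [:: 0; 1]%N -> crow x = 0%N.
Proof.
rewrite /hook_color; case: ifP => [/andP[/eqP-> //]|_]; case: leqP => // xq _.
exact: (@arm_row a q e h e0 eh x xq).
Qed.

Let head c := comm_prod (row_element (z \o c)) hd.

Let headE c : c \in col_stab lam -> head c =
  ((alpha c R * gamma c 0%N ^+ (a + b).+1 +
    gamma c R * alpha c 0%N * gamma c 0%N ^+ (a + b)) *+ 2 ^ (a + b).+1) *
  ((alpha c R * gamma c 0%N + alpha c R * alpha c 0%N + gamma c R * alpha c 0%N) *+ 2 +
    Z c R 0%N) ^+ l.
Proof.
move=> cc; rewrite /head comm_prod_cons comm_prod_nseq lcommutator_nseq0 ad_hook //.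
rewrite iter_ad_row_gt0 // oddS odd_N mulr0n addr0.
have -> : ((a + b).+1 == 1)%N = false by case: (a + b)%N odd_N.
by rewrite mulr0n addr0.
Qed.

Let hit01 c : c \in col_stab lam -> (hit c 0 1 <= b)%N.
Proof.
move=> cc; case: (boolP b) => [_|nb]; first by case: hit.
by rewrite hit_noOv // => r; rewrite /Ov (negPf nb) andbF.
Qed.

Let x0P : exists x : 'I_(sumn lam), crow x = 0%N /\ ccol x = 0%N.
Proof. by have [|x ? ?] := @cellP lam 0 0; [exact: nth_pos (leq_trans e0 eh) | exists x]. Qed.
Let xRP : exists x : 'I_(sumn lam), crow x = R /\ ccol x = 0%N.
Proof. by have [|x ? ?] := @cellP lam R 0; [exact: nth_pos Rh | exists x]. Qed.

(** The first term of [headE] needs all a + b + 1 letters of even color in row 0. The second needs a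
    letter of color 0 there, so the corner letter has left row 0, and gamma_R forces it into row
    R. *)
Let head_cases c : c \in col_stab lam ->
  [\/ head c = 0, hit c 0 0 /\ (hit c 0 1 = b) | hit c R 0 /\ (hit c 0 1 = b)].
Proof.
move=> cc; have h01 := hit01 cc; have h0 : (0 < h)%N := leq_trans e0 eh.
case: (boolP (hit c 0 1 == b)) => [/eqP hb|nb].
  case: (boolP (hit c 0 0)) => [h00|n00]; first by constructor 2.
  case: (boolP (hit c R 0)) => [hR0|nR0]; first by constructor 3.
  constructor 1; rewrite headE // gamma_pow0 //; last by rewrite (negPf n00) hb mul1n; lia.
  rewrite (@gamma0 K a q e h Ov charK e0 eh Oc c R) ?R0 ?mulr0 ?mul0r ?addr0 ?mul0rn ?mul0r //.
  apply/negP => hR1; case: (boolP b) => bb.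
    by rewrite bb in hb; have := hit_uniq Ou cc hb hR1; move: R0; lia.
  by move: hR1; rewrite hit_noOv // => r; rewrite /Ov (negPf bb) andbF.
constructor 1; rewrite headE //.
have bb : b /\ hit c 0 1 = false.
  by move: nb h01; case: (hit c 0 1); case: (b).
rewrite gamma_pow0 //; last by rewrite bb.1 bb.2 mul1n; case: (hit c 0 0) => /=; lia.
rewrite mulr0 add0r; case: (boolP (hit c 0 0)) => h00.
  by rewrite (alpha0 K cc h00) mulr0 !mul0r mul0rn mul0r.
by rewrite gamma_pow0 ?mulr0 ?mul0rn ?mul0r // (negPf h00) bb.1 bb.2 mul1n; lia.
Qed.

Let fixes_special c : c \in col_stab lam -> hit c 0 0 -> hit c 0 1 = b -> color_sign_perm v c.
Proof.
move=> cc h00 h01; apply: color_sign_hook => // x xO; apply/eqP; apply: contraT => cx.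
have := hit_moved Ou cc xO cx; case/andP: xO => /eqP-> /orP[/eqP->|/andP[bb /eqP->]].
  by rewrite h00.
by rewrite h01 bb.
Qed.

(* Two classes of column permutations survive: those keeping the corner in place
   contribute a + b + 1 times X, those exchanging it with row R contribute X, with
   the same sign. *)
Theorem appears_corner_gamma : appears K p lam.
Proof.
have [x0 [x0r x0c]] := x0P; have [xR [xRr xRc]] := xRP.
have ne : x0 != xR by apply: contraTneq R0 => e'; rewrite -xRr -e' x0r.
pose t := tperm x0 xR; have tV : (t^-1)%g = t by exact: tpermV.
have tc : t \in col_stab lam.
  by apply/col_stabP => x; rewrite /t; case: tpermP => [->|->|]; rewrite ?x0c ?xRc.
have vx0 : v x0 = [:: 0; 1]%N by rewrite /hook_color x0r x0c.
have vxR : v xR = [:: 0%N].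
  by rewrite /hook_color xRr xRc /Ov; case: R R0 => //.
have fixt y : v y != [:: 0%N] -> v y != [:: 0; 1]%N -> t y = y.
  move=> n0 n1; rewrite /t tpermD //; first by apply: contraNneq n1 => <-; apply/eqP.
  by apply: contraNneq n0 => <-; apply/eqP.
have alphat : alpha t 0%N = alpha 1%g R.
  apply: eq_bigl => y; rewrite !inE tV invg1 perm1.
  case: (v y =P _) => vy; rewrite ?andbF // !andbT; have [yc nO] := color_alpha vy.
  rewrite /t; case: tpermP => [yx|->|n1 n2].
  - by move: vy; rewrite yx vx0.
  - by rewrite x0r xRr !eqxx.
  - apply/eqP/eqP => yr; [case: n1 | case: n2]; apply: cell_inj; rewrite ?yc //; congruence.
have gammatR : gamma t R = z x0.
  rewrite /part (bigD1 x0) /=; last by rewrite inE tV tpermL xRr vx0 !eqxx.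
  rewrite big1 ?addr0 // => y /andP[]; rewrite inE tV => /andP[/eqP yr /eqP vy] yx.
  case/eqP: yx; move: yr; rewrite /t; case: tpermP => // [->|_ _ yr]; first by rewrite x0r => r0; move: R0; rewrite -r0.
  by move: R0; rewrite -yr (color_gamma vy).
have gamma1 : gamma 1%g 0%N = gamma t R + gamma t 0%N.
  rewrite gammatR [LHS](bigD1 x0); last by rewrite mem_cells1 x0r vx0 !eqxx.
  congr (_ + _); apply: eq_bigl => y; rewrite mem_cells1 inE tV.
  case: (v y =P _) => vy; rewrite ?andbF // !andbT; rewrite (color_gamma vy) eqxx /=.
  rewrite /t; case: tpermP => [->|yx|/eqP-> _]; first by rewrite eqxx xRr; apply/esym/eqP => r0; move: R0; rewrite r0.
    by move: vy; rewrite yx vxR.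
  by rewrite (color_gamma vy) eqxx.
have bsumt r : bsum K Ov t r = bsum K (a := a) (e := e) (h := h) Ov 1%g r.
  rewrite /bsum !big_seq; apply: eq_bigr => j jin; apply: eq_bigl => y.
  rewrite !inE tV invg1 perm1; case: (v y =P _) => vy; rewrite ?andbF // !andbT fixt // vy.
    by apply/eqP => -[j0]; have := allP (inner_ge2 q) j jin; rewrite j0.
  by rewrite eqseq_cons andbF.
have h0 : (0 < h)%N := leq_trans e0 eh.
have ht0 : hit t 0 0 = false.
  by rewrite -{1}x0r -{1}x0c hit1 tpermL xRr /Ov; case: R R0.
have htR : hit t R 0 by rewrite -{1}xRr -{1}xRc hit1 tpermR x0r x0c.
have hit1_Ov r s : hit 1%g r s -> Ov r s.
  by case/existsP => x /and3P[/eqP<- /eqP<-]; rewrite perm1.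
have hitt c : hit (t * c)%g 0 1 = hit c 0 1.
  apply: eq_existsb => x; case: (ccol x =P 1%N) => xc; rewrite ?andbF //.
  by rewrite permM /t tpermD //; apply: contra_eq_neq xc => <-; rewrite ?x0c ?xRc.
have hit11 : hit 1%g 0 1 = b.
  apply/idP/idP => [/hit1_Ov/andP[_]|bb]; first by rewrite andbT.
  by rewrite hit_id /Ov ?bb // nth_hook_shape //; have := bq bb; lia.
have alphatR : alpha t R = 0 := alpha0 K tc htR.
have Gamma0 : gamma t 0%N ^+ (a + b).+1 = 0.
  by apply: gamma_pow0; rewrite // ht0 mul1n addn0 ltnS leq_add2l hit01.
(* X is expressed through t because [gamma t R] is the corner letter alone and [gamma t 0] the
   remaining letters of even color. For the identity the corner letter is one of a + b + 1 equal
   candidates in a power, whence the multiple. *)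
pose X := (alpha t 0%N * (gamma t R * gamma t 0%N ^+ (a + b)) *+ 2 ^ (a + b).+1) * Z t R 0%N ^+ l.
have head1 : head 1%g = X *+ (a + b).+1.
  rewrite headE // (@alpha0 K a q e h Ov 1%g 0%N); last 2 first.
  - exact: one.
  - by rewrite -{1}x0r -{1}x0c hit1 perm1 x0r x0c.
  rewrite (@gamma0 K a q e h Ov charK e0 eh Oc 1%g R one); last 3 first.
  - by rewrite R0 Rh.
  - by apply/negP => /hit1_Ov /andP[/eqP R00]; rewrite R00 in (R0).
  - by apply/negP => /hit1_Ov /andP[/eqP R00]; rewrite R00 in (R0).
  rewrite !(mul0r, mulr0) !addr0 gamma1 -alphat -!bsumt expr_add_sq0; last 2 first.
  - by apply: ccomm cp cp _; cdot.
  - by rewrite gammatR; apply: divl_mul0 (@divl_letter K _ v x0) (@divl_letter K _ v x0).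
  rewrite Gamma0 add0r mulrnAr mulrnAC mulrnAl; congr (_ *+ _).
  exact: (absorb_tail charK _ _ _ _ _ _ _ (chomM cp (chomX cp))).
(* The sign of the transposition is compensated by the anticommutation of gamma_R and alpha_0. *)
have headt : (-1) ^+ t *: head t = X.
  have gN : @chom K _ v [:: 0; 1]%N (- gamma t R) by rewrite -scaleN1r; apply: chomZ; exact: cp.
  rewrite headE // alphatR !mul0r !add0r.
  rewrite (acomm (@chom_part _ _ v t 0%N [:: 0%N]) (@chom_part _ _ v t R [:: 0; 1]%N)); last by cdot.
  rewrite -mulrN -mulrA (absorb_tail charK _ _ _ _ _ _ _ (chomM gN (chomX cp))).
  by rewrite mulNr mulrN mulNrn mulNr odd_tperm ne expr1 scaleN1r opprK.
pose S := cells 1%g R [:: 0%N] :|: (cells t R [:: 0; 1]%N :|: cells t 0%N [:: 0; 1]%N) :|: SZ.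
have disj_color c c' r r' w w' : w != w' -> [disjoint cells c r w & cells c' r' w'].
  move=> nw; rewrite -setI_eq0; apply/eqP/setP => x; rewrite !inE.
  by apply/negP => /andP[/andP[_ /eqP->] /andP[_ ww]]; rewrite ww in nw.
apply: (@appears_hook_multiple K a q e h Ov charK e0 eh p hd o m S nilA _ o0 omh oe _ cnt _ X (a + b)) => //.
- by rewrite /= all_nseq orbT.
- by move=> r s /andP[or_ _]; rewrite /Ov (gtn_eqF (leq_trans o0 or_)).
- move=> x; rewrite !in_setU => xS; suff [->|->] : crow x = 0%N \/ crow x = R by [rewrite leqNgt o0|].
  case/orP: xS => [/orP[/mem_cells_row->|/orP[]]|/rSZ]; auto.
  + by rewrite inE => /andP[_ /eqP/color_gamma]; left.
  + by rewrite inE => /andP[_ /eqP/color_gamma]; left.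
- rewrite /X !bsumt; apply: pureM pSZ.
    by rewrite -setI_eq0 !setIUl !setU_eq0 !setI_eq0 !dSZ.
  apply: pureMn_exp2 => //; apply: pureM; last apply: pureM.
  + by rewrite -setI_eq0 !setIUr !setU_eq0 !setI_eq0 !disj_color.
  + by rewrite alphat; apply: alpha_pure => //; rewrite /Ov; case: R R0.
  + by apply: disjoint_cells; rewrite -lt0n R0.
  + have -> : cells t R [:: 0; 1]%N = [set x0].
      apply/setP => y; rewrite !inE tV.
      apply/andP/eqP => [[/eqP yr /eqP vy]|->]; last by rewrite tpermL xRr vx0 !eqxx.
      move: yr; rewrite /t; case: tpermP => // [->|_ _ yr]; first by rewrite x0r => r0; move: R0; rewrite -r0.
      by move: R0; rewrite -yr (color_gamma vy).
    by rewrite gammatR; exact: (@pure_cmono K _ v [set x0]).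
  + have [] := @part_pow K lam v charK t 0%N [:: 0; 1]%N gamma_even.
    rewrite card_gamma // ht0 mul1n addn0 => h1 _.
    have e1 : hit t 0 1 = b by rewrite -[t]mulg1 hitt.
    by rewrite e1 in h1.
- by rewrite -head1; apply: eq_comm_prod => r; rewrite row_element1.
move=> c cc; case: (head_cases cc) => [hz|[h00 h01]|[hR0 h01]]; first by left; exact: hz.
  right; exists (a + b).+1, 1%g, c; last split; rewrite ?mul1g //; last first.
    split=> [x _|]; first by rewrite perm1.
    by rewrite odd_perm1 expr0 scale1r; exact: head1.
  exact: fixes_special.
right; exists 1%N, t, (t * c)%g; last split.
- have tcc : (t * c)%g \in col_stab lam.
    by apply/col_stabP => x; rewrite permM !col_stab_col.
  have cxR : c xR = x0.
    have := hR0; rewrite -{1}xRr -{1}xRc hit1 => /andP[/eqP cr _].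
    by apply: cell_inj; rewrite ?x0r // col_stab_col // xRc.
  apply: fixes_special => //.
    by rewrite -{1}x0r -{1}x0c hit1 permM tpermL cxR x0r x0c.
  by rewrite hitt.
- by rewrite mulgA -{1}tV mulVg mul1g.
split; last by rewrite mulr1n.
move=> x xo; rewrite /t tpermD //; apply: contraTneq xo => <-; first by rewrite x0r leqNgt o0.
by rewrite xRr.
Qed.
End CornerGamma.

Section OddColumn.
Variables (K : fieldType) (a e h p : nat).
Hypothesis charK : [pchar K] =i pred0.
Hypotheses (e3 : (2 < e)%N) (eh : (e <= h)%N) (odd_e : odd e).
Local Notation q := 1%N.
Local Notation lam := (hook_shape a q e h).
Let e0 : (0 < e)%N. Proof. by case: (e) e3. Qed.
Let one := @col_stab1 a q e h.

Section EvenRows.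
Hypotheses (ev_h : ~~ odd h) (odd_a : odd a).
Hypothesis lep : (sumn lam + 2 <= p + h)%N || (sumn lam + a.+1 < 2 * p)%N.
Let Ov (r t : nat) : bool := (r == 0%N) && (t == 1%N).
Local Notation v := (@hook_color a q e h Ov).
Local Notation cells := (@cells lam v).
Local Notation gamma c r := (@part K lam v c r [:: 0; 1]%N).
Let Oc r t : Ov r t -> (t <= q)%N && (t <= 1)%N. Proof. by case/andP=> _ /eqP->. Qed.
Let Ou r r' t : Ov r t -> Ov r' t -> r = r'.
Proof. by case/andP=> /eqP-> _ /andP[/eqP-> _]. Qed.

Let nilA : lie_nilpotent (calg K v) p.
Proof.
apply: (@lie_nilpotent_hook K a q e h Ov e0 eh Oc Ou p false true) => //.
  by move=> r /andP[_ /eqP].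
by move: lep; lia.
Qed.

Let eh' : (e <= h.-1)%N.
Proof. have : e != h by apply: contraNneq ev_h => <-. by lia. Qed.

Let hit_0 c r : c \in col_stab lam -> hit Ov c r 0 = false.
Proof. by move=> cc; apply: hit_noOv => // r'; rewrite /Ov andbF. Qed.

Let gamma_last c : c \in col_stab lam -> gamma c h.-1 = 0.
Proof.
move=> cc; apply: gamma0; rewrite ?hit_0 ?hit_out //; first by lia.
by rewrite nth_hook_shape //; lia.
Qed.

(** Rows 1 to h - 2 are paired. The special cell (0, 1) prolongs the arm to a + 1 letters, so the
    single commutator of the last row with a + 2 entries y_0, an odd number, gives alpha_(h-1)
    gamma_0^(a+1) alpha_0. *)
Theorem appears_odd_column_even : appears K p lam.
Proof.
pose m := h./2.-1; have hm : (1 + m.*2 = h.-1)%N.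
  by rewrite /m; have := odd_double_half h; rewrite (negPf ev_h) add0n; lia.
pose hd := [:: [:: h.-1 & nseq a.+2 0%N]]; have oa2 : odd a.+2 by rewrite /= odd_a.
pose S := cells 1%g h.-1 [:: 0%N] :|: (cells 1%g 0%N [:: 0; 1]%N :|: cells 1%g 0%N [:: 0%N]).
have h00 : hit Ov (1%g : 'S_(sumn lam)) 0 1 by rewrite hit_id // nth_hook_shape //; lia.
apply: (appears_hook (Ov := Ov) (hd := hd) (o := 1) (m := m) (S := S) charK e0 eh Ou) => //.
- by rewrite hm; lia.
- by move=> r t; rewrite hm /Ov; lia.
- move=> r; rewrite hm nth_hook_shape //= cats0 count_nseq.
  case: r => [|r] /=; first by lia.
  by case: (ltngtP r.+1 h.-1) => rh /=; lia.
- move=> x; rewrite hm !in_setU => xS; suff : crow x = 0%N \/ crow x = h.-1 by lia.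
  by case/orP: xS => [/mem_cells_row->|/orP[]/mem_cells_row->]; auto.
- rewrite -(eq_comm_prod _ (@row_element1 K lam v)) comm_prod_cons /comm_prod big_nil mulr1.
  rewrite lcommutator_nseq0 iter_ad_row_gt0 // gamma_last // !mulrb oa2 !mul0r !addr0.
  rewrite (@gamma_pow0 K a q e h Ov charK e0 eh Oc 1%g 0%N a.+2) ?hit_0 ?h00 //; try lia.
  rewrite mulr0 add0r.
  apply: pureMn_exp2 => //; apply: pureM; last apply: pureM.
  + disj.
  + by apply: alpha_pure => //; rewrite /Ov; lia.
  + disj.
  + by apply: gamma_pure; rewrite ?hit_0 ?h00 //; lia.
  + by apply: alpha_pure => //; rewrite /Ov; lia.
move=> c cc [x /andP[/andP[/eqP x0 /eqP x1] nh]]; rewrite x0 x1 in nh.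
rewrite comm_prod_cons lcommutator_nseq0 iter_ad_row_gt0 // gamma_last //.
have g0 k : (a < k)%N -> gamma c 0%N ^+ k = 0.
  by move=> ak; apply: gamma_pow0 => //; rewrite ?hit_0 ?(negPf nh) //; lia.
by rewrite !g0 // !mulrb !(mul0r, mulr0, mul0rn, addr0, if_same).
Qed.
End EvenRows.

Section OddRows.
Hypothesis (odd_h : odd h).

Section OddArm.
Hypothesis odd_a : odd a.
Hypothesis lep : (sumn lam + 2 <= p + h)%N || (sumn lam + a.+1 < 2 * p)%N.
Let Ov (r t : nat) : bool := (r == 2%N) && (t == 1%N).
Local Notation v := (@hook_color a q e h Ov).
Local Notation cells := (@cells lam v).
Local Notation alpha c r := (@part K lam v c r [:: 0%N]).
Local Notation gamma c r := (@part K lam v c r [:: 0; 1]%N).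
Local Notation cp := (@chom_part _ _ _ _ _ _).
Let Oc r t : Ov r t -> (t <= q)%N && (t <= 1)%N. Proof. by case/andP=> _ /eqP->. Qed.
Let Ou r r' t : Ov r t -> Ov r' t -> r = r'.
Proof. by case/andP=> /eqP-> _ /andP[/eqP-> _]. Qed.

Let nilA : lie_nilpotent (calg K v) p.
Proof.
apply: (@lie_nilpotent_hook K a q e h Ov e0 eh Oc Ou p false true) => //.
  by move=> r /andP[_ /eqP].
by move: lep; lia.
Qed.

Let hit_0 c r : c \in col_stab lam -> hit Ov c r 0 = false.
Proof. by move=> cc; apply: hit_noOv => // r'; rewrite /Ov andbF. Qed.

Let hit_1 r : (r < e)%N -> hit Ov (1%g : 'S_(sumn lam)) r 1 = (r == 2%N).
Proof. by move=> re; rewrite hit_id /Ov ?andbT // nth_hook_shape //; lia. Qed.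

(** Rows 0, 1, 2 stay unpaired. The first commutator exhausts the arm and the special letter of row
    2, so of [y_2, y_0] only alpha_2 alpha_0 survives, and of [y_1, y_0] only the central part. *)
Theorem appears_odd_column_odd_odd : appears K p lam.
Proof.
pose m := h./2.-1; have hm : (3 + m.*2 = h)%N.
  by rewrite /m; have := odd_double_half h; rewrite odd_h; lia.
pose hd := [:: [:: 1%N & nseq a 0%N ++ [:: 2%N]]; [:: 2; 0]; [:: 1; 0]]%N.
pose S := cells 1%g 1%N [:: 0%N] :|: (cells 1%g 0%N [:: 0; 1]%N :|:
  (cells 1%g 2%N [:: 0; 1]%N :|: (cells 1%g 2%N [:: 0%N] :|: cells 1%g 0%N [:: 0%N])))
  :|: @inner_cells a q e h Ov 1%N 0%N.
apply: (appears_hook (Ov := Ov) (hd := hd) (o := 3) (m := m) (S := S) charK e0 eh Ou) => //.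
- by rewrite /= size_cat addn1.
- by rewrite hm.
- by move=> r t; rewrite hm /Ov; lia.
- move=> r; rewrite hm nth_hook_shape //= !count_cat count_nseq /=.
  by case: r => [|[|[|r]]] /=; [lia|lia|lia|case: ltnP => rh /=; lia].
- move=> x; rewrite hm !in_setU => xS; suff : (crow x < 3)%N by lia.
  by case/orP: xS => [/orP[/mem_cells_row->|/orP[/mem_cells_row->|/orP[/mem_cells_row->|/orP[]/mem_cells_row->]]]|/crow_inner_cells[]->].
- rewrite -(eq_comm_prod _ (@row_element1 K lam v)) !comm_prod_cons /comm_prod big_nil mulr1.
  rewrite lcommutator_nseq1 ad_third_row //.
  rewrite -![lcommutator (map _ [:: _; _])]/(ad _ _).
  have g1 : gamma 1%g 1%N = 0 by apply: gamma0; rewrite ?hit_0 ?hit_1 //; lia.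
  have b2 : bsum K (a := a) (q := q) (e := e) (h := h) Ov 1%g 2%N = 0.
    rewrite /bsum big_seq1; apply: part_empty; apply: card_kappa0 => //.
    by rewrite hit_1 ?orbT.
  rewrite (ad_hook Ov charK e0 eh 2%N 0%N one) (ad_hook Ov charK e0 eh 1%N 0%N one) g1 b2.
  rewrite [ad _ 0]ad_comm ?mulr0 ?mul0r // !addr0 mulrA.
  have -> : (alpha 1%g 1%N * gamma 1%g 0%N ^+ a * gamma 1%g 2%N) *+ 2 ^ a.+1 *
     ((alpha 1%g 2%N * gamma 1%g 0%N + alpha 1%g 2%N * alpha 1%g 0%N + gamma 1%g 2%N * alpha 1%g 0%N) *+ 2) =
     (alpha 1%g 1%N * (gamma 1%g 0%N ^+ a * (gamma 1%g 2%N * (alpha 1%g 2%N * alpha 1%g 0%N)))) *+ 2 ^ a.+2.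
    rewrite mulrnAl mulrnAr -mulrnA -expnS; congr (_ *+ _).
    rewrite !mulrDr -!mulrA [X in _ + X = _](_ : _ = 0); last first.
      have -> : gamma 1%g 2%N * (gamma 1%g 2%N * alpha 1%g 0%N) = gamma 1%g 2%N ^+ 2 * alpha 1%g 0%N.
        by rewrite mulrA.
      by rewrite (@gamma_pow0 K a q e h Ov charK e0 eh Oc 1%g 2%N 2) ?mul0r ?mulr0 ?hit_0 ?hit_1 //; lia.
    rewrite addr0 [X in X + _ = _](_ : _ = 0) ?add0r //.
    rewrite (acomm (chomM (@chom_part _ _ v 1%g 2%N [:: 0%N]) (@chom_part _ _ v 1%g 0%N [:: 0; 1]%N)) (@chom_part _ _ v 1%g 2%N [:: 0; 1]%N)).
      rewrite (acomm (@chom_part _ _ v 1%g 0%N [:: 0; 1]%N) (@chom_part _ _ v 1%g 2%N [:: 0%N])); last by cdot.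
      rewrite mulNr opprK -!mulrA (mulrA (_ ^+ _)) -exprSr.
      by rewrite (@gamma_pow0 K a q e h Ov charK e0 eh Oc 1%g 0%N a.+1) ?mul0r ?mulr0 ?oppr0 ?mulr0 ?hit_0 ?hit_1 //; lia.
    by rewrite /color_dot !big_cons big_nil.
  rewrite -mulrDr -[X in _ * X]expr1.
  rewrite (absorb_tail charK _ _ _ _ _ _ _ (chomM (chomX cp) (chomM cp (chomM cp cp)))).
  apply: pureM; [|apply: pureMn_exp2 => //; do 4?apply: pureM|apply: Z_pure => //; try lia].
  + disj.
  + disj.
  + by apply: alpha_pure => //; lia.
  + disj.
  + by apply: gamma_pure; rewrite ?hit_0 ?hit_1 //; lia.
  + disj.
  + by rewrite -[gamma 1%g 2%N]expr1; apply: gamma_pure; rewrite ?hit_0 ?hit_1 //; lia.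
  + disj.
  + by apply: alpha_pure => //; lia.
  + by apply: alpha_pure => //; lia.
move=> c cc [x /andP[/andP[/eqP x0 /eqP x1] nh]]; rewrite x0 x1 in nh.
have g0 : gamma c 2%N = 0 by apply: gamma0; rewrite ?hit_0 //; lia.
by rewrite comm_prod_cons lcommutator_nseq1 ad_third_row // g0 !(mulr0, mul0r) mul0rn mul0r.
Qed.
End OddArm.

Section EvenArm.
Hypothesis ev_a : ~~ odd a.
Hypothesis lep : (sumn lam + 3 <= p + h)%N || (sumn lam + a.+2 < 2 * p)%N.
Let Ov (r t : nat) : bool := (r == 0%N) && (t == 1%N) || (r == 2%N) && (t == 0%N).
Local Notation v := (@hook_color a q e h Ov).
Local Notation cells := (@cells lam v).
Local Notation gamma c r := (@part K lam v c r [:: 0; 1]%N).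
Local Notation cp := (@chom_part _ _ _ _ _ _).
Let Oc r t : Ov r t -> (t <= q)%N && (t <= 1)%N.
Proof. by case/orP=> /andP[_ /eqP->]. Qed.
Let Ou r r' t : Ov r t -> Ov r' t -> r = r'.
Proof. by case/orP=> /andP[/eqP-> /eqP->] /orP[] /andP[/eqP-> /eqP]. Qed.

Let nilA : lie_nilpotent (calg K v) p.
Proof.
apply: (@lie_nilpotent_hook K a q e h Ov e0 eh Oc Ou p true true) => //.
by move: lep; lia.
Qed.

Let hitE r t : (r < e)%N -> (t < 2)%N -> hit Ov (1%g : 'S_(sumn lam)) r t = Ov r t.
Proof. by move=> re t2; rewrite hit_id // nth_hook_shape //; lia. Qed.

(** As a is even, (0, 1) is made special to give a + 1 letters of even color in row 0, an odd
    number; row 2 enters the first commutator by the special cell (2, 0), and [y_1, y_2] contributes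
    its central part. *)
Theorem appears_odd_column_odd_even : appears K p lam.
Proof.
pose m := h./2.-1; have hm : (3 + m.*2 = h)%N.
  by rewrite /m; have := odd_double_half h; rewrite odd_h; lia.
pose hd := [:: [:: 1%N & nseq a.+1 0%N ++ [:: 2; 0]]; [:: 1; 2]]%N.
pose S := cells 1%g 1%N [:: 0%N] :|: (cells 1%g 0%N [:: 0; 1]%N :|:
  (cells 1%g 2%N [:: 0; 1]%N :|: cells 1%g 0%N [:: 0%N])) :|: @inner_cells a q e h Ov 1%N 2%N.
have odd_s : odd a.+1 by [].
apply: (appears_hook (Ov := Ov) (hd := hd) (o := 3) (m := m) (S := S) charK e0 eh Ou) => //.
- by rewrite hm.
- by move=> r t; rewrite hm /Ov; lia.
- move=> r; rewrite hm nth_hook_shape //= !count_cat count_nseq /=.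
  by case: r => [|[|[|r]]] /=; [lia|lia|lia|case: ltnP => rh /=; lia].
- move=> x; rewrite hm !in_setU => xS; suff : (crow x < 3)%N by lia.
  by case/orP: xS => [/orP[/mem_cells_row->|/orP[/mem_cells_row->|/orP[]/mem_cells_row->]]|/crow_inner_cells[]->].
- rewrite -(eq_comm_prod _ (@row_element1 K lam v)) !comm_prod_cons /comm_prod big_nil mulr1.
  rewrite lcommutator_nseq2 ad_fourth_row //.
  rewrite -![lcommutator (map _ [:: _; _])]/(ad _ _).
  have g1 : gamma 1%g 1%N = 0 by apply: gamma0; rewrite ?hitE /Ov //; lia.
  rewrite (ad_hook Ov charK e0 eh 1%N 2%N one) g1 !mul0r !addr0.
  rewrite (@gamma_pow0 K a q e h Ov charK e0 eh Oc 1%g 0%N a.+2) ?hitE /Ov //; try lia.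
  rewrite mulr0 mul0r addr0 -mulrDr -[X in _ * X]expr1.
  rewrite (absorb_tail charK _ _ _ _ _ _ _ (chomM (chomX cp) (chomM cp cp))).
  apply: pureM; [|apply: pureMn_exp2 => //; do 3?apply: pureM|apply: Z_pure => //; try lia].
  + disj.
  + disj.
  + by apply: alpha_pure => //; rewrite /Ov; lia.
  + disj.
  + by apply: gamma_pure; rewrite ?hitE /Ov //; lia.
  + disj.
  + by rewrite -[gamma 1%g 2%N]expr1; apply: gamma_pure; rewrite ?hitE /Ov //; lia.
  + by apply: alpha_pure => //; rewrite /Ov; lia.
move=> c cc hx; rewrite comm_prod_cons lcommutator_nseq2 ad_fourth_row //.
(* If the letter of (0, 1) has left row 0, that row either has no letter of color 0 or too few of
   even color. Otherwise the letter of (2, 0) has left row 2. *)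
case: (boolP (hit Ov c 0 1)) => h01; last first.
  rewrite (@gamma_pow0 K a q e h Ov charK e0 eh Oc c 0%N a.+2) //; last 2 first.
  - by lia.
  - by rewrite (negPf h01) mul1n addn0; case: (hit Ov c 0 0); lia.
  rewrite mulr0 mul0r addr0; case: (boolP (hit Ov c 0 0)) => h00.
    by rewrite (alpha0 K cc h00) !(mulr0, mul0r) addr0 mul0rn mul0r.
  rewrite (@gamma_pow0 K a q e h Ov charK e0 eh Oc c 0%N a.+1) //; try lia.
  by rewrite !(mulr0, mul0r) addr0 mul0rn mul0r.
have h20 : ~~ hit Ov c 2 0.
  case: hx => x /andP[/orP[]/andP[/eqP x0 /eqP x1]]; rewrite x0 x1 //.
  by rewrite h01.
have h21 : ~~ hit Ov c 2 1 by apply/negP => /(hit_uniq Ou cc h01).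
have g2 : gamma c 2%N = 0 by apply: gamma0 => //; lia.
by rewrite g2 !(mulr0, mul0r) !addr0 mul0rn mul0r.
Qed.
End EvenArm.
End OddRows.
End OddColumn.

Theorem appears_paired_rows (K : fieldType) (p m : nat) (lam : seq nat) :
    [pchar K] =i pred0 -> size lam = m.*2 -> all (leq 1) lam ->
    (forall t, (t < m)%N -> nth 0%N lam t.*2 = nth 0%N lam t.*2.+1) ->
    (sumn lam + 2 <= p + size lam)%N || (sumn lam < 2 * p)%N ->
  appears K p lam.
Proof.
move=> charK szl pos len lep.
pose v (x : 'I_(sumn lam)) := [:: kappa (ccol x)].
have nilA : lie_nilpotent (calg K v) p.
  apply: (@lie_nilpotent_shape K lam v p 0 0 set0 set0) => //; rewrite ?cards0 ?addn0 //.
  by move=> x; rewrite inE /v; case: (ccol x).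
apply: (@appears_of_special K lam v charK p [::] 0 m set0 pred0 nilA) => //.
- move=> r; rewrite add0n /=; case: ltnP => // mr.
  by rewrite nth_default // szl.
- by move=> x; rewrite inE.
- by rewrite /comm_prod big_nil; apply: pure1.
- by move=> x y _ _ xy; rewrite /v xy.
- by move=> x _; rewrite color_dot1 eqxx.
- by move=> c _ [].
Qed.

Section DoubledCorner.
Variables (K : fieldType) (q e h p : nat).
Hypothesis charK : [pchar K] =i pred0.
Hypotheses (e1 : (1 < e)%N) (eh : (e <= h)%N) (ev_e : ~~ odd e) (odd_h : odd h) (q0 : (0 < q)%N).
Local Notation lam := (hook_shape 0 q e h).
Hypothesis lep : (sumn lam + 2 <= p + h)%N || (sumn lam + 1 < 2 * p)%N.

Let e0 : (0 < e)%N := ltnW e1.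
Let v (x : 'I_(sumn lam)) : seq nat :=
  if (crow x == 1%N) && (ccol x == 1%N) then [:: 2; 0]%N else [:: kappa (ccol x)].
Local Notation A := (calg K v).
Local Notation z := (@letter K (sumn lam) v).
Local Notation cells := (@cells lam v).
Local Notation pt := (@part K lam v).
Local Notation cp := (@chom_part _ _ _ _ _ _).
Implicit Types (c : 'S_(sumn lam)).

Let eh' : (e <= h.-1)%N.
Proof. have : e != h by apply: contraNneq ev_e => ->. by lia. Qed.

Let nth_lam r : nth 0%N lam r = ((r < e)%N * q + (r < h)%N)%N.
Proof. by rewrite nth_hook_shape // muln0 add0n. Qed.

Let col_le (x : 'I_(sumn lam)) : (ccol x <= q)%N.
Proof. by have := ccol_lt x; rewrite nth_lam; case: (_ < e)%N; case: (_ < h)%N => /=; lia. Qed.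

Let special : exists x : 'I_(sumn lam), crow x = 1%N /\ ccol x = 1%N.
Proof. by have [|x ? ?] := @cellP lam 1 1; [rewrite nth_lam; lia | exists x]. Qed.

Let nilA : lie_nilpotent A p.
Proof.
have [x0 [x0r x0c]] := special.
apply: (@lie_nilpotent_shape K lam v p 0 1 set0 [set x0]); rewrite ?cards0 ?cards1 //.
- exact: hook_shape_pos.
- move=> x; rewrite inE /v; case: ifP => [/andP[_ /eqP->] //|_].
  by case: (ccol x).
- move=> x; rewrite inE /v; case: ifP => // /andP[/eqP xr /eqP xc].
  by rewrite (_ : x == x0) //; apply/eqP/cell_inj; congruence.
- by rewrite size_hook_shape // addn0.
Qed.

Let pi c r := pt c r [:: 2; 0]%N.
Let B c r := \sum_(j <- 0%N :: inner q) pt c r [:: j].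

Let row_split c r : c \in col_stab lam -> row_element (z \o c) r = pi c r + B c r.
Proof.
move=> cc; rewrite (@row_parts K lam v c r ([:: 2; 0]%N :: [seq [:: j] | j <- 0%N :: inner q])).
- by rewrite big_cons big_map.
- rewrite cons_uniq map_inj_uniq => [|i j [] //]; rewrite cons_uniq inner_uniq andbT.
  apply/andP; split; first by apply/mapP => -[j _].
  by apply/negP => /(allP (inner_ge2 q)).
move=> x xr; rewrite /v (col_stab_col x cc) inE; apply/orP.
case: ifP => _; [by left | right; apply: map_f].
case: (posnP (ccol x)) => [->|xp]; first by rewrite inE eqxx.
by rewrite inE; apply/orP; right; apply: map_f; rewrite mem_iota; have := col_le x; lia.
Qed.

Let last_row c : c \in col_stab lam -> row_element (z \o c) h.-1 = pt c h.-1 [:: 0%N].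
Proof.
move=> cc; rewrite (@row_parts K lam v c h.-1 [:: [:: 0%N]]) ?big_seq1 //.
move=> x xr; rewrite /v (col_stab_col x cc); have := ccol_lt x; rewrite xr nth_lam.
have -> : (h.-1 < e)%N = false by lia.
by case: (ccol x) => [|t]; [rewrite andbF inE | case: (_ < h)%N].
Qed.

Let ad_last c : c \in col_stab lam ->
  ad (row_element (z \o c) h.-1) (row_element (z \o c) 1%N) =
  (pi c 1%N * pt c h.-1 [:: 0%N] + pt c 1%N [:: 0%N] * pt c h.-1 [:: 0%N]) *+ 2.
Proof.
move=> cc; rewrite last_row // row_split // adD mulrnDl /B big_cons adD.
rewrite ad_anti; last by apply: acomm cp cp _; cdot.
rewrite ad_anti; last by apply: acomm cp cp _; cdot.
rewrite [ad _ (\sum_(_ <- _) _)]ad_comm ?addr0 //.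
apply/esym; apply: (@neutral_sum K _ v (inner q) (fun j => pt c 1%N [:: j]) (inner_ge2 q) _ [:: 0%N]) => //.
  by move=> j; apply: chom_part.
exact: cp.
Qed.

(** The unpaired last row is absorbed by [y_1, y_(h-1), y_0]: the special letter of row 1 brackets
    with color 0 of the last row and then with color 2 of row 0. The q other colors of rows 0 and 1
    are left for [y_1, y_0]^q. If the special letter leaves row 1, the first bracket is central and
    the second is 0. *)
Theorem appears_doubled_corner : appears K p lam.
Proof.
have [x0 [x0r x0c]] := special.
have one := @col_stab1 0 q e h.
have vx0 : v x0 = [:: 2; 0]%N by rewrite /v x0r x0c.
have v2 x : v x = [:: 2; 0]%N -> x = x0.
  by rewrite /v; case: ifP => // /andP[/eqP xr /eqP xc] _; apply: cell_inj; congruence.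
pose m := h./2.-1; have hm : (2 + m.*2 = h.-1)%N.
  by rewrite /m; have := odd_double_half h; rewrite odd_h; lia.
pose hd := [:: 1; h.-1; 0]%N :: nseq q [:: 1; 0]%N.
pose J := 0%N :: map kappa (iota 2 q.-1).
have uJ : uniq J.
  rewrite cons_uniq map_inj_uniq ?iota_uniq ?andbT; last exact: kappa_inj.
  by apply/mapP => -[t]; rewrite mem_iota; case: t.
have szJ : size J = q by rewrite /= size_map size_iota prednK.
have J2 j : j \in J -> j != 2%N.
  rewrite inE => /orP[/eqP->//|/mapP[t]]; rewrite mem_iota => t2 ->.
  by case: t t2 => [|[]].
pose kap r := pt 1%g r [:: 2%N].
pose B' r := \sum_(j <- J) pt 1%g r [:: j].
have BE r : B 1%g r = kap r + B' r.
  have iq : inner q = 2%N :: map kappa (iota 2 q.-1) by rewrite /inner -{1}(prednK q0).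
  by rewrite /B /B' /J iq !big_cons addrCA.
have kap1 : kap 1%N = 0.
  apply: part_empty; apply: card_cells0 => x xr; rewrite perm1 /v xr /=.
  by case: (ccol x) => [|[|t]].
have pi0 : pi 1%g 0%N = 0.
  by apply: part_empty; apply: card_cells0 => x xr; rewrite perm1 /v xr /= eqseq_cons andbF.
have pi1 : pi 1%g 1%N = z x0.
  rewrite /pi /part (_ : cells 1%g 1%N [:: 2; 0]%N = [set x0]) ?big_set1 //.
  apply/setP => x; rewrite mem_cells1 inE; apply/andP/eqP => [[_ /eqP/v2//]|->].
  by rewrite x0r vx0.
pose W := ad (B' 0%N) (B' 1%N).
have W_central x : W * x = x * W.
  by apply/chom_nil_central/chom_ad_orthogonal => // j; apply: chom_part.
pose S := cells 1%g 1%N [:: 2; 0]%N :|: (cells 1%g h.-1 [:: 0%N] :|: cells 1%g 0%N [:: 2%N])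
  :|: \bigcup_(j <- J) (cells 1%g 1%N [:: j] :|: cells 1%g 0%N [:: j]).
have crowS x : x \in \bigcup_(j <- J) (cells 1%g 1%N [:: j] :|: cells 1%g 0%N [:: j]) ->
    crow x = 0%N \/ crow x = 1%N.
  apply: (big_rec (fun U : {set 'I__} => x \in U -> crow x = 0%N \/ crow x = 1%N)) => [|j U _ IH].
    by rewrite inE.
  by rewrite !in_setU => /orP[/orP[]/mem_cells_row->|/IH]; auto.
have dS r w : (forall j, j \in J -> (r != 0%N) && (r != 1%N) || ([:: j] != w)) ->
    [disjoint cells 1%g r w & \bigcup_(j <- J) (cells 1%g 1%N [:: j] :|: cells 1%g 0%N [:: j])].
  move=> hw; rewrite disjoint_sym; apply: disjoint_bigcup_seq => j /hw jw.
  rewrite -setI_eq0 setIUl setU_eq0 !setI_eq0 !disjoint_cells //.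
    by case/orP: jw => [/andP[r0 _]|->]; rewrite ?orbT // eq_sym r0.
  by case/orP: jw => [/andP[_ r1]|->]; rewrite ?orbT // eq_sym r1.
apply: (@appears_of_special K lam v charK p hd 2 m S (pred1 x0) nilA).
- by rewrite /= all_nseq orbT.
- move=> t tm; rewrite !nth_lam.
  have -> : ((2 + t.*2).+1 < e)%N = (2 + t.*2 < e)%N.
    by have := odd_double_half e; rewrite (negPf ev_e) add0n; lia.
  have -> : (2 + t.*2 < h)%N by lia.
  by have -> : ((2 + t.*2).+1 < h)%N by lia.
- move=> r rr x xr; rewrite /v xr; case: (r =P 1%N) => // r1; lia.
- move=> r; rewrite hm nth_lam /= count_flatten_nseq2.
  case: r => [|[|r]] /=; [lia|lia|].
  by case: (ltngtP r.+2 h.-1) => rh /=; lia.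
- move=> x; rewrite hm !in_setU => xS; suff : (crow x < 2)%N \/ crow x = h.-1 by lia.
  case/orP: xS => [/orP[/mem_cells_row->|/orP[]/mem_cells_row->]|/crowS[]->]; auto.
- rewrite -(eq_comm_prod _ (@row_element1 K lam v)) comm_prod_cons comm_prod_nseq.
  rewrite -[lcommutator _]/(ad (row_element (z \o (1%g : 'S__)) 0%N) (ad (row_element (z \o (1%g : 'S__)) h.-1) (row_element (z \o (1%g : 'S__)) 1%N))).
  rewrite ad_last // !row_split // pi0 add0r !BE kap1 add0r.
  have -> : ad (kap 0%N + B' 0%N) ((pi 1%g 1%N * pt 1%g h.-1 [:: 0%N] + pt 1%g 1%N [:: 0%N] * pt 1%g h.-1 [:: 0%N]) *+ 2)
     = (pi 1%g 1%N * (pt 1%g h.-1 [:: 0%N] * kap 0%N)) *+ 2 ^ 2.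
    have hu : @chom K _ v [:: 2%N] (pi 1%g 1%N * pt 1%g h.-1 [:: 0%N]).
      by apply: chom_parity_eq (chomM cp cp) => k; rewrite /=; lia.
    have hw : @chom K _ v [::] (pt 1%g 1%N [:: 0%N] * pt 1%g h.-1 [:: 0%N]).
      by apply: chom_parity_eq (chomM cp cp) => k; rewrite /=; lia.
    rewrite adMn adD [X in (_ + X) *+ _ = _](_ : _ = 0); last first.
      by apply: ad_comm; apply/esym/chom_nil_central.
    rewrite addr0 adDl [X in (_ + X) *+ _ = _](_ : _ = 0); last first.
      rewrite ad_suml big_seq big1 // => j /J2 j2; apply: ad_comm.
      by apply: ccomm hu cp _; rewrite color_dot1 eq_sym.
    rewrite addr0 ad_anti; last by apply: acomm hu cp _; rewrite color_dot1.
    by rewrite -mulrA -mulrnA.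
  have -> : ad (kap 0%N + B' 0%N) (pi 1%g 1%N + B' 1%N) = ad (kap 0%N + B' 0%N) (pi 1%g 1%N) + W.
    rewrite adD; congr (_ + _); rewrite adDl [X in X + _ = _](_ : _ = 0) ?add0r //.
    rewrite ad_sum big_seq big1 // => j /J2 j2; apply: ad_comm.
    by apply: ccomm cp cp _; rewrite color_dot1.
  rewrite mul_expr_absorb //; last first.
    rewrite mulrnAl (_ : _ * _ = 0) ?mul0rn //.
    rewrite pi1; apply: (@divl_mul0 K _ v x0); first exact/divlMl/divl_letter.
    by apply: divlB; [apply: divlMl | apply: divlMr]; exact: divl_letter.
  apply: pureM.
  + rewrite -setI_eq0 ?(setIUl, setIUr, setU_eq0) !setI_eq0.
    apply/and3P; split; apply: dS => j jJ; first by rewrite eqseq_cons /= andbF.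
      by apply/orP; left; lia.
    by apply/orP; right; rewrite eqseq_cons andbT J2.
  + apply: pureMn_exp2 => //; apply: pureM; last apply: pureM.
    * by rewrite -setI_eq0 setIUr setU_eq0 !setI_eq0 !disjoint_cells //; apply/orP; left; lia.
    * apply: part_single; apply: (@card_cells_at _ _ 1%g 1%N 1%N); first by rewrite nth_lam; lia.
      by move=> x xr; rewrite perm1 /v xr /=; case: (ccol x) => [|[|t]].
    * by rewrite disjoint_cells //; apply/orP; left; lia.
    * apply: part_single; apply: (@card_cells_at _ _ 1%g h.-1 0%N); first by rewrite nth_lam; lia.
      move=> x xr; rewrite perm1 /v xr; have -> : (h.-1 == 1)%N = false by lia.
      by rewrite /=; case: (ccol x).
    * apply: part_single; apply: (@card_cells_at _ _ 1%g 0%N 1%N); first by rewrite nth_lam; lia.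
      by move=> x xr; rewrite perm1 /v xr /=; case: (ccol x) => [|[|t]].
  + rewrite -[X in W ^+ X]szJ; apply: pair_power => // j; rewrite inE => /orP[/eqP->|/mapP[t]].
      split; apply: (@card_cells_at _ _ 1%g _ 0%N); rewrite ?nth_lam; try lia.
        by move=> x xr; rewrite perm1 /v xr /=; case: (ccol x) => [|[|t]].
      by move=> x xr; rewrite perm1 /v xr /=; case: (ccol x) => [|[|t]].
    rewrite mem_iota => t2 ->; have tq : (t <= q)%N by lia.
    split; apply: (@card_cells_at _ _ 1%g _ t); rewrite ?nth_lam; try lia.
      move=> x xr; rewrite perm1 /v xr /=; case: (ccol x =P 1%N) => [->|_].
        by apply/eqP/eqP => [//|t1]; lia.
      by rewrite eqseq_cons andbT; apply/eqP/eqP => [/kappa_inj|->].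
    move=> x xr; rewrite perm1 /v xr /= eqseq_cons andbT.
    by apply/eqP/eqP => [/kappa_inj|->].
- move=> x y nx ny xy; have nv w : w != x0 -> v w = [:: kappa (ccol w)].
    rewrite /v; case: ifP => // /andP[/eqP wr /eqP wc] /eqP[].
    by apply: cell_inj; congruence.
  by rewrite !nv // xy.
- move=> x nx; rewrite /v; case: ifP => [/andP[/eqP xr /eqP xc]|_]; last by rewrite color_dot1 eqxx.
  by case/eqP: nx; apply: cell_inj; congruence.
move=> c cc [x /eqP -> cx].
rewrite comm_prod_cons -[lcommutator _]/(ad (row_element (z \o c) 0%N) (ad (row_element (z \o c) h.-1) (row_element (z \o c) 1%N))).
have pi10 : pi c 1%N = 0.
  apply: part_empty; apply: card_cells0 => y yr; apply/eqP => /v2 cy.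
  case/eqP: cx; apply: cell_inj; last exact: col_stab_col.
  have yc : ccol y = 1%N by rewrite -(col_stab_col y cc) cy x0c.
  have -> : x0 = y by apply: cell_inj; congruence.
  by rewrite cy x0r yr.
rewrite ad_last // pi10 mul0r add0r ad_comm ?mul0r //.
apply/esym; apply: chom_nil_central; apply: chomMn.
by apply: chom_parity_eq (chomM cp cp) => k; rewrite /=; lia.
Qed.
End DoubledCorner.

(** * Parity cases and the partitions of the theorem *)

Local Open Scope nat_scope.

Section Shapes.
Variables (K : fieldType) (p : nat).
Hypothesis charK : [pchar K]%R =i pred0.

(** Here the corner exchanges with row 1, whose remaining q cells are used up by [y_1, y_0]^q. *)
Lemma appears_corner_even a q e h : 1 < e -> e <= h -> ~~ odd e -> ~~ odd h -> odd a ->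
    (sumn (hook_shape a q e h) + 3 <= p + h) || (sumn (hook_shape a q e h) + a.+1 < 2 * p) ->
  appears K p (hook_shape a q e h).
Proof.
move=> e1 eh ev_e ev_h odd_a lep; have e0 := ltnW e1.
pose m := h./2.-1; have hm : 2 + m.*2 = h.
  by rewrite /m; have := odd_double_half h; rewrite (negPf ev_h) add0n; lia.
pose Ov (r t : nat) := (r == 0) && ((t == 0) || false && (t == 1)).
apply: (@appears_corner_gamma K a q e h p false 1 q 2 m charK e0 eh _ _ _ _ _ _ _ _ _ _
  (@inner_cells a q e h Ov 1 0)) => //; rewrite ?addn0 ?hm //.
- by lia.
- by rewrite (negPf ev_e).
- by move: lep; lia.
- move=> r; rewrite nth_hook_shape //= count_cat count_nseq count_flatten_nseq2.
  case: r => [|[|r]] /=; [lia|lia|].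
  by case: ltnP => rh /=; lia.
- by apply: Z_pure => //; case.
- by move=> x /crow_inner_cells[->|->]; auto.
move=> c r w w2; rewrite disjoint_sym; apply: disjoint_bigcup_seq => j /(allP (inner_ge2 q)) j2.
have nw : [:: j] != w by apply: contraTneq w2 => <-; rewrite /= andbT -leqNgt j2.
rewrite -setI_eq0; apply/eqP/setP => x; rewrite !inE.
apply/negP => /andP[jx /andP[_ /eqP xw]].
by case/orP: jx => /andP[_ /eqP xj]; rewrite -xw xj eqxx in nw.
Qed.

(** Here the corner exchanges with the last row, a single cell, so no further commutator is left
    over and rows 1 to h - 2 are paired. *)
Lemma appears_corner_odd_column a e h : 2 < e -> e <= h -> odd e -> ~~ odd h -> ~~ odd a ->
    (sumn (hook_shape a 1 e h) + 3 <= p + h) || (sumn (hook_shape a 1 e h) + a.+2 < 2 * p) ->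
  appears K p (hook_shape a 1 e h).
Proof.
move=> e3 eh odd_e ev_h ev_a lep; have e0 : 0 < e by lia.
pose m := h./2.-1; have hm : 1 + m.*2 = h.-1.
  by rewrite /m; have := odd_double_half h; rewrite (negPf ev_h) add0n; lia.
apply: (@appears_corner_gamma K a 1 e h p true h.-1 0 1 m charK e0 eh _ _ _ _ _ _ _ _ _ _ set0) => //;
  rewrite ?addn1 ?hm //; try lia.
- move=> r; rewrite nth_hook_shape //= cats0 count_nseq.
  case: r => [|r] /=; first by lia.
  by case: (ltngtP r.+1 h.-1) => rh /=; lia.
- by rewrite expr0; apply: pure1.
- by move=> x; rewrite inE.
- by move=> c r w _; rewrite disjoint_sym disjoints_subset sub0set.
Qed.

(** For odd a a special cell in column 0 costs one in both counts. For a = 0 and odd h the doubled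
    corner costs one in the total count only. *)
Theorem appears_even_columns a q e h : 1 < e -> e <= h -> ~~ odd e ->
    ((a == 0) && odd h -> 0 < q) ->
    (a + e * q + 2 + odd a <= p) || (a + e * q + h + a + odd a + ((a == 0) && odd h) < 2 * p) ->
  appears K p (hook_shape a q e h).
Proof.
move=> e1 eh ev_e hq lep; have e0 := ltnW e1.
have sE := @sumn_hook_shape a q e h e0 eh.
case: (posnP a) => [a0|a_gt0].
  case: (boolP (odd h)) => odd_h.
    rewrite a0 in lep hq sE *; apply: appears_doubled_corner => //; first exact: hq.
    by rewrite sE; move: lep; rewrite odd_h /=; lia.
  apply: (@appears_paired_rows K p h./2) => //.
  - by rewrite size_hook_shape //; have := odd_double_half h; rewrite (negPf odd_h) add0n.
  - exact: hook_shape_pos.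
  - move=> t th; rewrite !nth_hook_shape // a0 !muln0.
    have -> : (t.*2.+1 < e) = (t.*2 < e).
      by have := odd_double_half e; rewrite (negPf ev_e) add0n; lia.
    have := odd_double_half h; rewrite (negPf odd_h) add0n => hh.
    have -> : t.*2 < h by lia.
    by have -> : t.*2.+1 < h by lia.
  - by rewrite sE size_hook_shape //; move: lep; rewrite a0 /=; lia.
case: (boolP (odd a)) lep => odd_a lep; rewrite (gtn_eqF a_gt0) /= in lep.
  case: (boolP (odd h)) => odd_h.
    by apply: appears_hook_odd_odd => //; rewrite sE; lia.
  by apply: appears_corner_even => //; rewrite sE; lia.
case: (boolP (odd h)) => odd_h.
  by apply: appears_hook_even_odd => //; rewrite sE; lia.
by apply: appears_hook_even_even => //; rewrite sE; lia.
Qed.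

(** A special cell in column 1 always costs one in the total count; for even a another one in column
    0 costs one in both. *)
Theorem appears_odd_column a e h : 2 < e -> e <= h -> odd e ->
    (a + e + 2 + ~~ odd a <= p) || (a + e + h + a + 1 + ~~ odd a < 2 * p) ->
  appears K p (hook_shape a 1 e h).
Proof.
move=> e3 eh odd_e lep; have e0 : 0 < e by lia.
have sE := @sumn_hook_shape a 1 e h e0 eh; rewrite muln1 in sE.
case: (boolP (odd a)) lep => odd_a lep; case: (boolP (odd h)) => odd_h.
- by apply: appears_odd_column_odd_odd => //; rewrite sE; move: lep => /=; lia.
- by apply: appears_odd_column_even => //; rewrite sE; move: lep => /=; lia.
- by apply: appears_odd_column_odd_even => //; rewrite sE; move: lep => /=; lia.
- by apply: appears_corner_odd_column => //; rewrite sE; move: lep => /=; lia.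
Qed.

Theorem appears_near_two_columns a b c : 0 < b + c ->
    (a + b + 3 + ~~ odd (a + b) <= p) || (2 * (a + b) + 3 + c + ~~ odd (a + b) < 2 * p) ->
  appears K p ([:: a + 2] ++ nseq b 2 ++ nseq c 1).
Proof.
move=> bc lep; case: (boolP (odd b)) => odd_b.
  have -> : [:: a + 2] ++ nseq b 2 ++ nseq c 1 = hook_shape a 1 b.+1 (b.+1 + c).
    by rewrite /hook_shape addKn -addnA.
  have b0 : 0 < b by case: (b) odd_b.
  apply: appears_even_columns => //; rewrite ?leq_addr //= ?odd_b //.
  by move: lep; rewrite oddD odd_b addbT negbK; case: (odd a); case: (_ && _) => /=; lia.
case: (posnP b) => [b0|b_gt0].
  (* For b = 0 the shape is a hook; with no additional column the height e is free, and 2 makes it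
     even. *)
  rewrite b0 in bc lep *; have -> : [:: a + 2] ++ nseq 0 2 ++ nseq c 1 = hook_shape a.+1 0 2 c.+1.
    by case: c bc {lep} => // c _; rewrite /hook_shape /=; congr [:: _, _ & nseq _ _]; lia.
  apply: appears_even_columns => //.
  by move: lep; rewrite addn0 /=; case: (odd a) => /=; lia.
have -> : [:: a + 2] ++ nseq b 2 ++ nseq c 1 = hook_shape a 1 b.+1 (b.+1 + c).
  by rewrite /hook_shape addKn -addnA.
apply: appears_odd_column; rewrite ?leq_addr //=.
  by case: (b) b_gt0 odd_b => [|[]].
by move: lep; rewrite oddD (negPf odd_b) addbF; case: (odd a) => /=; lia.
Qed.
End Shapes.

Theorem mainTheorem9 (K : fieldType) (k p : nat)
    (charK : [pchar K]%R =i pred0) (k_ge1 : 1 <= k)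
    (p_def : p = 2 * k \/ p = 2 * k + 1) :
  [/\ (* (i) *)
      appears K p [:: p - 1; 1] /\ appears K p [:: p - 1; p - 1],
      (* (ii) *)
      forall a b c : nat, 0 < b + c -> a + b + 1 <= 2 * k - 2 ->
        appears K p ([:: a + 2] ++ nseq b 2 ++ nseq c 1),
      (* (iii) *)
      forall l n : nat, 1 <= l -> l <= k - 2 ->
        [/\ 2 * l + 4 <= n ->
              appears K p ([:: l + 3; l + 1] ++ nseq (n - 2 * l - 4) 1),
            2 * l + 4 <= n ->
              appears K p ([:: l + 2; l + 2] ++ nseq (n - 2 * l - 4) 1) &
            2 * l + 3 <= n ->
              appears K p ([:: l + 2; l + 1] ++ nseq (n - 2 * l - 3) 1)],
      (* (iv) *)
      forall n : nat, ~~ odd n -> appears K p (nseq n 1) &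
      p = 2 * k + 1 ->
        (* (v) *)
        (forall a b : nat, 0 < b ->
           a + b + 1 = 2 * k \/ a + b + 1 = 2 * k - 1 ->
           sumn ([:: a + 2] ++ nseq b 2) <= 4 * k ->
           appears K p ([:: a + 2] ++ nseq b 2)) /\
        (* (vi) *)
        (forall a b : nat, a + b + 1 = 2 * k - 1 ->
           sumn ([:: a + 2] ++ nseq b 2 ++ [:: 1]) <= 4 * k ->
           appears K p ([:: a + 2] ++ nseq b 2 ++ [:: 1]))].
Proof.
have p_ge2 : 2 <= p by lia.
split.
- split.
    have -> : [:: p - 1; 1] = hook_shape (p - 2) 0 2 2.
      by rewrite /hook_shape /=; congr [:: _; _]; lia.
    apply: appears_even_columns; rewrite ?andbF //.
    (* For odd p the total count is 2 (p - 2) + 2 + 1 = 2 p - 1, just below the bound. *)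
    by case: (boolP (odd (p - 2))) => op; lia.
  have -> : [:: p - 1; p - 1] = hook_shape 0 (p - 2) 2 2.
    by rewrite /hook_shape /=; congr [:: _; _]; lia.
  by apply: appears_even_columns => //=; lia.
- move=> a b c bc abk; apply: appears_near_two_columns => //.
  (* As 2k - 3 is odd, an even a + b is at most 2k - 4, which leaves room for the extra unit. *)
  apply/orP; left; have := odd_double_half (a + b).
  by case: (odd (a + b)) => /=; lia.
(* All three shapes need exactly 2l + 4 <= p, whatever the number of rows. *)
- move=> l n l1 lk; split=> ln.
  + have -> : [:: l + 3; l + 1] ++ nseq (n - 2 * l - 4) 1 = hook_shape 2 l 2 (n - 2 * l - 2).
      by rewrite /hook_shape /=; congr [:: _, _ & nseq _ _]; lia.
    by apply: appears_even_columns => //; lia.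
  + have -> : [:: l + 2; l + 2] ++ nseq (n - 2 * l - 4) 1 = hook_shape 0 l.+1 2 (n - 2 * l - 2).
      by rewrite /hook_shape /=; congr [:: _, _ & nseq _ _]; lia.
    by apply: appears_even_columns => //; lia.
  + have -> : [:: l + 2; l + 1] ++ nseq (n - 2 * l - 3) 1 = hook_shape 1 l 2 (n - 2 * l - 1).
      by rewrite /hook_shape /=; congr [:: _, _ & nseq _ _]; lia.
    by apply: appears_even_columns => //; lia.
- move=> n ev_n; have n2 : n = n./2.*2 by rewrite -[LHS]odd_double_half (negPf ev_n).
  apply: (@appears_paired_rows K p n./2); rewrite ?size_nseq ?all_nseq ?orbT //.
    move=> t tn; rewrite !nth_nseq; have -> : t.*2 < n by lia.
    by have -> : t.*2.+1 < n by lia.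
  by rewrite sumn_nseq mul1n; lia.
move=> p_odd; split=> [a b b0 ab _|a b ab _].
  rewrite -[nseq b 2]cats0 -[[::]]/(nseq 0 1); apply: appears_near_two_columns; rewrite ?addn0 //.
  (* The count of colors is 4k + 1 for a + b = 2k - 1 and 4k for a + b = 2k - 2, below 2p = 4k + 2;
     in (vi) the additional cell makes it 4k + 1. *)
  apply/orP; right; have := odd_double_half (a + b).
  by case: (odd (a + b)) => /=; lia.
rewrite -[[:: 1]]/(nseq 1 1); apply: appears_near_two_columns; rewrite ?addn1 //.
apply/orP; right; have := odd_double_half (a + b).
by case: (odd (a + b)) => /=; lia.
Qed.
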